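(* Let $\lambda=(\lambda_n)_{n\ge 1}$ be a frequency satisfying (NC). Then $\lambda$ satisfies Bohr's theorem, i.e. every Dirichlet series $D=\sum_n a_n e^{-\lambda_n s}$ in $\mathcal D_\infty^{\mathrm{ext}}(\lambda)$ converges uniformly on $\mathbb C_\varepsilon$ for every $\varepsilon>0$.
   Context: A frequency is a (strictly) increasing sequence $\lambda=(\lambda_n)_{n\ge1}$ of nonnegative real numbers tending to $+\infty$. A $\lambda$-Dirichlet series is a formal series $D=\sum_{n\ge1} a_n e^{-\lambda_n s}$ with $a_n\in\mathbb C$ and $s$ a complex variable. For $\theta\in\mathbb R$, $\mathbb C_\theta=\{s\in\mathbb C:\ \mathrm{Re}\,s>\theta\}$. $\mathcal D_\infty^{\mathrm{ext}}(\lambda)$ is the space of $\lambda$-Dirichlet series which converge at some point of $\mathbb C$ and whose sum function has a bounded holomorphic extension to $\mathbb C_0$. Condition (NC): for every $\delta>0$ there exists $C>0$ such that for every $n\ge1$ there exists $m>n$ with $$\log\left(\frac{\lambda_m+\lambda_n}{\lambda_m-\lambda_n}\right)+(m-n)\le Ce^{\delta\lambda_n}.$$ *)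

(* Defs.v *)
From Stdlib Require Export Reals.
From Coquelicot Require Export Coquelicot.

Open Scope R_scope.

(* Indices are shifted by one: [lam n] is the (n+1)-st frequency, so that
   [n : nat] ranges over all of them, and likewise for the coefficients. *)
Definition is_frequency (lam : nat -> R) : Prop :=
  (forall n, 0 <= lam n) /\
  (forall n, lam n < lam (S n)) /\
  is_lim_seq lam p_infty.

(* Insensitive to the index shift, since only [m - n] involves the indices. *)
Definition condition_NC (lam : nat -> R) : Prop :=
  forall delta : R, 0 < delta ->
  exists C0 : R, 0 < C0 /\
    forall n : nat, exists m : nat, (n < m)%nat /\
      ln ((lam m + lam n) / (lam m - lam n)) + (INR m - INR n)
        <= C0 * exp (delta * lam n).

Definition Cexp (z : C) : C := (exp (Re z) * cos (Im z), exp (Re z) * sin (Im z)).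

Definition half_plane (theta : R) (s : C) : Prop := theta < Re s.

Definition dirichlet_term (lam : nat -> R) (a : nat -> C) (s : C) (n : nat) : C :=
  Cmult (a n) (Cexp (Copp (Cmult (RtoC (lam n)) s))).

Definition dirichlet_is_sum (lam : nat -> R) (a : nat -> C) (s l : C) : Prop :=
  @is_series C_AbsRing C_NormedModule (dirichlet_term lam a s) l.

Definition dirichlet_converges (lam : nat -> R) (a : nat -> C) (s : C) : Prop :=
  exists l : C, dirichlet_is_sum lam a s l.

Definition abscissa_conv (lam : nat -> R) (a : nat -> C) : Rbar :=
  Glb_Rbar (fun theta : R =>
    forall s : C, half_plane theta s -> dirichlet_converges lam a s).

Definition holomorphic_on (f : C -> C) (U : C -> Prop) : Prop :=
  forall s : C, U s -> @ex_derive C_AbsRing C_NormedModule f s.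

Definition bounded_on (f : C -> C) (U : C -> Prop) : Prop :=
  exists M : R, forall s : C, U s -> Cmod (f s) <= M.

(* The sum function lives on the open half-plane of convergence, which may be
   larger than the right half-plane; [f] extends it in the sense that both agree
   wherever both are defined. The values of [f] outside the right half-plane
   are irrelevant. *)
Definition D_infty_ext (lam : nat -> R) (a : nat -> C) : Prop :=
  (exists s0 : C, dirichlet_converges lam a s0) /\
  exists f : C -> C,
    holomorphic_on f (half_plane 0) /\
    bounded_on f (half_plane 0) /\
    forall s : C, half_plane 0 s -> Rbar_lt (abscissa_conv lam a) (Re s) ->
      dirichlet_is_sum lam a s (f s).

Definition dirichlet_converges_uniformly_on
    (lam : nat -> R) (a : nat -> C) (U : C -> Prop) : Prop :=
  exists g : C -> C, forall eta : R, 0 < eta ->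
    exists N0 : nat, forall N : nat, (N0 <= N)%nat ->
      forall s : C, U s ->
        Cmod (Cminus (@sum_n C_AbelianMonoid (dirichlet_term lam a s) N) (g s)) < eta.

Definition satisfies_Bohr_theorem (lam : nat -> R) : Prop :=
  forall a : nat -> C, D_infty_ext lam a ->
    forall eps : R, 0 < eps ->
      dirichlet_converges_uniformly_on lam a (half_plane eps).

(* Main.v *)
Require Import Defs.
From Stdlib Require Import Lra Lia Psatz.

(** Integrating [f (s + z)] over a line [Re z = c] against the Perron-type kernel
    [(exp (q z) - exp (p z)) / (2 pi (q - p) z^2)], with [p = lam N < q = lam m], weights the
    term of frequency [l] by the trapezoid equal to [1] for [l <= p] and [0] for [l >= q].
    The line lies in the right half-plane, so only the bound of [f] enters; for [c = 1 / q]
    the [L^1]-norm of the kernel is [O(1 + log ((q + p) / (q - p)))]. The terms strictly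
    between [N] and [m] are controlled by the coefficient bound [|a_k| <= C sup |f|], a mean
    value of [f (s + z) exp (lam k z)]. Hence [S_N = O(log ((q + p) / (q - p)) + m - N)]
    on the whole right half-plane, which is [O(exp (delta lam N))] by (NC), and Abel
    summation gives uniform convergence.

    The series need not converge absolutely anywhere, so it cannot be integrated term by
    term. Instead, a fixed partial sum is subtracted from [f], and the integral of the
    difference over [-T <= Im z <= T] is moved to [Re z = +oo] by Cauchy's theorem. *)

Local Open Scope C_scope.

(** * Complex differentiability *)

(** The abscissa of convergence may be positive, and to its left the tail [f - S_n] is only known to
    be bounded. Decay at rate [lam (S n)] holds far to the right, where Abel summation costs a
    factor linear in [Im z]. The mean-value kernel [exp (l z) / (2 T)] is only [O(1 / T)] on the
    horizontal sides, so that factor would not vanish as [T] grows. Averaging the two bounds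
    geometrically leaves a square root, at the price of half the decay rate; this is harmless, since
    the index [n] of the subtracted partial sum is free and [lam (S n)] may be taken beyond twice
    the growth rate of the kernel.

    With [D = q - p], the numerator of the trapezoid kernel is [O(min (D |z|, 1))] on the line.
    After division by [D |z|^2] the range from [1 / q] to [1 / D] contributes [O(log (q / D))] and
    the rest [O(1)]. The abscissa [1 / q] keeps [exp (q c)] bounded and cuts off the singularity at
    [0].

    Holomorphy is bare differentiability at each point, hence Goursat's subdivision. The one residue
    needed, that of [exp (nu z) / z^2], comes from explicit logarithms and arctangents. *)

Definition is_cderiv (f : C -> C) (z l : C) : Prop :=
  forall eps : R, (0 < eps)%R -> exists d : R, (0 < d)%R /\
    forall w : C, (Cmod (w - z) < d)%R ->
      (Cmod (f w - f z - l * (w - z)) <= eps * Cmod (w - z))%R.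

Definition cdiff (f : C -> C) (z : C) : Prop := exists l, is_cderiv f z l.

Lemma Re_le_Cmod (z : C) : (Rabs (Re z) <= Cmod z)%R.
Proof.
  eapply Rle_trans; [|apply Rmax_Cmod]; apply Rmax_l.
Qed.

Lemma Im_le_Cmod (z : C) : (Rabs (Im z) <= Cmod z)%R.
Proof.
  eapply Rle_trans; [|apply Rmax_Cmod]; apply Rmax_r.
Qed.

Lemma Cmod_le_Re_Im (z : C) : (Cmod z <= Rabs (Re z) + Rabs (Im z))%R.
Proof.
  destruct z as [x y]; unfold Cmod; simpl fst; simpl snd; unfold Re, Im; simpl.
  pose proof (Rabs_pos x); pose proof (Rabs_pos y).
  apply Rsqr_incr_0_var; [|lra].
  rewrite Rsqr_sqrt by nra.
  unfold Rsqr. rewrite <- (Rabs_pos_eq (x * (x * 1))) by nra.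
  rewrite <- (Rabs_pos_eq (y * (y * 1))) by nra.
  rewrite !Rabs_mult, Rabs_R1. nra.
Qed.

Lemma Cmod_minus_sym (z w : C) : Cmod (z - w) = Cmod (w - z).
Proof.
  rewrite <- Cmod_opp; f_equal; ring.
Qed.

Lemma Cmod_triangle_minus (z w : C) : (Cmod (z - w) <= Cmod z + Cmod w)%R.
Proof.
  unfold Cminus; rewrite <- (Cmod_opp w); apply Cmod_triangle.
Qed.

Lemma cdiff_of_ex_derive (f : C -> C) (z : C) :
  @ex_derive C_AbsRing C_NormedModule f z -> cdiff f z.
Proof.
  intros [l [_ Hl]]. exists l. intros eps Heps.
  specialize (Hl z (fun P H => H) (mkposreal eps Heps)).
  destruct Hl as [d Hd]. exists d. split; [apply cond_pos|].
  intros w Hw. specialize (Hd w Hw). simpl in Hd.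
  replace (f w - f z - l * (w - z)) with
     (@minus C_NormedModule (minus (f w) (f z)) (scal (minus w z) l)).
  - exact Hd.
  - unfold minus, plus, opp, scal; simpl. unfold mult; simpl. ring.
Qed.

Lemma is_cderiv_const (c z : C) : is_cderiv (fun _ => c) z 0.
Proof.
  intros eps Heps. exists 1%R. split; [lra|]. intros w _.
  replace (c - c - 0 * (w - z)) with (RtoC 0) by ring.
  rewrite Cmod_0. apply Rmult_le_pos; [lra|apply Cmod_ge_0].
Qed.

Lemma is_cderiv_id (z : C) : is_cderiv (fun w => w) z 1.
Proof.
  intros eps Heps. exists 1%R. split; [lra|]. intros w _.
  replace (w - z - 1 * (w - z)) with (RtoC 0) by ring.
  rewrite Cmod_0. apply Rmult_le_pos; [lra|apply Cmod_ge_0].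
Qed.

Lemma is_cderiv_plus (f g : C -> C) (z l m : C) :
  is_cderiv f z l -> is_cderiv g z m -> is_cderiv (fun w => f w + g w) z (l + m).
Proof.
  intros Hf Hg eps Heps.
  destruct (Hf (eps / 2)%R) as [d [Hd Hf']]; [lra|].
  destruct (Hg (eps / 2)%R) as [d' [Hd' Hg']]; [lra|].
  exists (Rmin d d'). split; [apply Rmin_glb_lt; auto|].
  intros w Hw.
  specialize (Hf' w (Rlt_le_trans _ _ _ Hw (Rmin_l _ _))).
  specialize (Hg' w (Rlt_le_trans _ _ _ Hw (Rmin_r _ _))).
  replace (f w + g w - (f z + g z) - (l + m) * (w - z)) with
    ((f w - f z - l * (w - z)) + (g w - g z - m * (w - z))) by ring.
  eapply Rle_trans; [apply Cmod_triangle|]. lra.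
Qed.

Lemma is_cderiv_lipschitz (f : C -> C) (z l : C) : is_cderiv f z l ->
  exists d : R, (0 < d)%R /\ forall w, (Cmod (w - z) < d)%R ->
    (Cmod (f w - f z) <= (Cmod l + 1) * Cmod (w - z))%R.
Proof.
  intros Hf. destruct (Hf 1%R) as [d [Hd Hf']]; [lra|].
  exists d; split; auto. intros w Hw. specialize (Hf' w Hw).
  replace (f w - f z) with ((f w - f z - l * (w - z)) + l * (w - z)) by ring.
  eapply Rle_trans; [apply Cmod_triangle|]. rewrite (Cmod_mult l). lra.
Qed.

Lemma is_cderiv_mult (f g : C -> C) (z l m : C) :
  is_cderiv f z l -> is_cderiv g z m ->
  is_cderiv (fun w => f w * g w) z (l * g z + f z * m).
Proof.
  intros Hf Hg eps Heps.
  destruct (is_cderiv_lipschitz f z l Hf) as [d1 [Hd1 Lf]].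
  destruct (is_cderiv_lipschitz g z m Hg) as [d2 [Hd2 Lg]].
  set (A := Cmod (g z)). set (B := Cmod (f z)).
  assert (HA : (0 <= A)%R) by apply Cmod_ge_0.
  assert (HB : (0 <= B)%R) by apply Cmod_ge_0.
  destruct (Hf (eps / 3 / (A + 1))%R) as [d3 [Hd3 Hf']].
  { apply Rdiv_lt_0_compat; lra. }
  destruct (Hg (eps / 3 / (B + 1))%R) as [d4 [Hd4 Hg']].
  { apply Rdiv_lt_0_compat; lra. }
  set (P := ((Cmod l + 1) * (Cmod m + 1))%R).
  assert (HP : (0 < P)%R).
  { unfold P; pose proof (Cmod_ge_0 l); pose proof (Cmod_ge_0 m); nra. }
  (* The product of the two increments is at most [P * r ^ 2] by the Lipschitz bounds; this radius
     turns it into a third of the allowed error. The other two thirds go to the linear errors of [f]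
     and [g]. *)
  set (d5 := (eps / 3 / P)%R).
  assert (Hd5 : (0 < d5)%R) by (apply Rdiv_lt_0_compat; lra).
  exists (Rmin d5 (Rmin (Rmin d1 d2) (Rmin d3 d4))).
  split; [repeat apply Rmin_glb_lt; auto|].
  intros w Hw.
  pose proof (Rmin_l d5 (Rmin (Rmin d1 d2) (Rmin d3 d4))).
  pose proof (Rmin_r d5 (Rmin (Rmin d1 d2) (Rmin d3 d4))).
  pose proof (Rmin_l (Rmin d1 d2) (Rmin d3 d4)).
  pose proof (Rmin_r (Rmin d1 d2) (Rmin d3 d4)).
  pose proof (Rmin_l d1 d2). pose proof (Rmin_r d1 d2).
  pose proof (Rmin_l d3 d4). pose proof (Rmin_r d3 d4).
  assert (E1 := Lf w ltac:(lra)). assert (E2 := Lg w ltac:(lra)).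
  assert (E3 := Hf' w ltac:(lra)). assert (E4 := Hg' w ltac:(lra)).
  replace (f w * g w - f z * g z - (l * g z + f z * m) * (w - z)) with
    ((f w - f z) * (g w - g z) + ((f w - f z - l * (w - z)) * g z
      + f z * (g w - g z - m * (w - z)))) by ring.
  set (r := Cmod (w - z)) in *.
  assert (Hr : (0 <= r)%R) by apply Cmod_ge_0.
  eapply Rle_trans; [apply Cmod_triangle|].
  eapply Rle_trans; [apply Rplus_le_compat_l; apply Cmod_triangle|].
  rewrite !Cmod_mult. fold A; fold B.
  assert (F1 : (Cmod (f w - f z) * Cmod (g w - g z) <= eps / 3 * r)%R).
  { apply Rle_trans with (((Cmod l + 1) * r) * ((Cmod m + 1) * r))%R.
    - apply Rmult_le_compat; auto using Cmod_ge_0.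
    - replace (((Cmod l + 1) * r) * ((Cmod m + 1) * r))%R with (P * r * r)%R by (unfold P; ring).
      apply Rmult_le_compat_r; auto.
      apply Rle_trans with (P * d5)%R; [apply Rmult_le_compat_l; lra|].
      unfold d5. right. field. lra. }
  assert (F2 : (Cmod (f w - f z - l * (w - z)) * A <= eps / 3 * r)%R).
  { apply Rle_trans with (eps / 3 / (A + 1) * r * (A + 1))%R.
    - apply Rmult_le_compat; auto using Cmod_ge_0; lra.
    - right; field; lra. }
  assert (F3 : (B * Cmod (g w - g z - m * (w - z)) <= eps / 3 * r)%R).
  { apply Rle_trans with ((B + 1) * (eps / 3 / (B + 1) * r))%R.
    - apply Rmult_le_compat; auto using Cmod_ge_0; lra.
    - right; field; lra. }
  lra.
Qed.

Lemma is_cderiv_shift (f : C -> C) (s z l : C) :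
  is_cderiv f (s + z) l -> is_cderiv (fun w => f (s + w)) z l.
Proof.
  intros Hf eps Heps. destruct (Hf eps Heps) as [d [Hd H]].
  exists d; split; auto. intros w Hw. specialize (H (s + w)).
  replace (s + w - (s + z)) with (w - z) in H by ring. auto.
Qed.

Lemma is_cderiv_scal_arg (f : C -> C) (a z l : C) :
  is_cderiv f (a * z) l -> is_cderiv (fun w => f (a * w)) z (a * l).
Proof.
  intros Hf eps Heps.
  assert (Ha := Cmod_ge_0 a).
  destruct (Hf (eps / (Cmod a + 1))%R) as [d [Hd H]].
  { apply Rdiv_lt_0_compat; lra. }
  exists (d / (Cmod a + 1))%R; split.
  { apply Rdiv_lt_0_compat; lra. }
  intros w Hw. specialize (H (a * w)).
  replace (a * w - a * z) with (a * (w - z)) in H by ring.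
  rewrite Cmod_mult in H.
  assert (Hr := Cmod_ge_0 (w - z)).
  assert (Hlt : (Cmod a * Cmod (w - z) < d)%R).
  { apply Rle_lt_trans with ((Cmod a + 1) * Cmod (w - z))%R; [nra|].
    replace d with ((Cmod a + 1) * (d / (Cmod a + 1)))%R by (field; lra).
    apply Rmult_lt_compat_l; lra. }
  specialize (H Hlt).
  replace (a * l * (w - z)) with (l * (a * (w - z))) by ring.
  eapply Rle_trans; [apply H|].
  replace (eps * Cmod (w - z))%R with (eps / (Cmod a + 1) * ((Cmod a + 1) * Cmod (w - z)))%R
    by (field; lra).
  apply Rmult_le_compat_l; [|nra]. apply Rlt_le, Rdiv_lt_0_compat; lra.
Qed.

Lemma is_cderiv_inv (z : C) : z <> 0%R -> is_cderiv (fun w => / w) z (- / (z * z)).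
Proof.
  intros Hz eps Heps.
  assert (Hm : (0 < Cmod z)%R) by (apply Cmod_gt_0; auto).
  set (m := Cmod z) in *.
  (* The first radius keeps [Cmod w] above [m / 2]; the second then absorbs the error
     [(w - z)^2 / (w z^2)]. *)
  exists (Rmin (m / 2) (eps * m * m * m / 2)).
  assert (0 < eps * m * m * m / 2)%R.
  { repeat apply Rmult_lt_0_compat; lra. }
  split; [apply Rmin_glb_lt; lra|].
  intros w Hw.
  pose proof (Rmin_l (m / 2) (eps * m * m * m / 2)).
  pose proof (Rmin_r (m / 2) (eps * m * m * m / 2)).
  assert (Hw2 : (m / 2 <= Cmod w)%R).
  { assert (m <= Cmod (w - z) + Cmod w)%R; [|lra].
    unfold m. rewrite (Cmod_minus_sym w z).
    replace z with ((z - w) + w) at 1 by ring. apply Cmod_triangle. }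
  assert (Hw0 : w <> 0%R) by (apply Cmod_gt_0; lra).
  replace (/ w - / z - - / (z * z) * (w - z)) with ((w - z) * (w - z) / (w * (z * z)))
    by (field; auto).
  rewrite Cmod_div; [|repeat apply Cmult_neq_0; auto].
  rewrite !Cmod_mult. fold m.
  set (r := Cmod (w - z)) in *. assert (Hr : (0 <= r)%R) by apply Cmod_ge_0.
  assert (Hden : (0 < Cmod w * (m * m))%R) by (repeat apply Rmult_lt_0_compat; lra).
  apply Rmult_le_reg_r with (1 := Hden).
  unfold Rdiv. rewrite Rmult_assoc, Rinv_l by lra. rewrite Rmult_1_r.
  rewrite (Rmult_comm eps r), Rmult_assoc. apply Rmult_le_compat_l; auto.
  apply Rle_trans with (eps * (m / 2 * (m * m)))%R; [lra|].
  apply Rmult_le_compat_l; [lra|]. apply Rmult_le_compat_r; nra.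
Qed.

Lemma cdiff_const (c z : C) : cdiff (fun _ => c) z.
Proof. eexists; apply is_cderiv_const. Qed.

Lemma cdiff_id (z : C) : cdiff (fun w => w) z.
Proof. eexists; apply is_cderiv_id. Qed.

Lemma cdiff_plus (f g : C -> C) (z : C) :
  cdiff f z -> cdiff g z -> cdiff (fun w => f w + g w) z.
Proof. intros [l Hl] [m Hm]; eexists; apply is_cderiv_plus; eauto. Qed.

Lemma cdiff_mult (f g : C -> C) (z : C) :
  cdiff f z -> cdiff g z -> cdiff (fun w => f w * g w) z.
Proof. intros [l Hl] [m Hm]; eexists; apply is_cderiv_mult; eauto. Qed.

Lemma is_cderiv_ext (f g : C -> C) (z l : C) :
  (forall w, f w = g w) -> is_cderiv f z l -> is_cderiv g z l.
Proof.
  intros E H eps Heps. destruct (H eps Heps) as [d [Hd K]].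
  exists d; split; auto. intros w Hw. rewrite <- !E; auto.
Qed.

Lemma cdiff_ext (f g : C -> C) (z : C) :
  (forall w, f w = g w) -> cdiff f z -> cdiff g z.
Proof. intros E [l Hl]; exists l; eapply is_cderiv_ext; eauto. Qed.

Lemma cdiff_minus (f g : C -> C) (z : C) :
  cdiff f z -> cdiff g z -> cdiff (fun w => f w - g w) z.
Proof.
  intros Hf Hg. apply cdiff_ext with (fun w => f w + (-(1)) * g w).
  - intros w; ring.
  - apply cdiff_plus; auto. apply cdiff_mult; auto. apply cdiff_const.
Qed.

Lemma cdiff_inv (z : C) : z <> 0%R -> cdiff (fun w => / w) z.
Proof. intros Hz; eexists; apply is_cderiv_inv; auto. Qed.

Lemma cdiff_shift (f : C -> C) (s z : C) :
  cdiff f (s + z) -> cdiff (fun w => f (s + w)) z.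
Proof. intros [l Hl]; eexists; apply is_cderiv_shift; eauto. Qed.

(** * Integrals of complex-valued functions *)

Definition CInt (f : R -> C) (a b : R) : C :=
  (RInt (fun t => Re (f t)) a b, RInt (fun t => Im (f t)) a b).

Definition ccont (f : R -> C) (t : R) : Prop :=
  continuous (fun t => Re (f t)) t /\ continuous (fun t => Im (f t)) t.

Definition ccont_on (f : R -> C) (a b : R) : Prop :=
  forall t, (a <= t <= b)%R -> ccont f t.

Lemma ccont_on_ex (f : R -> C) (a b : R) : (a <= b)%R -> ccont_on f a b ->
  ex_RInt (fun t => Re (f t)) a b /\ ex_RInt (fun t => Im (f t)) a b.
Proof.
  intros Hab H. split; apply (ex_RInt_continuous (V := R_CompleteNormedModule));
    intros t; rewrite Rmin_left, Rmax_right by auto; intros Ht; apply (H t Ht).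
Qed.

Lemma continuous_eps (f : R -> R) (t : R) :
  (forall eps, 0 < eps -> exists d, 0 < d /\ forall u, Rabs (u - t) < d -> Rabs (f u - f t) < eps)%R
  -> continuous f t.
Proof.
  intros H. apply filterlim_locally. intros eps.
  destruct (H eps (cond_pos eps)) as [d [Hd K]].
  exists (mkposreal d Hd). intros u Hu. apply K. apply Hu.
Qed.

Lemma ccont_eps (f : R -> C) (t : R) :
  (forall eps, 0 < eps -> exists d, 0 < d /\
     forall u, Rabs (u - t) < d -> Cmod (f u - f t)%C < eps)%R
  -> ccont f t.
Proof.
  intros H; split; apply continuous_eps; intros eps Heps;
  destruct (H eps Heps) as [d [Hd K]]; exists d; split; auto; intros u Hu;
  (eapply Rle_lt_trans; [|apply (K u Hu)]).
  - apply (Re_le_Cmod (f u - f t)).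
  - apply (Im_le_Cmod (f u - f t)).
Qed.

Lemma ccont_line (f : C -> C) (z d : C) (t : R) :
  cdiff f (z + t * d) -> ccont (fun u : R => f (z + u * d)) t.
Proof.
  intros [l Hl]. destruct (is_cderiv_lipschitz _ _ _ Hl) as [r [Hr H]].
  apply ccont_eps. intros eps Heps.
  assert (Hl0 := Cmod_ge_0 l). assert (Hd0 := Cmod_ge_0 d).
  set (k := ((Cmod l + 1) * (Cmod d + 1))%R).
  assert (Hk : (0 < k)%R) by (unfold k; nra).
  exists (Rmin (r / (Cmod d + 1)) (eps / k)).
  split; [apply Rmin_glb_lt; apply Rdiv_lt_0_compat; lra|].
  intros u Hu.
  assert (Hu1 := Rlt_le_trans _ _ _ Hu (Rmin_l _ _)).
  assert (Hu2 := Rlt_le_trans _ _ _ Hu (Rmin_r _ _)).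
  assert (E : Cmod (z + u * d - (z + t * d)) = (Rabs (u - t) * Cmod d)%R).
  { replace (z + u * d - (z + t * d)) with (RtoC (u - t) * d).
    - rewrite Cmod_mult, Cmod_R; auto.
    - rewrite RtoC_minus; ring. }
  pose proof (Rabs_pos (u - t)).
  assert (F : (Rabs (u - t) * Cmod d < r)%R).
  { apply Rle_lt_trans with (Rabs (u - t) * (Cmod d + 1))%R; [nra|].
    apply Rmult_lt_compat_r with (r := (Cmod d + 1)%R) in Hu1; [|lra].
    replace (r / (Cmod d + 1) * (Cmod d + 1))%R with r in Hu1 by (field; lra). auto. }
  specialize (H (z + u * d)). rewrite E in H. specialize (H F).
  eapply Rle_lt_trans; [apply H|].
  apply Rmult_lt_compat_r with (r := k) in Hu2; [|lra].
  replace (eps / k * k)%R with eps in Hu2 by (field; lra).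
  eapply Rle_lt_trans; [|apply Hu2]. unfold k.
  assert (0 <= (Cmod l + 1) * Rabs (u - t))%R by nra. nra.
Qed.

Lemma ccont_H (f : C -> C) (x y : R) : cdiff f (x, y) -> ccont (fun t => f (t, y)) x.
Proof.
  intros H. assert (E : forall t : R, (t, y) = (0, y)%R + t * 1).
  { intros t; unfold RtoC, Cplus, Cmult; simpl; f_equal; ring. }
  rewrite E in H. apply ccont_line in H.
  destruct H as [H1 H2].
  split; [refine (continuous_ext _ _ _ _ H1)|refine (continuous_ext _ _ _ _ H2)];
  intros t; cbv beta; rewrite <- E; reflexivity.
Qed.

Lemma ccont_V (f : C -> C) (x y : R) : cdiff f (x, y) -> ccont (fun t => f (x, t)) y.
Proof.
  intros H. assert (E : forall t : R, (x, t) = (x, 0)%R + t * Ci).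
  { intros t; unfold RtoC, Cplus, Cmult; simpl; f_equal; ring. }
  rewrite E in H. apply ccont_line in H.
  destruct H as [H1 H2].
  split; [refine (continuous_ext _ _ _ _ H1)|refine (continuous_ext _ _ _ _ H2)];
  intros t; cbv beta; rewrite <- E; reflexivity.
Qed.

Lemma CInt_ext (f g : R -> C) (a b : R) : (a <= b)%R ->
  (forall t, (a <= t <= b)%R -> f t = g t) -> CInt f a b = CInt g a b.
Proof.
  intros Hab H. unfold CInt; f_equal; apply RInt_ext; intros t;
  rewrite Rmin_left, Rmax_right by auto; intros Ht; rewrite H; auto; lra.
Qed.

Lemma CInt_plus (f g : R -> C) (a b : R) : (a <= b)%R ->
  ccont_on f a b -> ccont_on g a b ->
  CInt (fun t => f t + g t) a b = CInt f a b + CInt g a b.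
Proof.
  intros Hab Hf Hg.
  destruct (ccont_on_ex f a b Hab Hf). destruct (ccont_on_ex g a b Hab Hg).
  unfold CInt, Cplus; simpl; f_equal;
  apply (RInt_plus (V := R_CompleteNormedModule)); auto.
Qed.

Lemma CInt_scal (c : C) (f : R -> C) (a b : R) : (a <= b)%R ->
  ccont_on f a b -> CInt (fun t => c * f t) a b = c * CInt f a b.
Proof.
  intros Hab Hf.
  destruct (ccont_on_ex f a b Hab Hf) as [H1 H2].
  destruct c as [u v]. unfold CInt, Cmult; simpl.
  assert (L : forall k (h : R -> R), ex_RInt h a b ->
    is_RInt (fun t => k * h t)%R a b (k * RInt h a b)%R).
  { intros k h Hh. apply (is_RInt_scal (V := R_NormedModule)).
    apply (RInt_correct (V := R_CompleteNormedModule)); auto. }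
  f_equal; apply is_RInt_unique.
  - apply (is_RInt_minus (V := R_NormedModule)); apply L; auto.
  - apply (is_RInt_plus (V := R_NormedModule)); apply L; auto.
Qed.

Lemma ccont_on_plus (f g : R -> C) (a b : R) :
  ccont_on f a b -> ccont_on g a b -> ccont_on (fun t => f t + g t) a b.
Proof.
  intros Hf Hg t Ht. destruct (Hf t Ht), (Hg t Ht).
  split; simpl; apply (continuous_plus (V := R_NormedModule)); auto.
Qed.

Lemma ccont_on_scal (c : C) (f : R -> C) (a b : R) :
  ccont_on f a b -> ccont_on (fun t => c * f t) a b.
Proof.
  intros Hf t Ht. destruct (Hf t Ht). destruct c as [u v].
  assert (L : forall k h, continuous h t -> continuous (fun t => k * h t)%R t).
  { intros k h Hh. apply (continuous_scal_r k (V := R_NormedModule)); auto. }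
  split; simpl.
  - apply (continuous_minus (V := R_NormedModule)); apply L; auto.
  - apply (continuous_plus (V := R_NormedModule)); apply L; auto.
Qed.

Lemma CInt_chasles (f : R -> C) (a b c : R) : (a <= b <= c)%R ->
  ccont_on f a c -> CInt f a c = CInt f a b + CInt f b c.
Proof.
  intros Habc H.
  destruct (ccont_on_ex f a b) as [A1 A2]; [lra|intros t Ht; apply H; lra|].
  destruct (ccont_on_ex f b c) as [B1 B2]; [lra|intros t Ht; apply H; lra|].
  unfold CInt, Cplus; simpl; f_equal; symmetry;
  apply (RInt_Chasles (V := R_CompleteNormedModule)); auto.
Qed.

(** Goes through [C] as a real normed module, so that the modulus is estimated with constant 1
    instead of component by component. *)
Lemma CInt_le (f : R -> C) (g : R -> R) (a b I : R) : (a <= b)%R ->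
  ccont_on f a b -> (forall t, (a <= t <= b)%R -> (Cmod (f t) <= g t)%R) ->
  is_RInt g a b I -> (Cmod (CInt f a b) <= I)%R.
Proof.
  intros Hab Hf Hle HI. destruct (ccont_on_ex f a b Hab Hf) as [H1 H2].
  rewrite Cmod_norm.
  apply (norm_RInt_le (V := C_R_NormedModule)) with (f := f) (g := g) (a := a) (b := b); auto.
  - intros t Ht. rewrite <- Cmod_norm. auto.
  - apply (is_RInt_fct_extend_pair (U := R_NormedModule) (V := R_NormedModule));
    apply (RInt_correct (V := R_CompleteNormedModule)); auto.
Qed.

Lemma CInt_le_const (f : R -> C) (a b M : R) : (a <= b)%R ->
  ccont_on f a b -> (forall t, (a <= t <= b)%R -> (Cmod (f t) <= M)%R) ->
  (Cmod (CInt f a b) <= (b - a) * M)%R.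
Proof.
  intros Hab Hf Hle. apply CInt_le with (g := fun _ => M); auto.
  apply (is_RInt_const (V := R_NormedModule)).
Qed.

Lemma is_derive_eps (g : R -> R) (t l : R) :
  (forall eps, 0 < eps -> exists d, 0 < d /\
     forall u, Rabs (u - t) < d -> Rabs (g u - g t - (u - t) * l) <= eps * Rabs (u - t))%R
  -> is_derive g t l.
Proof.
  intros H. split; [apply is_linear_scal_l|].
  intros x Hx. apply (is_filter_lim_locally_unique (V := R_NormedModule)) in Hx. subst x.
  intros eps. destruct (H eps (cond_pos eps)) as [d [Hd K]].
  exists (mkposreal d Hd). intros u Hu. apply K, Hu.
Qed.

Lemma is_derive_line (F : C -> C) (z d l : C) (t : R) :
  is_cderiv F (z + t * d) l ->
  is_derive (fun u : R => Re (F (z + u * d))) t (Re (d * l)) /\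
  is_derive (fun u : R => Im (F (z + u * d))) t (Im (d * l)).
Proof.
  intros H.
  assert (K : forall eps, (0 < eps)%R -> exists r, (0 < r)%R /\ forall u : R,
    (Rabs (u - t) < r)%R ->
    (Cmod (F (z + u * d) - F (z + t * d) - RtoC (u - t) * (d * l))%C <= eps * Rabs (u - t))%R).
  { intros eps Heps. assert (Hd0 := Cmod_ge_0 d).
    destruct (H (eps / (Cmod d + 1))%R) as [r [Hr H']]; [apply Rdiv_lt_0_compat; lra|].
    exists (r / (Cmod d + 1))%R. split; [apply Rdiv_lt_0_compat; lra|].
    intros u Hu. specialize (H' (z + u * d)).
    replace (z + u * d - (z + t * d)) with (RtoC (u - t) * d) in H'
      by (rewrite RtoC_minus; ring).
    rewrite Cmod_mult, Cmod_R in H'.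
    pose proof (Rabs_pos (u - t)).
    assert (F1 : (Rabs (u - t) * Cmod d < r)%R).
    { apply Rle_lt_trans with (Rabs (u - t) * (Cmod d + 1))%R; [nra|].
      apply Rmult_lt_compat_r with (r := (Cmod d + 1)%R) in Hu; [|lra].
      replace (r / (Cmod d + 1) * (Cmod d + 1))%R with r in Hu by (field; lra). auto. }
    specialize (H' F1).
    replace (RtoC (u - t) * (d * l)) with (l * (RtoC (u - t) * d)) by ring.
    eapply Rle_trans; [apply H'|].
    replace (eps * Rabs (u - t))%R with
      (eps / (Cmod d + 1) * (Rabs (u - t) * (Cmod d + 1)))%R by (field; lra).
    apply Rmult_le_compat_l; [|nra]. apply Rlt_le, Rdiv_lt_0_compat; lra. }
  split; apply is_derive_eps; intros eps Heps; destruct (K eps Heps) as [r [Hr K']];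
    exists r; split; auto; intros u Hu; (eapply Rle_trans; [|apply (K' u Hu)]).
  - eapply Rle_trans; [|apply Re_le_Cmod]. right; f_equal.
    unfold Re, Cminus, Cplus, Copp, Cmult, RtoC; simpl. ring.
  - eapply Rle_trans; [|apply Im_le_Cmod]. right; f_equal.
    unfold Im, Cminus, Cplus, Copp, Cmult, RtoC; simpl. ring.
Qed.

Lemma path_integral (phi dphi : R -> C) (a b : R) : (a <= b)%R ->
  (forall t, (a <= t <= b)%R -> is_derive (fun t => Re (phi t)) t (Re (dphi t)) /\
     is_derive (fun t => Im (phi t)) t (Im (dphi t))) ->
  ccont_on dphi a b -> CInt dphi a b = phi b - phi a.
Proof.
  intros Hab Hd Hc. unfold CInt.
  unfold Cminus, Cplus, Copp; apply injective_projections; unfold fst at 1; unfold snd at 1;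
  apply is_RInt_unique.
  - apply (is_RInt_derive (V := R_CompleteNormedModule) (fun t => Re (phi t)));
    intros t; rewrite Rmin_left, Rmax_right by auto; intros Ht; [apply Hd|apply Hc]; auto.
  - apply (is_RInt_derive (V := R_CompleteNormedModule) (fun t => Im (phi t)));
    intros t; rewrite Rmin_left, Rmax_right by auto; intros Ht; [apply Hd|apply Hc]; auto.
Qed.

Lemma CInt_primitive (F f : C -> C) (z d : C) (a b : R) : (a <= b)%R ->
  (forall t : R, (a <= t <= b)%R -> is_cderiv F (z + t * d) (f (z + t * d))) ->
  ccont_on (fun t : R => f (z + t * d)) a b ->
  d * CInt (fun t : R => f (z + t * d)) a b = F (z + b * d) - F (z + a * d).
Proof.
  intros Hab HF Hc. rewrite <- CInt_scal by auto.
  apply (path_integral (fun t : R => F (z + t * d))); auto using ccont_on_scal.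
  intros t Ht. apply is_derive_line; auto.
Qed.

(** * Cauchy's theorem on rectangles *)

Definition rect_int (f : C -> C) (a b p q : R) : C :=
  CInt (fun x => f (x, p)) a b + Ci * CInt (fun y => f (b, y)) p q
  - CInt (fun x => f (x, q)) a b - Ci * CInt (fun y => f (a, y)) p q.

Definition cdiff_rect (f : C -> C) (a b p q : R) : Prop :=
  forall x y : R, (a <= x <= b)%R -> (p <= y <= q)%R -> cdiff f (x, y).

Lemma cdiff_rect_H (f : C -> C) (a b p q y : R) : (p <= y <= q)%R ->
  cdiff_rect f a b p q -> ccont_on (fun x => f (x, y)) a b.
Proof. intros Hy H x Hx. apply ccont_H. auto. Qed.

Lemma cdiff_rect_V (f : C -> C) (a b p q x : R) : (a <= x <= b)%R ->
  cdiff_rect f a b p q -> ccont_on (fun y => f (x, y)) p q.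
Proof. intros Hx H y Hy. apply ccont_V. auto. Qed.

(** Integrals around a rectangle only see its sides; this version admits integrands with a pole
    inside. *)
Definition cdiff_boundary (f : C -> C) (a b p q : R) : Prop :=
  forall x y : R, (a <= x <= b)%R -> (p <= y <= q)%R ->
    x = a \/ x = b \/ y = p \/ y = q -> cdiff f (x, y).

Lemma cdiff_rect_boundary (f : C -> C) (a b p q : R) :
  cdiff_rect f a b p q -> cdiff_boundary f a b p q.
Proof. intros H x y Hx Hy _; auto. Qed.

Lemma cdiff_boundary_H (f : C -> C) (a b p q y : R) : (p <= q)%R -> y = p \/ y = q ->
  cdiff_boundary f a b p q -> ccont_on (fun x => f (x, y)) a b.
Proof. intros Hpq Hy H x Hx. apply ccont_H, H; auto; destruct Hy; lra. Qed.

Lemma cdiff_boundary_V (f : C -> C) (a b p q x : R) : (a <= b)%R -> x = a \/ x = b ->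
  cdiff_boundary f a b p q -> ccont_on (fun y => f (x, y)) p q.
Proof. intros Hab Hx H y Hy. apply ccont_V, H; auto; destruct Hx; lra || tauto. Qed.

Lemma rect_int_split_H (f : C -> C) (a c b p q : R) :
  (a <= c <= b)%R -> (p <= q)%R -> cdiff_rect f a b p q ->
  rect_int f a b p q = rect_int f a c p q + rect_int f c b p q.
Proof.
  intros Hc Hpq H. unfold rect_int.
  rewrite (CInt_chasles (fun x => f (x, p)) a c b) by
    (try apply cdiff_rect_H with p q; auto; lra).
  rewrite (CInt_chasles (fun x => f (x, q)) a c b) by
    (try apply cdiff_rect_H with p q; auto; lra).
  ring.
Qed.

Lemma rect_int_split_V (f : C -> C) (a b p c q : R) :
  (p <= c <= q)%R -> (a <= b)%R -> cdiff_rect f a b p q ->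
  rect_int f a b p q = rect_int f a b p c + rect_int f a b c q.
Proof.
  intros Hc Hab H. unfold rect_int.
  rewrite (CInt_chasles (fun y => f (a, y)) p c q) by
    (try apply cdiff_rect_V with a b; auto; lra).
  rewrite (CInt_chasles (fun y => f (b, y)) p c q) by
    (try apply cdiff_rect_V with a b; auto; lra).
  ring.
Qed.

Lemma Cmod_4 (u v w z : C) :
  (Cmod (u + v - w - z) <= Cmod u + Cmod v + Cmod w + Cmod z)%R.
Proof.
  eapply Rle_trans; [apply Cmod_triangle_minus|]. apply Rplus_le_compat_r.
  eapply Rle_trans; [apply Cmod_triangle_minus|]. apply Rplus_le_compat_r.
  apply Cmod_triangle.
Qed.

Lemma rect_int_bound (f : C -> C) (a b p q M : R) : (a <= b)%R -> (p <= q)%R ->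
  cdiff_rect f a b p q ->
  (forall x y : R, (a <= x <= b)%R -> (p <= y <= q)%R -> (Cmod (f (x, y)) <= M)%R) ->
  (Cmod (rect_int f a b p q) <= 2 * ((b - a) + (q - p)) * M)%R.
Proof.
  intros Hab Hpq H HM. unfold rect_int.
  eapply Rle_trans; [apply Cmod_4|]. rewrite !Cmod_mult, Cmod_Ci.
  pose proof (CInt_le_const (fun x => f (x, p)) a b M Hab
    ltac:(apply cdiff_rect_H with p q; auto; lra) ltac:(intros; apply HM; lra)).
  pose proof (CInt_le_const (fun x => f (x, q)) a b M Hab
    ltac:(apply cdiff_rect_H with p q; auto; lra) ltac:(intros; apply HM; lra)).
  pose proof (CInt_le_const (fun y => f (b, y)) p q M Hpq
    ltac:(apply cdiff_rect_V with a b; auto; lra) ltac:(intros; apply HM; lra)).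
  pose proof (CInt_le_const (fun y => f (a, y)) p q M Hpq
    ltac:(apply cdiff_rect_V with a b; auto; lra) ltac:(intros; apply HM; lra)).
  lra.
Qed.

Lemma CInt_primitive_H (F f : C -> C) (a b y : R) : (a <= b)%R ->
  (forall x, (a <= x <= b)%R -> is_cderiv F (x, y) (f (x, y))) ->
  ccont_on (fun x => f (x, y)) a b ->
  CInt (fun x => f (x, y)) a b = F (b, y) - F (a, y).
Proof.
  intros Hab HF Hc.
  assert (E : forall t : R, (0, y)%R + t * 1 = (t, y)).
  { intros t; unfold RtoC, Cplus, Cmult; simpl; f_equal; ring. }
  transitivity (1 * CInt (fun t : R => f ((0, y)%R + t * 1)) a b).
  - rewrite Cmult_1_l. apply CInt_ext; auto. intros; rewrite E; auto.
  - rewrite (CInt_primitive F); auto.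
    + rewrite !E; auto.
    + intros t Ht; rewrite E; auto.
    + intros t Ht. destruct (Hc t Ht) as [H1 H2].
      split; [refine (continuous_ext _ _ _ _ H1)|refine (continuous_ext _ _ _ _ H2)];
      intros u; cbv beta; rewrite E; reflexivity.
Qed.

Lemma CInt_primitive_V (F f : C -> C) (x p q : R) : (p <= q)%R ->
  (forall y, (p <= y <= q)%R -> is_cderiv F (x, y) (f (x, y))) ->
  ccont_on (fun y => f (x, y)) p q ->
  Ci * CInt (fun y => f (x, y)) p q = F (x, q) - F (x, p).
Proof.
  intros Hab HF Hc.
  assert (E : forall t : R, (x, 0)%R + t * Ci = (x, t)).
  { intros t; unfold RtoC, Cplus, Cmult; simpl; f_equal; ring. }
  transitivity (Ci * CInt (fun t : R => f ((x, 0)%R + t * Ci)) p q).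
  - f_equal. apply CInt_ext; auto. intros; rewrite E; auto.
  - rewrite (CInt_primitive F); auto.
    + rewrite !E; auto.
    + intros t Ht; rewrite E; auto.
    + intros t Ht. destruct (Hc t Ht) as [H1 H2].
      split; [refine (continuous_ext _ _ _ _ H1)|refine (continuous_ext _ _ _ _ H2)];
      intros u; cbv beta; rewrite E; reflexivity.
Qed.

(** The four increments of [F] cancel around the corners. Since [F] is only asked for along the
    sides, [1 / z^2] around [0] is covered as well as affine functions. *)
Lemma rect_int_primitive (F f : C -> C) (a b p q : R) : (a <= b)%R -> (p <= q)%R ->
  cdiff_boundary f a b p q ->
  (forall x y : R, (a <= x <= b)%R -> (p <= y <= q)%R ->
     x = a \/ x = b \/ y = p \/ y = q -> is_cderiv F (x, y) (f (x, y))) ->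
  rect_int f a b p q = 0.
Proof.
  intros Hab Hpq H HF. unfold rect_int.
  rewrite (CInt_primitive_H F f a b p), (CInt_primitive_H F f a b q),
    (CInt_primitive_V F f a p q), (CInt_primitive_V F f b p q); auto.
  - ring.
  - intros; apply HF; auto; lra.
  - apply cdiff_boundary_V with a b; auto.
  - intros; apply HF; auto; lra.
  - apply cdiff_boundary_V with a b; auto.
  - intros; apply HF; auto; lra.
  - apply cdiff_boundary_H with p q; auto.
  - intros; apply HF; auto; lra.
  - apply cdiff_boundary_H with p q; auto.
Qed.

Lemma rect_int_affine (A B z0 : C) (a b p q : R) : (a <= b)%R -> (p <= q)%R ->
  rect_int (fun z => A + B * (z - z0)) a b p q = 0.
Proof.
  intros Hab Hpq.
  set (F := fun z => A * z + (B * / 2) * ((z - z0) * (z - z0))).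
  assert (HF : forall z, is_cderiv F z (A + B * (z - z0))).
  { intros z. unfold F.
    assert (D : is_cderiv (fun z => z - z0) z 1).
    { apply is_cderiv_ext with (fun z => z + - z0); [intros; ring|].
      replace (RtoC 1) with (1 + 0) by ring.
      apply is_cderiv_plus; [apply is_cderiv_id|apply is_cderiv_const]. }
    replace (A + B * (z - z0)) with
      ((0 * z + A * 1) + (0 * ((z - z0) * (z - z0)) + (B * / 2) * (1 * (z - z0) + (z - z0) * 1))).
    - apply (is_cderiv_plus (fun z => A * z)).
      + apply (is_cderiv_mult (fun _ => A)); [apply is_cderiv_const|apply is_cderiv_id].
      + apply (is_cderiv_mult (fun _ => B * / 2) (fun z => (z - z0) * (z - z0)));
          [apply is_cderiv_const|].
        apply (is_cderiv_mult (fun z => z - z0) (fun z => z - z0)); auto.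
    - field. }
  assert (Hc : cdiff_rect (fun z => A + B * (z - z0)) a b p q).
  { intros x y _ _. apply cdiff_plus; [apply cdiff_const|].
    apply cdiff_mult; [apply cdiff_const|]. apply cdiff_minus; [apply cdiff_id|apply cdiff_const]. }
  apply (rect_int_primitive F); auto using cdiff_rect_boundary.
Qed.

Lemma rect_int_lin (f g : C -> C) (c : C) (a b p q : R) : (a <= b)%R -> (p <= q)%R ->
  cdiff_boundary f a b p q -> cdiff_boundary g a b p q ->
  rect_int (fun z => f z + c * g z) a b p q = rect_int f a b p q + c * rect_int g a b p q.
Proof.
  intros Hab Hpq Hf Hg. unfold rect_int.
  assert (L : forall (u v : R -> C) r s, (r <= s)%R -> ccont_on u r s -> ccont_on v r s ->
    CInt (fun t => u t + c * v t) r s = CInt u r s + c * CInt v r s).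
  { intros u v r s Hrs Hu Hv. rewrite CInt_plus, CInt_scal; auto.
    apply ccont_on_scal; auto. }
  pose proof (fun y Hy => L _ _ a b Hab (cdiff_boundary_H f a b p q y Hpq Hy Hf)
    (cdiff_boundary_H g a b p q y Hpq Hy Hg)) as LH.
  pose proof (fun x Hx => L _ _ p q Hpq (cdiff_boundary_V f a b p q x Hab Hx Hf)
    (cdiff_boundary_V g a b p q x Hab Hx Hg)) as LV.
  cbv beta in LH, LV.
  rewrite (LH p), (LH q), (LV a), (LV b) by auto. ring.
Qed.

Lemma rect_int_ext (f g : C -> C) (a b p q : R) : (a <= b)%R -> (p <= q)%R ->
  (forall x y : R, (a <= x <= b)%R -> (p <= y <= q)%R ->
     x = a \/ x = b \/ y = p \/ y = q -> f (x, y) = g (x, y)) ->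
  rect_int f a b p q = rect_int g a b p q.
Proof.
  intros Hab Hpq H. unfold rect_int.
  rewrite (CInt_ext (fun x => f (x, p)) (fun x => g (x, p)) a b),
    (CInt_ext (fun x => f (x, q)) (fun x => g (x, q)) a b),
    (CInt_ext (fun y => f (a, y)) (fun y => g (a, y)) p q),
    (CInt_ext (fun y => f (b, y)) (fun y => g (b, y)) p q); auto;
    intros; apply H; auto; lra.
Qed.

(** The affine part at [z0] integrates to zero. What is left is at most [eps] times the
    half-perimeter, and it is integrated over the whole perimeter. *)
Lemma rect_int_local (f : C -> C) (a b p q eps : R) (z0 l : C) :
  (a <= b)%R -> (p <= q)%R -> cdiff_rect f a b p q -> (0 <= eps)%R ->
  (a <= Re z0 <= b)%R -> (p <= Im z0 <= q)%R ->
  (forall x y : R, (a <= x <= b)%R -> (p <= y <= q)%R ->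
     (Cmod (f (x, y) - f z0 - l * ((x, y) - z0)) <= eps * Cmod ((x, y) - z0))%R) ->
  (Cmod (rect_int f a b p q) <= 2 * eps * ((b - a) + (q - p)) ^ 2)%R.
Proof.
  intros Hab Hpq Hf Heps Hx0 Hy0 H.
  set (g := fun z => f z0 + l * (z - z0)).
  assert (Hg : cdiff_rect g a b p q).
  { intros x y _ _. apply cdiff_plus; [apply cdiff_const|].
    apply cdiff_mult; [apply cdiff_const|]. apply cdiff_minus; [apply cdiff_id|apply cdiff_const]. }
  replace (rect_int f a b p q) with (rect_int (fun z => f z + (- (1)) * g z) a b p q).
  - replace (2 * eps * ((b - a) + (q - p)) ^ 2)%R with
      (2 * ((b - a) + (q - p)) * (eps * ((b - a) + (q - p))))%R by ring.
    apply rect_int_bound; auto.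
    + intros x y Hx Hy. apply cdiff_plus; auto. apply cdiff_mult; auto. apply cdiff_const.
    + intros x y Hx Hy. unfold g.
      replace (f (x, y) + - (1) * (f z0 + l * ((x, y) - z0))) with
        (f (x, y) - f z0 - l * ((x, y) - z0)) by ring.
      eapply Rle_trans; [apply H; auto|]. apply Rmult_le_compat_l; auto.
      eapply Rle_trans; [apply Cmod_le_Re_Im|].
      destruct z0 as [x0 y0]; unfold Re, Im in *; simpl in *.
      apply Rplus_le_compat; apply Rabs_le; lra.
  - rewrite rect_int_lin; auto using cdiff_rect_boundary.
    unfold g. rewrite rect_int_affine; auto. ring.
Qed.

(** * Goursat's subdivision argument *)

Definition quarter (f : C -> C) (r : R * R * R * R) : R * R * R * R :=
  match r with (a, b, p, q) =>
    let m := ((a + b) / 2)%R in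
    let n := ((p + q) / 2)%R in
    let t := (Cmod (rect_int f a b p q) / 4)%R in
    if Rle_dec t (Cmod (rect_int f a m p n)) then (a, m, p, n)
    else if Rle_dec t (Cmod (rect_int f m b p n)) then (m, b, p, n)
    else if Rle_dec t (Cmod (rect_int f a m n q)) then (a, m, n, q)
    else (m, b, n, q)
  end.

Lemma quarter_spec (f : C -> C) (a b p q : R) :
  (a <= b)%R -> (p <= q)%R -> cdiff_rect f a b p q ->
  exists a' b' p' q' : R, quarter f (a, b, p, q) = (a', b', p', q') /\
    (a <= a')%R /\ (a' <= b')%R /\ (b' <= b)%R /\
    (p <= p')%R /\ (p' <= q')%R /\ (q' <= q)%R /\
    (b' - a' = (b - a) / 2)%R /\ (q' - p' = (q - p) / 2)%R /\
    (Cmod (rect_int f a b p q) / 4 <= Cmod (rect_int f a' b' p' q'))%R.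
Proof.
  intros Hab Hpq H. unfold quarter.
  set (m := ((a + b) / 2)%R). set (n := ((p + q) / 2)%R).
  assert (Hm : (a <= m <= b)%R) by (unfold m; lra).
  assert (Hn : (p <= n <= q)%R) by (unfold n; lra).
  destruct (Rle_dec _ (Cmod (rect_int f a m p n))) as [H1|H1];
  [|destruct (Rle_dec _ (Cmod (rect_int f m b p n))) as [H2|H2];
  [|destruct (Rle_dec _ (Cmod (rect_int f a m n q))) as [H3|H3]]];
  do 4 eexists; (split; [reflexivity|]); repeat split; auto; try lra; try (unfold m, n; lra).
  (* Only the default quadrant needs an argument: if the other three each carry less than a quarter
     of the modulus, the triangle inequality leaves at least a quarter to the last. The double
     negations match the shape of [Cmod_4]. *)
  assert (E : rect_int f a b p q = rect_int f a m p n + rect_int f m b p n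
     - (- rect_int f a m n q) - (- rect_int f m b n q)).
  { rewrite (rect_int_split_H f a m b), (rect_int_split_V f a m p n q),
      (rect_int_split_V f m b p n q); auto; try lra; [ring|..];
    intros x y Hx Hy; apply H; lra. }
  rewrite E in H1, H2, H3 |- *.
  pose proof (Cmod_4 (rect_int f a m p n) (rect_int f m b p n)
     (- rect_int f a m n q) (- rect_int f m b n q)) as K.
  rewrite !(Cmod_opp (rect_int f _ _ _ _)) in K. lra.
Qed.

Lemma quarter_iter (f : C -> C) (a b p q : R) (k : nat) :
  (a <= b)%R -> (p <= q)%R -> cdiff_rect f a b p q ->
  exists a' b' p' q' : R, Nat.iter k (quarter f) (a, b, p, q) = (a', b', p', q') /\
    (a <= a')%R /\ (a' <= b')%R /\ (b' <= b)%R /\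
    (p <= p')%R /\ (p' <= q')%R /\ (q' <= q)%R /\
    (b' - a' = (b - a) / 2 ^ k)%R /\ (q' - p' = (q - p) / 2 ^ k)%R /\
    (Cmod (rect_int f a b p q) / 4 ^ k <= Cmod (rect_int f a' b' p' q'))%R.
Proof.
  intros Hab Hpq H. induction k as [|k IH].
  - exists a, b, p, q; simpl. repeat split; auto; try lra.
  - destruct IH as (a1 & b1 & p1 & q1 & E & ? & ? & ? & ? & ? & ? & Eb & Eq & ?).
    destruct (quarter_spec f a1 b1 p1 q1) as
      (a2 & b2 & p2 & q2 & E2 & ? & ? & ? & ? & ? & ? & Eb2 & Eq2 & ?); auto.
    { intros x y Hx Hy; apply H; lra. }
    exists a2, b2, p2, q2. rewrite Nat.iter_succ, E, E2.
    assert (0 < 2 ^ k)%R by (apply pow_lt; lra).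
    assert (0 < 4 ^ k)%R by (apply pow_lt; lra).
    repeat split; auto; try lra.
    + rewrite Eb2, Eb; simpl; field; lra.
    + rewrite Eq2, Eq; simpl; field; lra.
    + replace (Cmod (rect_int f a b p q) / 4 ^ S k)%R with
        (Cmod (rect_int f a b p q) / 4 ^ k / 4)%R by (simpl; field; lra). lra.
Qed.

Lemma nested_intervals (a b : nat -> R) :
  (forall n, a n <= a (S n))%R -> (forall n, b (S n) <= b n)%R ->
  (forall n, a n <= b n)%R -> exists x, forall n, (a n <= x <= b n)%R.
Proof.
  intros Ha Hb Hab.
  assert (Ha' : forall n k, (a n <= a (k + n)%nat)%R).
  { intros n k; induction k; simpl; [lra|]. eapply Rle_trans; eauto. }
  assert (Hb' : forall n k, (b (k + n)%nat <= b n)%R).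
  { intros n k; induction k; simpl; [lra|]. eapply Rle_trans; eauto. }
  assert (Hc : forall n m, (a n <= b m)%R).
  { intros n m. eapply Rle_trans; [apply (Ha' n m)|].
    eapply Rle_trans; [apply Hab|]. rewrite Nat.add_comm. apply Hb'. }
  destruct (completeness (fun x => exists n, x = a n)) as [x [Hx1 Hx2]].
  - exists (b O). intros x [n ->]. apply Hc.
  - exists (a O), O; auto.
  - exists x. intros n; split; [apply Hx1; exists n; auto|].
    apply Hx2. intros y [k ->]. apply Hc.
Qed.

Lemma rect_int_goursat (f : C -> C) (a b p q : R) :
  (a <= b)%R -> (p <= q)%R -> cdiff_rect f a b p q -> rect_int f a b p q = 0.
Proof.
  intros Hab Hpq H.
  set (s := fun k => Nat.iter k (quarter f) (a, b, p, q)).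
  set (A := fun k => fst (fst (fst (s k)))). set (B := fun k => snd (fst (fst (s k)))).
  set (P := fun k => snd (fst (s k))). set (Q := fun k => snd (s k)).
  assert (Hs : forall k, (a <= A k)%R /\ (A k <= B k)%R /\ (B k <= b)%R /\
    (p <= P k)%R /\ (P k <= Q k)%R /\ (Q k <= q)%R /\
    (B k - A k = (b - a) / 2 ^ k)%R /\ (Q k - P k = (q - p) / 2 ^ k)%R /\
    (Cmod (rect_int f a b p q) / 4 ^ k <= Cmod (rect_int f (A k) (B k) (P k) (Q k)))%R).
  { intros k. destruct (quarter_iter f a b p q k Hab Hpq H)
      as (a1 & b1 & p1 & q1 & E & K).
    unfold A, B, P, Q, s. rewrite E. exact K. }
  assert (Hmono : forall k, (A k <= A (S k))%R /\ (B (S k) <= B k)%R /\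
    (P k <= P (S k))%R /\ (Q (S k) <= Q k)%R).
  { intros k. pose proof (Hs k) as K.
    destruct (quarter_spec f (A k) (B k) (P k) (Q k)) as
      (a2 & b2 & p2 & q2 & E2 & K2); try apply K.
    { intros x y Hx Hy; apply H; lra. }
    assert (E : s (S k) = quarter f (A k, B k, P k, Q k)).
    { unfold s. rewrite Nat.iter_succ. f_equal. unfold A, B, P, Q, s.
      destruct (Nat.iter k (quarter f) (a, b, p, q)) as [[[? ?] ?] ?]; reflexivity. }
    rewrite E2 in E. unfold A at 2, B at 1, P at 2, Q at 1. rewrite E. simpl.
    repeat split; apply K2. }
  destruct (nested_intervals A B) as [x Hx]; try (intros; apply Hmono); try (intros; apply Hs).
  destruct (nested_intervals P Q) as [y Hy]; try (intros; apply Hmono); try (intros; apply Hs).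
  destruct (H x y) as [l Hl].
  { specialize (Hx O). specialize (Hs O). lra. }
  { specialize (Hy O). specialize (Hs O). lra. }
  set (I := Cmod (rect_int f a b p q)) in *.
  destruct (Req_dec I 0) as [HI|HI]; [apply Cmod_eq_0; auto|exfalso].
  assert (HI0 : (0 < I)%R).
  { assert (0 <= I)%R by apply Cmod_ge_0. lra. }
  set (L := ((b - a) + (q - p))%R). assert (HL : (0 <= L)%R) by (unfold L; lra).
  (* Both the integral and the local bound scale by [4 ^ k], so the contradiction is
     [I <= 2 * eps * L ^ 2 < I]. The [+ 1] covers a rectangle reduced to a point. *)
  set (eps := (I / (4 * (L ^ 2 + 1)))%R).
  assert (HL2 : (0 <= L ^ 2)%R) by (apply pow_le; auto).
  assert (Heps : (0 < eps)%R) by (apply Rdiv_lt_0_compat; lra).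
  destruct (Hl eps Heps) as [d [Hd Hld]].
  assert (Hk : exists k, (L / 2 ^ k < d)%R).
  { destruct (pow_lt_1_zero (/ 2) ltac:(rewrite Rabs_pos_eq; lra) (d / (L + 1))%R)
      as [k Hk]. { apply Rdiv_lt_0_compat; lra. }
    exists k. specialize (Hk k (le_n k)).
    assert (0 < (/ 2) ^ k)%R by (apply pow_lt; lra).
    rewrite Rabs_pos_eq in Hk by lra. unfold Rdiv. rewrite <- pow_inv.
    apply Rle_lt_trans with ((L + 1) * (/ 2) ^ k)%R; [nra|].
    replace d with ((L + 1) * (d / (L + 1)))%R by (field; lra).
    apply Rmult_lt_compat_l; lra. }
  destruct Hk as [k Hk].
  specialize (Hx k). specialize (Hy k).
  destruct (Hs k) as (? & ? & ? & ? & ? & ? & Eb & Eq & HIk).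
  assert (E : ((B k - A k) + (Q k - P k) = L / 2 ^ k)%R).
  { rewrite Eb, Eq. unfold L. field. apply pow_nonzero; lra. }
  assert (HB : (Cmod (rect_int f (A k) (B k) (P k) (Q k)) <= 2 * eps * (L / 2 ^ k) ^ 2)%R).
  { rewrite <- E. apply rect_int_local with (x, y) l; simpl; auto; try lra.
    - intros u v Hu Hv; apply H; lra.
    - intros u v Hu Hv. apply Hld.
      eapply Rle_lt_trans; [apply Cmod_le_Re_Im|].
      apply Rle_lt_trans with (2 := Hk). rewrite <- E. unfold Re, Im; simpl.
      apply Rplus_le_compat; apply Rabs_le; lra. }
  assert (Hpow4 : (0 < 4 ^ k)%R) by (apply pow_lt; lra).
  assert (E4 : ((L / 2 ^ k) ^ 2 = L ^ 2 / 4 ^ k)%R).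
  { replace 4%R with (2 * 2)%R by ring. rewrite Rpow_mult_distr. field.
    apply pow_nonzero; lra. }
  rewrite E4 in HB.
  assert (K : (I <= 2 * eps * L ^ 2)%R).
  { apply Rmult_le_reg_r with (/ 4 ^ k)%R; [apply Rinv_0_lt_compat; auto|].
    unfold Rdiv in *. lra. }
  assert (K2 : (4 * eps * (L ^ 2 + 1) = I)%R) by (unfold eps; field; lra).
  nra.
Qed.

(** * The complex exponential *)

Lemma Cexp_plus (z w : C) : Cexp (z + w) = Cexp z * Cexp w.
Proof.
  destruct z as [a b], w as [c d]. unfold Cexp, Re, Im, Cplus, Cmult; simpl.
  rewrite exp_plus, cos_plus, sin_plus. f_equal; ring.
Qed.

Lemma Cexp_0 : Cexp 0 = 1.
Proof.
  unfold Cexp, RtoC, Re, Im; simpl. rewrite exp_0, cos_0, sin_0. f_equal; ring.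
Qed.

Lemma Cmod_Cexp (z : C) : Cmod (Cexp z) = exp (Re z).
Proof.
  unfold Cexp, Cmod; simpl fst; simpl snd.
  replace ((exp (Re z) * cos (Im z)) ^ 2 + (exp (Re z) * sin (Im z)) ^ 2)%R with (exp (Re z) ^ 2)%R.
  - apply sqrt_pow2, Rlt_le, exp_pos.
  - pose proof (sin2_cos2 (Im z)) as H. unfold Rsqr in H. nra.
Qed.

Lemma exp_le_compat (x y : R) : (x <= y)%R -> (exp x <= exp y)%R.
Proof.
  intros [H| ->]; [left; apply exp_increasing; auto|right; auto].
Qed.

Lemma Cmod_Cexp_le (w : C) : (Cmod (Cexp w) <= exp (Cmod w))%R.
Proof.
  rewrite Cmod_Cexp. apply exp_le_compat.
  eapply Rle_trans; [apply Rle_abs|apply Re_le_Cmod].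
Qed.

Lemma Cmod_scal_unit (t : R) (w : C) : (0 <= t <= 1)%R -> (Cmod (RtoC t * w) <= Cmod w)%R.
Proof.
  intros Ht. rewrite Cmod_mult, Cmod_R, Rabs_pos_eq by lra.
  pose proof (Cmod_ge_0 w). nra.
Qed.

Lemma Cexp_path_cont (w c : C) (a b : R) :
  ccont_on (fun t : R => c * (Cexp (t * w) - 1)) a b.
Proof.
  apply ccont_on_scal. intros t _.
  destruct w as [u v]. split; unfold Cexp, Re, Im; simpl;
  apply (ex_derive_continuous (V := R_NormedModule)); auto_derive; auto.
Qed.

(** Integrates the derivative along the segment from [0] to [w]. The higher Taylor bounds arise by
    integrating the preceding one in the same way; the factorials are given away. *)
Lemma Cexp_minus_1_le (w : C) : (Cmod (Cexp w - 1) <= Cmod w * exp (Cmod w))%R.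
Proof.
  assert (Hc : ccont_on (fun t : R => w * Cexp (t * w)) 0 1).
  { apply ccont_on_scal. intros t _.
    destruct w as [u v]. split; unfold Cexp, Re, Im; simpl;
    apply (ex_derive_continuous (V := R_NormedModule)); auto_derive; auto. }
  replace (Cexp w - 1) with (CInt (fun t : R => w * Cexp (t * w)) 0 1).
  - replace (Cmod w * exp (Cmod w))%R with ((1 - 0) * (Cmod w * exp (Cmod w)))%R by ring.
    apply CInt_le_const; auto; [lra|]. intros t Ht. rewrite Cmod_mult.
    apply Rmult_le_compat_l; [apply Cmod_ge_0|].
    eapply Rle_trans; [apply Cmod_Cexp_le|]. apply exp_le_compat, Cmod_scal_unit; auto.
  - rewrite (path_integral (fun t : R => Cexp (t * w))); auto.
    + rewrite Cmult_1_l, Cmult_0_l, Cexp_0; auto.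
    + lra.
    + intros t _. destruct w as [u v]. split; unfold Cexp, Re, Im; simpl;
      auto_derive; auto; unfold Rminus; ring.
Qed.

Lemma Cexp_minus_1_lin_le (w : C) :
  (Cmod (Cexp w - 1 - w) <= Cmod w * (Cmod w * exp (Cmod w)))%R.
Proof.
  replace (Cexp w - 1 - w) with (CInt (fun t : R => w * (Cexp (t * w) - 1)) 0 1).
  - replace (Cmod w * (Cmod w * exp (Cmod w)))%R with
      ((1 - 0) * (Cmod w * (Cmod w * exp (Cmod w))))%R by ring.
    apply CInt_le_const; [lra|apply Cexp_path_cont|]. intros t Ht. rewrite Cmod_mult.
    apply Rmult_le_compat_l; [apply Cmod_ge_0|].
    eapply Rle_trans; [apply Cexp_minus_1_le|].
    pose proof (Cmod_scal_unit t w Ht).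
    apply Rmult_le_compat; auto using Cmod_ge_0, exp_le_compat. apply Rlt_le, exp_pos.
  - rewrite (path_integral (fun t : R => Cexp (t * w) - t * w)).
    + rewrite !Cmult_1_l, !Cmult_0_l, Cexp_0; ring.
    + lra.
    + intros t _. destruct w as [u v]. split; unfold Cexp, Re, Im; simpl;
      auto_derive; auto; unfold Rminus; ring.
    + apply Cexp_path_cont.
Qed.

Lemma is_cderiv_Cexp (z : C) : is_cderiv Cexp z (Cexp z).
Proof.
  intros eps Heps.
  set (K := (exp (Re z) * exp 1)%R).
  assert (HK : (0 < K)%R) by (apply Rmult_lt_0_compat; apply exp_pos).
  exists (Rmin 1 (eps / K)). split.
  { apply Rmin_glb_lt; [lra|]. apply Rdiv_lt_0_compat; lra. }
  intros w Hw.
  assert (Hw1 := Rlt_le_trans _ _ _ Hw (Rmin_l _ _)).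
  assert (Hw2 := Rlt_le_trans _ _ _ Hw (Rmin_r _ _)).
  set (u := w - z) in *.
  replace (Cexp w) with (Cexp z * Cexp u) by (rewrite <- Cexp_plus; f_equal; unfold u; ring).
  replace (Cexp z * Cexp u - Cexp z - Cexp z * u) with (Cexp z * (Cexp u - 1 - u)) by ring.
  rewrite Cmod_mult, Cmod_Cexp.
  assert (Hu := Cmod_ge_0 u).
  apply Rle_trans with (exp (Re z) * (Cmod u * (Cmod u * exp 1)))%R.
  - apply Rmult_le_compat_l; [apply Rlt_le, exp_pos|].
    eapply Rle_trans; [apply Cexp_minus_1_lin_le|].
    repeat apply Rmult_le_compat_l; auto. apply exp_le_compat; lra.
  - replace (exp (Re z) * (Cmod u * (Cmod u * exp 1)))%R with (Cmod u * K * Cmod u)%R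
      by (unfold K; ring).
    apply Rmult_le_compat_r; auto.
    apply Rmult_lt_compat_r with (r := K) in Hw2; auto.
    replace (eps / K * K)%R with eps in Hw2 by (field; lra). lra.
Qed.

Lemma is_cderiv_Cexp_scal (a z : C) : is_cderiv (fun w => Cexp (a * w)) z (a * Cexp (a * z)).
Proof. apply is_cderiv_scal_arg, is_cderiv_Cexp. Qed.

Lemma cdiff_Cexp_scal (a z : C) : cdiff (fun w => Cexp (a * w)) z.
Proof. eexists; apply is_cderiv_Cexp_scal. Qed.

Lemma Cmod_increment_le (F f : C -> C) (w : C) (M : R) :
  (forall z, is_cderiv F z (f z)) -> (forall z, cdiff f z) ->
  (forall t : R, (0 <= t <= 1)%R -> (Cmod (f (t * w)%C) <= M)%R) ->
  (Cmod (F w - F 0)%C <= Cmod w * M)%R.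
Proof.
  intros HF Hf HM.
  assert (Hc : ccont_on (fun t : R => f (0 + t * w)) 0 1).
  { intros t _. apply ccont_line, Hf. }
  replace (F w - F 0) with (F (0 + 1%R * w) - F (0 + 0%R * w)) by
    (f_equal; [f_equal; ring|f_equal; f_equal; ring]).
  rewrite <- (CInt_primitive F f 0 w 0 1); auto; [|lra].
  rewrite Cmod_mult. apply Rmult_le_compat_l; [apply Cmod_ge_0|].
  replace M with ((1 - 0) * M)%R by ring. apply CInt_le_const; auto; [lra|].
  intros t Ht. rewrite Cplus_0_l. auto.
Qed.

Lemma scaled_power_bound (w : C) (t : R) (n : nat) : (0 <= t <= 1)%R ->
  (Cmod (RtoC t * w) ^ n * exp (Cmod (RtoC t * w)) <= Cmod w ^ n * exp (Cmod w))%R.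
Proof.
  intros Ht. pose proof (Cmod_scal_unit t w Ht).
  apply Rmult_le_compat.
  - apply pow_le, Cmod_ge_0.
  - apply Rlt_le, exp_pos.
  - apply pow_incr. split; auto using Cmod_ge_0.
  - apply exp_le_compat; auto.
Qed.

Lemma Cexp_taylor2_le (w : C) :
  (Cmod (Cexp w - 1 - w - w * w / 2) <= Cmod w ^ 3 * exp (Cmod w))%R.
Proof.
  set (f := fun z => Cexp (1 * z) + (-(1)) * (1 + 1 * z)).
  set (F := fun z => Cexp (1 * z) + (- (1)) * (z + / 2 * (z * z))).
  assert (Hf : forall z, cdiff f z).
  { intros z. apply cdiff_plus; [apply cdiff_Cexp_scal|].
    apply cdiff_mult; [apply cdiff_const|].
    apply cdiff_plus; [apply cdiff_const|].
    apply cdiff_mult; [apply cdiff_const|apply cdiff_id]. }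
  assert (HF : forall z, is_cderiv F z (f z)).
  { intros z. unfold F, f.
    replace (Cexp (1 * z) + - (1) * (1 + 1 * z)) with
      (1 * Cexp (1 * z) + (0 * (z + / 2 * (z * z)) +
        (- (1)) * (1 + (0 * (z * z) + / 2 * (1 * z + z * 1))))) by field.
    apply (is_cderiv_plus (fun z => Cexp (1 * z)));
      [apply is_cderiv_Cexp_scal|].
    apply (is_cderiv_mult (fun _ => - (1)) (fun z => z + / 2 * (z * z)));
      [apply is_cderiv_const|].
    apply (is_cderiv_plus (fun z => z) (fun z => / 2 * (z * z))); [apply is_cderiv_id|].
    apply (is_cderiv_mult (fun _ => / 2) (fun z => z * z)); [apply is_cderiv_const|].
    apply (is_cderiv_mult (fun z => z) (fun z => z)); apply is_cderiv_id. }
  replace (Cexp w - 1 - w - w * w / 2) with (F w - F 0).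
  - replace (Cmod w ^ 3 * exp (Cmod w))%R with (Cmod w * (Cmod w ^ 2 * exp (Cmod w)))%R by ring.
    apply Cmod_increment_le with f; auto. intros t Ht. unfold f.
    eapply Rle_trans; [|apply (scaled_power_bound w t 2 Ht)].
    replace (Cexp (1 * (t * w)) + - (1) * (1 + 1 * (t * w))) with
      (Cexp (t * w) - 1 - t * w).
    + eapply Rle_trans; [apply Cexp_minus_1_lin_le|]. right; ring.
    + rewrite Cmult_1_l. ring.
  - unfold F. rewrite !Cmult_1_l, Cexp_0. field.
Qed.

(** Third order is what the derivative of [exp_remainder] at [0] consumes, two orders being lost to
    the division by [z^2]. *)
Lemma Cexp_taylor3_le (w : C) :
  (Cmod (Cexp w - 1 - w - w * w / 2 - w * w * w / 6) <= Cmod w ^ 4 * exp (Cmod w))%R.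
Proof.
  set (f := fun z => Cexp (1 * z) + (-(1)) * (1 + (1 * z + / 2 * (z * z)))).
  set (F := fun z => Cexp (1 * z) + (- (1)) * (z + (/ 2 * (z * z) + / 6 * (z * (z * z))))).
  assert (Hf : forall z, cdiff f z).
  { intros z. apply cdiff_plus; [apply cdiff_Cexp_scal|].
    apply cdiff_mult; [apply cdiff_const|].
    apply cdiff_plus; [apply cdiff_const|].
    apply cdiff_plus; (apply cdiff_mult; [apply cdiff_const|]); try apply cdiff_id.
    apply cdiff_mult; apply cdiff_id. }
  assert (HF : forall z, is_cderiv F z (f z)).
  { intros z. unfold F, f.
    replace (Cexp (1 * z) + - (1) * (1 + (1 * z + / 2 * (z * z)))) with
      (1 * Cexp (1 * z) + (0 * (z + (/ 2 * (z * z) + / 6 * (z * (z * z)))) +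
        (- (1)) * (1 + ((0 * (z * z) + / 2 * (1 * z + z * 1)) +
          (0 * (z * (z * z)) + / 6 * (1 * (z * z) + z * (1 * z + z * 1))))))) by field.
    apply (is_cderiv_plus (fun z => Cexp (1 * z)));
      [apply is_cderiv_Cexp_scal|].
    apply (is_cderiv_mult (fun _ => - (1)) (fun z => z + (/ 2 * (z * z) + / 6 * (z * (z * z)))));
      [apply is_cderiv_const|].
    apply (is_cderiv_plus (fun z => z) (fun z => / 2 * (z * z) + / 6 * (z * (z * z))));
      [apply is_cderiv_id|].
    apply (is_cderiv_plus (fun z => / 2 * (z * z)) (fun z => / 6 * (z * (z * z)))).
    - apply (is_cderiv_mult (fun _ => / 2) (fun z => z * z)); [apply is_cderiv_const|].
      apply (is_cderiv_mult (fun z => z) (fun z => z)); apply is_cderiv_id.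
    - apply (is_cderiv_mult (fun _ => / 6) (fun z => z * (z * z))); [apply is_cderiv_const|].
      apply (is_cderiv_mult (fun z => z) (fun z => z * z)); [apply is_cderiv_id|].
      apply (is_cderiv_mult (fun z => z) (fun z => z)); apply is_cderiv_id. }
  replace (Cexp w - 1 - w - w * w / 2 - w * w * w / 6) with (F w - F 0).
  - replace (Cmod w ^ 4 * exp (Cmod w))%R with (Cmod w * (Cmod w ^ 3 * exp (Cmod w)))%R by ring.
    apply Cmod_increment_le with f; auto. intros t Ht. unfold f.
    eapply Rle_trans; [|apply (scaled_power_bound w t 3 Ht)].
    replace (Cexp (1 * (t * w)) + - (1) * (1 + (1 * (t * w) + / 2 * (t * w * (t * w))))) with
      (Cexp (t * w) - 1 - t * w - t * w * (t * w) / 2).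
    + apply Cexp_taylor2_le.
    + rewrite Cmult_1_l. field.
  - unfold F. rewrite !Cmult_1_l, Cexp_0. field.
Qed.

(** * Perron's formula *)

Lemma pair_neq_0 (x y : R) : x <> 0%R \/ y <> 0%R -> ((x, y) : C) <> 0%R.
Proof. intros H E. injection E as E1 E2. destruct H; auto. Qed.

(** Each side of the rectangle gets its own branch of the logarithm, written as logarithm of the
    modulus and arctangent of a quotient whose denominator is constant and nonzero along that side.
    No branch cut is met. *)
Lemma CInt_inv_H (p a b : R) : (a <= b)%R -> p <> 0%R ->
  CInt (fun x => / (x, p)) a b =
  ((ln (b ^ 2 + p ^ 2) - ln (a ^ 2 + p ^ 2)) / 2, - (atan (b / p) - atan (a / p)))%R.
Proof.
  intros Hab Hp.
  rewrite (path_integral (fun x => (ln (x ^ 2 + p ^ 2) / 2, - atan (x / p))%R)); auto.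
  - unfold Cminus, Cplus, Copp; simpl. f_equal; lra.
  - intros x _. assert (0 < x ^ 2 + p ^ 2)%R by nra.
    split; unfold Re, Im, Cinv; simpl fst; simpl snd; auto_derive; auto.
    + field. nra.
    + field. repeat split; nra.
  - intros x _. apply (ccont_H (fun z => / z)). apply cdiff_inv, pair_neq_0; auto.
Qed.

Lemma CInt_inv_V (c p q : R) : (p <= q)%R -> c <> 0%R ->
  CInt (fun y => / (c, y)) p q =
  (atan (q / c) - atan (p / c), - ((ln (c ^ 2 + q ^ 2) - ln (c ^ 2 + p ^ 2)) / 2))%R.
Proof.
  intros Hpq Hc.
  rewrite (path_integral (fun y => (atan (y / c), - (ln (c ^ 2 + y ^ 2) / 2))%R)); auto.
  - unfold Cminus, Cplus, Copp; simpl. f_equal; lra.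
  - intros y _. assert (0 < c ^ 2 + y ^ 2)%R by nra.
    split; unfold Re, Im, Cinv; simpl fst; simpl snd; auto_derive; auto.
    + field. repeat split; nra.
    + field. nra.
  - intros y _. apply (ccont_V (fun z => / z)). apply cdiff_inv, pair_neq_0; auto.
Qed.

Lemma atan_div_swap (x y : R) : (0 < x)%R -> (0 < y)%R ->
  (atan (y / x) = PI / 2 - atan (x / y))%R.
Proof.
  intros Hx Hy. replace (y / x)%R with (/ (x / y))%R by (field; lra).
  apply atan_inv. apply Rdiv_lt_0_compat; auto.
Qed.

(** The logarithms cancel between adjacent sides; at each of the four corners two arctangents of
    reciprocal numbers add up to [PI / 2]. *)
Lemma rect_int_inv (a b T : R) : (0 < a)%R -> (0 < b)%R -> (0 < T)%R ->
  rect_int (fun z => / z) (- a) b (- T) T = (2 * PI)%R * Ci.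
Proof.
  intros Ha Hb HT. unfold rect_int.
  rewrite !CInt_inv_H, !CInt_inv_V by lra.
  replace ((- a) ^ 2)%R with (a ^ 2)%R by ring.
  replace ((- T) ^ 2)%R with (T ^ 2)%R by ring.
  replace (b / - T)%R with (- (b / T))%R by (field; lra).
  replace (- a / - T)%R with (a / T)%R by (field; lra).
  replace (- T / b)%R with (- (T / b))%R by (field; lra).
  replace (- a / T)%R with (- (a / T))%R by (field; lra).
  replace (T / - a)%R with (- (T / a))%R by (field; lra).
  replace (- T / - a)%R with (T / a)%R by (field; lra).
  rewrite !atan_opp. rewrite (atan_div_swap b T), (atan_div_swap a T) by auto.
  apply injective_projections; simpl; field.
Qed.

Lemma is_cderiv_opp_inv (z : C) : z <> 0%R -> is_cderiv (fun w => - (1) * / w) z (/ (z * z)).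
Proof.
  intros Hz. replace (/ (z * z)) with (0 * / z + (- (1)) * (- / (z * z))) by ring.
  apply (is_cderiv_mult (fun _ => - (1)) (fun w => / w)).
  - apply is_cderiv_const.
  - apply is_cderiv_inv; auto.
Qed.

Lemma cdiff_inv_sq (z : C) : z <> 0%R -> cdiff (fun w => / (w * w)) z.
Proof.
  intros Hz. eexists.
  apply is_cderiv_ext with (fun w => / w * / w).
  (* [is_cderiv_ext] asks for equality everywhere, including [0]; there both sides are zero because
     the numerators in [Cinv] vanish. *)
  - intros w. destruct (Req_EM_T (Cmod w) 0) as [E|E].
    + apply Cmod_eq_0 in E. subst w. unfold Cinv, Cmult, RtoC; simpl.
      f_equal; unfold Rdiv; ring.
    + assert (w <> 0%R) by (intros ->; apply E, Cmod_0). field; auto.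
  - apply (is_cderiv_mult (fun w => / w) (fun w => / w)); apply is_cderiv_inv; auto.
Qed.

Lemma boundary_neq_0 (a b T x y : R) : (0 < a)%R -> (0 < b)%R -> (0 < T)%R ->
  (x = - a \/ x = b \/ y = - T \/ y = T)%R -> ((x, y) : C) <> 0%R.
Proof.
  intros Ha Hb HT H. apply pair_neq_0. destruct H as [H|[H|[H|H]]]; [left|left|right|right]; lra.
Qed.

Lemma rect_int_inv_sq (a b T : R) : (0 < a)%R -> (0 < b)%R -> (0 < T)%R ->
  rect_int (fun z => / (z * z)) (- a) b (- T) T = 0.
Proof.
  intros Ha Hb HT. apply (rect_int_primitive (fun z => - (1) * / z)); try lra.
  - intros x y _ _ H. apply boundary_neq_0 in H; auto using cdiff_inv_sq.
  - intros x y _ _ H. apply boundary_neq_0 in H; auto using is_cderiv_opp_inv.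
Qed.

(** What remains of [exp (nu z) / z^2] after subtracting its principal part at [0]. *)
Definition exp_remainder (nu z : C) : C :=
  if Req_EM_T (Cmod z) 0 then nu * nu / 2
  else (Cexp (nu * z) - 1 - nu * z) * / (z * z).

Lemma exp_remainder_neq (nu z : C) : z <> 0%R ->
  exp_remainder nu z = (Cexp (nu * z) - 1 - nu * z) * / (z * z).
Proof.
  intros Hz. unfold exp_remainder. destruct (Req_EM_T (Cmod z) 0) as [E|E]; auto.
  apply Cmod_eq_0 in E; contradiction.
Qed.

Lemma is_cderiv_ext_loc (f g : C -> C) (z l : C) (r : R) : (0 < r)%R ->
  (forall w, (Cmod (w - z) < r)%R -> f w = g w) -> is_cderiv f z l -> is_cderiv g z l.
Proof.
  intros Hr E H eps Heps. destruct (H eps Heps) as [d [Hd K]].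
  exists (Rmin d r); split; [apply Rmin_glb_lt; auto|]. intros w Hw.
  assert (H1 := Rlt_le_trans _ _ _ Hw (Rmin_l _ _)).
  assert (H2 := Rlt_le_trans _ _ _ Hw (Rmin_r _ _)).
  rewrite <- !E; auto. replace (z - z) with (RtoC 0) by ring. rewrite Cmod_0; auto.
Qed.

(** The singularity at [0] is removed by hand: the value [nu^2 / 2] and the derivative [nu^3 / 6]
    are the next Taylor coefficients, and the error is of order [|w|^4 / |w|^2]. *)
Lemma cdiff_exp_remainder (nu z : C) : cdiff (exp_remainder nu) z.
Proof.
  destruct (Req_EM_T (Cmod z) 0) as [E|E].
  - apply Cmod_eq_0 in E. subst z. exists (nu * nu * nu / 6). intros eps Heps.
    set (K := (Cmod nu ^ 4 * exp (Cmod nu) + 1)%R).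
    assert (HK : (0 < K)%R).
    { unfold K. pose proof (exp_pos (Cmod nu)). pose proof (pow_le (Cmod nu) 4 (Cmod_ge_0 _)). nra. }
    exists (Rmin 1 (eps / K)). split; [apply Rmin_glb_lt; [lra|apply Rdiv_lt_0_compat; lra]|].
    intros w Hw.
    assert (Hw1 := Rlt_le_trans _ _ _ Hw (Rmin_l _ _)).
    assert (Hw2 := Rlt_le_trans _ _ _ Hw (Rmin_r _ _)).
    replace (w - 0) with w in * by ring.
    assert (E0 : exp_remainder nu 0 = nu * nu / 2).
    { unfold exp_remainder. destruct (Req_EM_T (Cmod 0) 0) as [E|E]; auto.
      exfalso; apply E, Cmod_0. }
    rewrite E0.
    destruct (Req_EM_T (Cmod w) 0) as [E|E].
    + rewrite (Cmod_eq_0 _ E), E0.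
      replace (nu * nu / 2 - nu * nu / 2 - nu * nu * nu / 6 * 0) with (RtoC 0) by ring.
      rewrite Cmod_0; lra.
    + assert (Hw0 : w <> 0%R) by (intros ->; apply E, Cmod_0).
      rewrite exp_remainder_neq by auto.
      replace ((Cexp (nu * w) - 1 - nu * w) * / (w * w) - nu * nu / 2 - nu * nu * nu / 6 * w)
        with ((Cexp (nu * w) - 1 - nu * w - nu * w * (nu * w) / 2
               - nu * w * (nu * w) * (nu * w) / 6) / (w * w)) by (field; auto).
      rewrite Cmod_div by (apply Cmult_neq_0; auto).
      assert (Hm : (0 < Cmod w)%R) by (apply Cmod_gt_0; auto).
      rewrite (Cmod_mult w w).
      apply Rmult_le_reg_r with (Cmod w * Cmod w)%R; [nra|].
      unfold Rdiv. rewrite Rmult_assoc, Rinv_l by nra. rewrite Rmult_1_r.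
      eapply Rle_trans; [apply Cexp_taylor3_le|].
      rewrite Cmod_mult. rewrite Rpow_mult_distr.
      apply Rle_trans with (K * Cmod w ^ 4)%R.
      * rewrite Rmult_assoc, (Rmult_comm (Cmod w ^ 4)), <- Rmult_assoc.
        apply Rmult_le_compat_r; [apply pow_le, Cmod_ge_0|].
        apply Rle_trans with (Cmod nu ^ 4 * exp (Cmod nu))%R; [|unfold K; lra].
        apply Rmult_le_compat_l; [apply pow_le, Cmod_ge_0|].
        apply exp_le_compat. pose proof (Cmod_ge_0 nu). nra.
      * apply Rmult_lt_compat_r with (r := K) in Hw2; auto.
        replace (eps / K * K)%R with eps in Hw2 by (field; lra).
        replace (K * Cmod w ^ 4)%R with (Cmod w * K * (Cmod w * (Cmod w * Cmod w)))%R by ring.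
        rewrite (Rmult_assoc eps).
        apply Rmult_le_compat_r; [|lra]. repeat apply Rmult_le_pos; lra.
  - assert (Hz : z <> 0%R) by (intros ->; apply E, Cmod_0).
    assert (H : cdiff (fun w => (Cexp (nu * w) - 1 - nu * w) * / (w * w)) z).
    { apply cdiff_mult; [|apply cdiff_inv_sq; auto].
      apply cdiff_minus.
      - apply cdiff_minus; [apply cdiff_Cexp_scal|apply cdiff_const].
      - apply cdiff_mult; [apply cdiff_const|apply cdiff_id]. }
    destruct H as [l Hl]. exists l.
    apply is_cderiv_ext_loc with (3 := Hl) (r := Cmod z).
    + apply Cmod_gt_0; auto.
    + intros w Hw. symmetry. apply exp_remainder_neq. intros ->.
      rewrite Cmod_minus_sym in Hw. replace (z - 0) with z in Hw by ring. lra.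
Qed.

(** Laurent splitting at [0]: the remainder is entire, [1 / z^2] has a primitive on the sides, and
    only the residue term [nu / z] survives. *)
Lemma rect_int_exp_inv_sq (nu a b T : R) : (0 < a)%R -> (0 < b)%R -> (0 < T)%R ->
  rect_int (fun z => Cexp (nu * z) * / (z * z)) (- a) b (- T) T = (2 * PI * nu)%R * Ci.
Proof.
  intros Ha Hb HT.
  set (f1 := fun z => exp_remainder nu z + nu * / z).
  assert (Hh : cdiff_boundary (exp_remainder nu) (- a) b (- T) T)
    by (intros x y _ _ _; apply cdiff_exp_remainder).
  assert (Hi : cdiff_boundary (fun z => / z) (- a) b (- T) T)
    by (intros x y _ _ H; apply boundary_neq_0 in H; auto using cdiff_inv).
  assert (Hs : cdiff_boundary (fun z => / (z * z)) (- a) b (- T) T)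
    by (intros x y _ _ H; apply boundary_neq_0 in H; auto using cdiff_inv_sq).
  assert (Hf1 : cdiff_boundary f1 (- a) b (- T) T).
  { intros x y Hx Hy H. apply cdiff_plus; [apply Hh; auto|].
    apply cdiff_mult; [apply cdiff_const|apply Hi; auto]. }
  rewrite (rect_int_ext _ (fun z => f1 z + 1 * / (z * z))); try lra.
  - rewrite rect_int_lin; auto; try lra. unfold f1. rewrite rect_int_lin; auto; try lra.
    rewrite rect_int_goursat, rect_int_inv, rect_int_inv_sq; auto; try lra.
    + rewrite !RtoC_mult. ring.
    + intros x y _ _; apply cdiff_exp_remainder.
  - intros x y _ _ H. apply boundary_neq_0 in H; auto. unfold f1.
    rewrite exp_remainder_neq by auto. field; auto.
Qed.

Definition perron_kernel (nu : R) (z : C) : C := Cexp (nu * z) * / (z * z).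

Lemma cdiff_perron_kernel (nu : R) (z : C) : z <> 0%R -> cdiff (perron_kernel nu) z.
Proof.
  intros Hz. apply cdiff_mult; [apply cdiff_Cexp_scal|apply cdiff_inv_sq; auto].
Qed.

Lemma Re_real_mult (nu : R) (z : C) : Re (nu * z) = (nu * Re z)%R.
Proof. unfold Re, Cmult, RtoC; simpl; ring. Qed.

Lemma perron_kernel_le (nu x y r : R) : (0 < r)%R -> (r <= Rabs x \/ r <= Rabs y)%R ->
  (Cmod (perron_kernel nu (x, y)) <= exp (nu * x) / r ^ 2)%R.
Proof.
  intros Hr H. unfold perron_kernel.
  assert (Hm : (r <= Cmod (x, y))%R).
  { destruct H; (eapply Rle_trans; [eassumption|]);
      [apply (Re_le_Cmod (x, y))|apply (Im_le_Cmod (x, y))]. }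
  assert (Hz : ((x, y) : C) <> 0%R) by (apply Cmod_gt_0; lra).
  rewrite Cmod_mult, Cmod_inv, Cmod_mult by (apply Cmult_neq_0; auto).
  rewrite Cmod_Cexp, Re_real_mult. unfold Re; simpl fst.
  apply Rmult_le_compat_l; [apply Rlt_le, exp_pos|].
  apply Rinv_le_contravar; [apply pow_lt; auto|]. nra.
Qed.

(** The right side enters [rect_int] with the factor [Ci], so adding [Ci * rect_int] cancels it and
    leaves the three other sides. *)
Lemma rect_int_right (f : C -> C) (a b p q M : R) : (a <= b)%R -> (p <= q)%R ->
  cdiff_boundary f a b p q ->
  (forall x y : R, (a <= x <= b)%R -> (p <= y <= q)%R ->
     x = a \/ y = p \/ y = q -> (Cmod (f (x, y)) <= M)%R) ->
  (Cmod (CInt (fun y => f (b, y)) p q + Ci * rect_int f a b p q)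
     <= (2 * (b - a) + (q - p)) * M)%R.
Proof.
  intros Hab Hpq H HM.
  assert (E : CInt (fun y => f (b, y)) p q + Ci * rect_int f a b p q =
    Ci * CInt (fun x => f (x, p)) a b + 0 - Ci * CInt (fun x => f (x, q)) a b
      - (- CInt (fun y => f (a, y)) p q)).
  { unfold rect_int. rewrite <- (Cmult_1_l (CInt (fun y => f (b, y)) p q)) at 1.
    replace (RtoC 1) with (- (Ci * Ci)) by
      (unfold Ci, Cmult, Copp, RtoC; simpl; f_equal; ring).
    assert (E' : CInt (fun y => f (a, y)) p q = - (Ci * Ci) * CInt (fun y => f (a, y)) p q).
    { replace (- (Ci * Ci)) with (RtoC 1) by
      (unfold Ci, Cmult, Copp, RtoC; simpl; f_equal; ring). ring. }
    rewrite E' at 2. ring. }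
  rewrite E. eapply Rle_trans; [apply Cmod_4|].
  rewrite !Cmod_mult, Cmod_opp, Cmod_Ci, Cmod_0.
  pose proof (CInt_le_const (fun x => f (x, p)) a b M Hab
    ltac:(apply cdiff_boundary_H with p q; auto) ltac:(intros; apply HM; auto; lra)).
  pose proof (CInt_le_const (fun x => f (x, q)) a b M Hab
    ltac:(apply cdiff_boundary_H with p q; auto) ltac:(intros; apply HM; auto; lra)).
  pose proof (CInt_le_const (fun y => f (a, y)) p q M Hpq
    ltac:(apply cdiff_boundary_V with a b; auto) ltac:(intros; apply HM; auto; lra)).
  lra.
Qed.

(** Contour shift to the right without crossing a pole: the total is zero by Goursat, hence the left
    side is controlled by the other three. *)
Lemma rect_int_left (f : C -> C) (a b p q H0 V0 : R) : (a <= b)%R -> (p <= q)%R ->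
  cdiff_rect f a b p q ->
  (Cmod (CInt (fun x => f (x, p)) a b) <= H0)%R ->
  (Cmod (CInt (fun x => f (x, q)) a b) <= H0)%R ->
  (Cmod (CInt (fun y => f (b, y)) p q) <= V0)%R ->
  (Cmod (CInt (fun y => f (a, y)) p q) <= 2 * H0 + V0)%R.
Proof.
  intros Hab Hpq H H1 H2 H3.
  pose proof (rect_int_goursat f a b p q Hab Hpq H) as E. unfold rect_int in E.
  assert (E' : Ci * CInt (fun y => f (a, y)) p q =
    CInt (fun x => f (x, p)) a b + Ci * CInt (fun y => f (b, y)) p q
      - CInt (fun x => f (x, q)) a b - 0).
  { symmetry. rewrite <- E. ring. }
  assert (K : Cmod (Ci * CInt (fun y => f (a, y)) p q) = Cmod (CInt (fun y => f (a, y)) p q)).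
  { rewrite Cmod_mult, Cmod_Ci; ring. }
  rewrite <- K, E'. eapply Rle_trans; [apply Cmod_4|].
  rewrite !Cmod_mult, Cmod_Ci, Cmod_0. lra.
Qed.

(** The line is shifted towards the half-plane where [exp (nu z)] does not grow. Going left meets
    the double pole at [0], whose residue is [nu]; going right meets nothing. The explicit rate
    [A / T] is kept because it is later summed over the terms of a partial sum. *)
Lemma perron_formula (nu c : R) : (0 < c)%R ->
  exists A : R, (0 <= A)%R /\ forall T : R, (1 <= T)%R ->
    (Cmod (CInt (fun y => perron_kernel nu (c, y)) (- T) T - (2 * PI * Rmax 0 nu)%R)
       <= A / T)%R.
Proof.
  intros Hc. destruct (Rle_dec nu 0) as [Hnu|Hnu].
  (* Shift to [Re z = c + T]: the three other sides stay at distance at least [T] from [0], where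
     the kernel is at most [1 / T^2], and their total length is [4 T]. *)
  - exists 4%R. split; [lra|]. intros T HT. rewrite Rmax_left by auto.
    replace (CInt (fun y => perron_kernel nu (c, y)) (- T) T - (2 * PI * 0)%R)
      with (CInt (fun y => perron_kernel nu (c, y)) (- T) T)
      by (rewrite Rmult_0_r; ring).
    assert (HM : forall x y : R, (c <= x)%R -> (T <= Rabs x \/ T <= Rabs y)%R ->
      (Cmod (perron_kernel nu (x, y)) <= / T ^ 2)%R).
    { intros x y Hx H. eapply Rle_trans; [apply perron_kernel_le with (r := T); auto; lra|].
      rewrite <- (Rmult_1_l (/ T ^ 2)). apply Rmult_le_compat_r.
      - apply Rlt_le, Rinv_0_lt_compat, pow_lt; lra.
      - rewrite <- exp_0. apply exp_le_compat. nra. }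
    assert (HD : cdiff_rect (perron_kernel nu) c (c + T) (- T) T).
    { intros x y Hx Hy. apply cdiff_perron_kernel, pair_neq_0. left; lra. }
    replace (4 / T)%R with (2 * (((c + T) - c) * / T ^ 2) + (T - - T) * / T ^ 2)%R
      by (field; lra).
    apply rect_int_left with (c + T)%R; auto; try lra; apply CInt_le_const; try lra.
    + apply cdiff_rect_H with (- T)%R T; auto; lra.
    + intros x Hx; apply HM; try lra. right. rewrite Rabs_Ropp, Rabs_pos_eq; lra.
    + apply cdiff_rect_H with (- T)%R T; auto; lra.
    + intros x Hx; apply HM; try lra. right. rewrite Rabs_pos_eq; lra.
    + apply cdiff_rect_V with c (c + T)%R; auto; lra.
    + intros x Hx; apply HM; try lra. left. rewrite Rabs_pos_eq; lra.
  (* Shift to [Re z = - T]: the three sides have total length [2 (c + T) + 2 T], at most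
     [(4 + 2 c) T] since [T >= 1]. *)
  - exists ((4 + 2 * c) * exp (nu * c))%R. split.
    { apply Rmult_le_pos; [lra|apply Rlt_le, exp_pos]. }
    intros T HT. rewrite Rmax_right by lra.
    assert (E := rect_int_exp_inv_sq nu T c T ltac:(lra) Hc ltac:(lra)).
    assert (K := rect_int_right (perron_kernel nu) (- T) c (- T) T (exp (nu * c) / T ^ 2)
      ltac:(lra) ltac:(lra)).
    change (fun z : C => Cexp (nu * z) * / (z * z)) with (perron_kernel nu) in E.
    rewrite E in K.
    replace (CInt (fun y : R => perron_kernel nu (c, y)) (- T) T - (2 * PI * nu)%R) with
      (CInt (fun y : R => perron_kernel nu (c, y)) (- T) T + Ci * ((2 * PI * nu)%R * Ci)).
    2:{ unfold Cminus. f_equal. unfold Ci, Cmult, Copp, RtoC; simpl; f_equal; ring. }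
    eapply Rle_trans; [apply K|].
    + intros x y _ _ H. apply boundary_neq_0 in H; try lra. apply cdiff_perron_kernel; auto.
    + intros x y Hx Hy H. eapply Rle_trans; [apply perron_kernel_le with (r := T); [lra|]|].
      * destruct H as [H|[H|H]]; rewrite H; [left|right|right];
          rewrite ?Rabs_Ropp, Rabs_pos_eq; lra.
      * apply Rmult_le_compat_r; [apply Rlt_le, Rinv_0_lt_compat, pow_lt; lra|].
        apply exp_le_compat. nra.
    + replace ((4 + 2 * c) * exp (nu * c) / T)%R with
        ((4 + 2 * c) * T * (exp (nu * c) / T ^ 2))%R by (field; lra).
      apply Rmult_le_compat_r; [|nra].
      apply Rmult_le_pos; [apply Rlt_le, exp_pos|].
      apply Rlt_le, Rinv_0_lt_compat, pow_lt; lra.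
Qed.

(** * Estimates for the tail of a Dirichlet series *)

Lemma is_RInt_exp (k a b : R) : k <> 0%R -> (a <= b)%R ->
  is_RInt (fun t => exp (- (k * t))) a b ((exp (- (k * a)) - exp (- (k * b))) / k)%R.
Proof.
  intros Hk Hab.
  replace ((exp (- (k * a)) - exp (- (k * b))) / k)%R with
    (minus (- exp (- (k * b)) / k) (- exp (- (k * a)) / k))%R
    by (unfold minus, plus, opp; simpl; field; auto).
  apply (is_RInt_derive (V := R_CompleteNormedModule) (fun t => - exp (- (k * t)) / k)%R);
    intros t _.
  - auto_derive; auto. field; auto.
  - apply (ex_derive_continuous (V := R_NormedModule)). auto_derive; auto.
Qed.

(** An explicit threshold from [1 + x <= exp x]. *)
Lemma exp_decay_small (V k eps : R) : (0 <= V)%R -> (0 < k)%R -> (0 < eps)%R ->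
  exists X0 : R, forall X, (X0 <= X)%R -> (V * exp (- (k * X)) <= eps)%R.
Proof.
  intros HV Hk Heps. exists (V / (k * eps))%R. intros X HX.
  assert (0 < k * eps)%R by nra.
  assert (0 <= V / (k * eps))%R by (apply Rmult_le_pos; [lra|apply Rlt_le, Rinv_0_lt_compat; lra]).
  assert (H1 : (V <= eps * (k * X))%R).
  { replace V with (V / (k * eps) * (k * eps))%R at 1 by (field; nra).
    replace (eps * (k * X))%R with (X * (k * eps))%R by ring.
    apply Rmult_le_compat_r; lra. }
  pose proof (exp_ineq1_le (k * X)) as H2. pose proof (exp_pos (k * X)) as H3.
  rewrite exp_Ropp. apply Rmult_le_reg_r with (1 := H3).
  rewrite Rmult_assoc, Rinv_l by lra. nra.
Qed.

(** Two bounds on [K] are separated on purpose. The small [k] is needed on the horizontal sides,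
    whose contribution remains in the conclusion; the crude [k'] serves on the far vertical side,
    which disappears at fixed [T] because [G * K] decays like [exp (- ((mu - nu) x))]. *)
Lemma tail_integral (G K : C -> C) (c nu mu A k k' T : R) :
  (0 < c)%R -> (nu < mu)%R -> (0 <= T)%R -> (0 <= A)%R -> (0 <= k)%R -> (0 <= k')%R ->
  (forall z, (0 < Re z)%R -> cdiff G z) -> (forall z, (0 < Re z)%R -> cdiff K z) ->
  (forall x y : R, (0 < x)%R -> (Cmod (G (x, y)) <= A * sqrt (1 + Rabs y) * exp (- (mu * x)))%R) ->
  (forall x y : R, (c <= x)%R -> Rabs y = T -> (Cmod (K (x, y)) <= k * exp (nu * x))%R) ->
  (forall x y : R, (c <= x)%R -> (Rabs y <= T)%R -> (Cmod (K (x, y)) <= k' * exp (nu * x))%R) ->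
  (Cmod (CInt (fun y => (G (c, y) * K (c, y))%C) (- T) T) <= 2 * (A * k * sqrt (1 + T) / (mu - nu)))%R.
Proof.
  intros Hc Hnu HT HA Hk Hk' HG HK BG BK BK'.
  set (s := sqrt (1 + T)). assert (Hs : (0 <= s)%R) by apply sqrt_pos.
  assert (HGs : forall x y : R, (0 < x)%R -> (Rabs y <= T)%R ->
    (Cmod (G (x, y)) <= A * s * exp (- (mu * x)))%R).
  { intros x y Hx Hy. eapply Rle_trans; [apply BG; auto|].
    apply Rmult_le_compat_r; [apply Rlt_le, exp_pos|].
    apply Rmult_le_compat_l; auto. apply sqrt_le_1_alt; lra. }
  assert (HP : forall r x y : R, (0 <= r)%R -> (c <= x)%R -> (Rabs y <= T)%R ->
    (Cmod (K (x, y)) <= r * exp (nu * x))%R ->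
    (Cmod (G (x, y) * K (x, y))%C <= A * r * s * exp (- ((mu - nu) * x)))%R).
  { intros r x y Hr Hx Hy HKr. rewrite Cmod_mult.
    apply Rle_trans with ((A * s * exp (- (mu * x))) * (r * exp (nu * x)))%R.
    - apply Rmult_le_compat; auto using Cmod_ge_0. apply HGs; auto; lra.
    - right. replace (- ((mu - nu) * x))%R with (- (mu * x) + nu * x)%R by ring.
      rewrite exp_plus. ring. }
  assert (HD : forall X, (c <= X)%R -> cdiff_rect (fun z => G z * K z) c X (- T) T).
  { intros X HX x y Hx Hy. apply cdiff_mult; [apply HG|apply HK]; unfold Re; simpl; lra. }
  apply le_epsilon. intros eps Heps.
  assert (HV0 : (0 <= (T - - T) * (A * k' * s))%R).
  { apply Rmult_le_pos; [lra|]. repeat apply Rmult_le_pos; auto. }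
  destruct (exp_decay_small ((T - - T) * (A * k' * s)) (mu - nu) eps HV0) as [X0 HX0]; [lra|auto|].
  set (X := Rmax c X0). assert (HX : (c <= X)%R) by apply Rmax_l.
  specialize (HX0 X (Rmax_r _ _)).
  assert (Hkappa : (0 < mu - nu)%R) by lra.
  assert (HH : forall y, Rabs y = T ->
    (Cmod (CInt (fun x => (G (x, y) * K (x, y))%C) c X) <= A * k * s / (mu - nu))%R).
  { intros y Hy.
    apply Rle_trans with
      (A * k * s * ((exp (- ((mu - nu) * c)) - exp (- ((mu - nu) * X))) / (mu - nu)))%R.
    - apply CInt_le with (g := fun x => (A * k * s * exp (- ((mu - nu) * x)))%R); auto.
      + apply (cdiff_rect_H (fun z => G z * K z) c X (- T) T y); auto.
        pose proof (Rle_abs y); pose proof (Rle_abs (- y)); rewrite Rabs_Ropp in *; lra.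
      + intros x Hx. apply HP; auto; try lra. apply BK; auto; lra.
      + apply (is_RInt_scal (V := R_NormedModule)). apply is_RInt_exp; auto; lra.
    - unfold Rdiv. rewrite <- !Rmult_assoc. apply Rmult_le_compat_r.
      + apply Rlt_le, Rinv_0_lt_compat; auto.
      + rewrite <- (Rmult_1_r (A * k * s)) at 2. apply Rmult_le_compat_l.
        * repeat apply Rmult_le_pos; auto.
        * pose proof (exp_pos (- ((mu - nu) * X))).
          assert (exp (- ((mu - nu) * c)) <= 1)%R; [|lra].
          rewrite <- exp_0. apply exp_le_compat. nra. }
  apply Rle_trans with (2 * (A * k * s / (mu - nu)) +
     (T - - T) * (A * k' * s * exp (- ((mu - nu) * X))))%R; [|lra].
  apply (rect_int_left (fun z => G z * K z) c X (- T) T); auto; try lra.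
  - apply HH. rewrite Rabs_Ropp, Rabs_pos_eq; auto.
  - apply HH. rewrite Rabs_pos_eq; auto.
  - apply CInt_le_const; [lra| |].
    + apply (cdiff_rect_V (fun z => G z * K z) c X (- T) T X); auto; lra.
    + intros y Hy. assert (Rabs y <= T)%R by (apply Rabs_le; lra).
      apply HP; auto.
Qed.

(** * Partial sums and Abel summation *)

Definition csum (u : nat -> C) (n : nat) : C := @sum_n C_AbelianMonoid u n.

Lemma csum_O (u : nat -> C) : csum u 0 = u O.
Proof. apply sum_O. Qed.

Lemma csum_S (u : nat -> C) (n : nat) : csum u (S n) = csum u n + u (S n).
Proof. unfold csum. rewrite sum_Sn. reflexivity. Qed.

Lemma csum_ext (u v : nat -> C) (n : nat) :
  (forall k, (k <= n)%nat -> u k = v k) -> csum u n = csum v n.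
Proof.
  induction n as [|n IH]; intros H.
  - rewrite !csum_O; auto.
  - rewrite !csum_S, IH, H; auto.
Qed.

Lemma Cmod_csum_le (u : nat -> C) (v : nat -> R) (n : nat) :
  (forall k, (k <= n)%nat -> (Cmod (u k) <= v k)%R) -> (Cmod (csum u n) <= sum_f_R0 v n)%R.
Proof.
  induction n as [|n IH]; intros H.
  - rewrite csum_O; simpl; auto.
  - rewrite csum_S; simpl. eapply Rle_trans; [apply Cmod_triangle|].
    apply Rplus_le_compat; auto.
Qed.

(** Summation by parts with a telescoping majorant [gam] left free, so that it applies both to
    bounded partial sums and to exponentially growing ones. *)
Lemma abel_bound (b c : nat -> C) (gam : nat -> R) (n : nat) :
  (forall k, (n < k)%nat -> (Cmod (csum b k - csum b n)%C * Cmod (c (S k) - c k)%C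
     <= gam k - gam (S k))%R) ->
  forall j, (Cmod (csum (fun k => b k * c k) (n + S j) - csum (fun k => b k * c k) n
      - (csum b (n + S j) - csum b n) * c (n + S j)%nat)%C <= gam (S n) - gam (n + S j)%nat)%R.
Proof.
  intros H j. induction j as [|j IH].
  - rewrite Nat.add_1_r, !csum_S.
    replace (_ - _ - _) with (RtoC 0) by ring. rewrite Cmod_0; lra.
  - rewrite (Nat.add_succ_r n (S j)), !csum_S.
    set (m := (n + S j)%nat) in *.
    replace (csum (fun k => b k * c k) m + b (S m) * c (S m) - csum (fun k => b k * c k) n
       - (csum b m + b (S m) - csum b n) * c (S m)) with
      ((csum (fun k => b k * c k) m - csum (fun k => b k * c k) n
         - (csum b m - csum b n) * c m) - (csum b m - csum b n) * (c (S m) - c m)) by ring.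
    eapply Rle_trans; [apply Cmod_triangle_minus|]. rewrite (Cmod_mult (csum b m - csum b n)).
    specialize (H m ltac:(unfold m; lia)). lra.
Qed.

(** Integrating the derivative in [t] makes the bound a difference of exponentials, which telescopes
    over consecutive frequencies; the price is the Stolz ratio [Cmod w / Re w]. *)
Lemma Cexp_increment_le (w : C) (x y : R) : (0 < Re w)%R -> (x <= y)%R ->
  (Cmod (Cexp (- (y * w)) - Cexp (- (x * w)))%C
     <= Cmod w / Re w * (exp (- (Re w * x)) - exp (- (Re w * y))))%R.
Proof.
  intros Hw Hxy.
  assert (Hc : ccont_on (fun t : R => - w * Cexp (- (t * w))) x y).
  { apply ccont_on_scal. intros t _. destruct w as [u v].
    split; unfold Cexp, Re, Im; simpl;
    apply (ex_derive_continuous (V := R_NormedModule)); auto_derive; auto. }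
  rewrite <- (path_integral (fun t : R => Cexp (- (t * w))) (fun t : R => - w * Cexp (- (t * w))));
    auto.
  - replace (Cmod w / Re w * (exp (- (Re w * x)) - exp (- (Re w * y))))%R with
      (Cmod w * ((exp (- (Re w * x)) - exp (- (Re w * y))) / Re w))%R by (field; lra).
    apply CInt_le with (g := fun t => (Cmod w * exp (- (Re w * t)))%R); auto.
    + intros t _. rewrite Cmod_mult, Cmod_opp, Cmod_Cexp. right. f_equal. f_equal.
      unfold Re, Copp, Cmult, RtoC; simpl; ring.
    + apply (is_RInt_scal (V := R_NormedModule)). apply is_RInt_exp; auto; lra.
  - intros t _. destruct w as [u v]. split; unfold Cexp, Re, Im; simpl;
      auto_derive; auto; unfold Rminus; ring.
Qed.

Lemma frequency_le (lam : nat -> R) : is_frequency lam ->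
  forall n m, (n <= m)%nat -> (lam n <= lam m)%R.
Proof.
  intros [_ [H _]] n m Hnm. induction Hnm as [|m Hnm IH]; [lra|].
  specialize (H m); lra.
Qed.

Lemma frequency_lt (lam : nat -> R) : is_frequency lam ->
  forall n m, (n < m)%nat -> (lam n < lam m)%R.
Proof.
  intros Hf n m Hnm. pose proof (frequency_le lam Hf (S n) m Hnm).
  destruct Hf as [_ [H1 _]]. specialize (H1 n). lra.
Qed.

Lemma frequency_large (lam : nat -> R) (x : R) : is_frequency lam ->
  exists N, forall n, (N <= n)%nat -> (x < lam n)%R.
Proof.
  intros [_ [_ H]]. apply is_lim_seq_spec in H. destruct (H x) as [N HN]. exists N; auto.
Qed.

Lemma dirichlet_term_shift (lam : nat -> R) (a : nat -> C) (s w : C) (n : nat) :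
  dirichlet_term lam a (s + w) n = dirichlet_term lam a s n * Cexp (- (lam n * w)).
Proof.
  unfold dirichlet_term. rewrite <- Cmult_assoc, <- Cexp_plus. f_equal. f_equal. ring.
Qed.

Lemma dirichlet_abel (lam : nat -> R) (a : nat -> C) (s w : C) (B : R) (n m : nat) :
  is_frequency lam -> (0 < Re w)%R -> (n < m)%nat ->
  (forall k, (n < k)%nat ->
     (Cmod (csum (dirichlet_term lam a s) k - csum (dirichlet_term lam a s) n)%C <= B)%R) ->
  (Cmod (csum (dirichlet_term lam a (s + w)) m - csum (dirichlet_term lam a (s + w)) n)%C
     <= B * (Cmod w / Re w) * exp (- (Re w * lam (S n))))%R.
Proof.
  intros Hf Hw Hnm HB.
  assert (Hlam := frequency_le lam Hf).
  assert (Hq : (1 <= Cmod w / Re w)%R).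
  { apply Rmult_le_reg_r with (1 := Hw). unfold Rdiv. rewrite Rmult_assoc, Rinv_l by lra.
    rewrite Rmult_1_l, Rmult_1_r. eapply Rle_trans; [apply Rle_abs|apply Re_le_Cmod]. }
  set (Q := (Cmod w / Re w)%R) in *.
  assert (HB0 : (0 <= B)%R).
  { eapply Rle_trans; [apply Cmod_ge_0|apply (HB (S n)); lia]. }
  set (c := fun k => Cexp (- (lam k * w))).
  set (b := dirichlet_term lam a s) in *.
  assert (E : forall k, csum (dirichlet_term lam a (s + w)) k = csum (fun k => b k * c k) k).
  { intros k. apply csum_ext. intros; apply dirichlet_term_shift. }
  rewrite !E.
  destruct (Nat.le_exists_sub (S n) m) as [j [Hj _]]; [lia|].
  replace m with (n + S j)%nat in * by lia.
  pose proof (abel_bound b c (fun k => B * Q * exp (- (Re w * lam k)))%R n) as HA.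
  specialize (fun H => HA H j).
  set (T := csum (fun k => b k * c k) (n + S j) - csum (fun k => b k * c k) n) in *.
  set (V := csum b (n + S j) - csum b n) in *.
  assert (HV : (Cmod (V * c (n + S j)%nat)%C <= B * Q * exp (- (Re w * lam (n + S j)%nat)))%R).
  { rewrite Cmod_mult. unfold c. rewrite Cmod_Cexp.
    replace (Re (- (lam (n + S j)%nat * w))) with (- (Re w * lam (n + S j)%nat))%R
      by (unfold Re, Copp, Cmult, RtoC; simpl; ring).
    apply Rmult_le_compat_r; [apply Rlt_le, exp_pos|].
    unfold V. specialize (HB (n + S j)%nat ltac:(lia)). nra. }
  replace T with ((T - V * c (n + S j)%nat) + V * c (n + S j)%nat) by ring.
  eapply Rle_trans; [apply Cmod_triangle|].
  cbv beta in HA. assert (HA' := HA); clear HA.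
  match type of HA' with ?P -> _ => assert (HA : P) end.
  - intros k Hk. rewrite <- Rmult_minus_distr_l, Rmult_assoc.
    apply Rmult_le_compat; auto using Cmod_ge_0.
    apply Cexp_increment_le; auto.
  - specialize (HA' HA). lra.
Qed.

Lemma bounded_of_eventually (x : nat -> R) (M : R) (N : nat) :
  (forall n, (N <= n)%nat -> (x n <= M)%R) -> exists M', forall n, (x n <= M')%R.
Proof.
  revert M. induction N as [|N IH]; intros M H.
  - exists M; intros; apply H; lia.
  - apply (IH (Rmax M (x N))). intros n Hn.
    destruct (Nat.eq_dec n N) as [->|Hne]; [apply Rmax_r|].
    eapply Rle_trans; [apply H; lia|apply Rmax_l].
Qed.

Lemma dirichlet_is_sum_eps (lam : nat -> R) (a : nat -> C) (s l : C) :
  dirichlet_is_sum lam a s l -> forall eps, (0 < eps)%R ->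
  exists N, forall n, (N <= n)%nat -> (Cmod (csum (dirichlet_term lam a s) n - l)%C < eps)%R.
Proof.
  intros H eps Heps.
  assert (Hs : (0 < sqrt 2)%R) by (apply sqrt_lt_R0; lra).
  (* Balls of [C] as a uniform space are squares; passing from them to [Cmod] costs a factor
     [sqrt 2]. *)
  assert (He : (0 < eps / sqrt 2)%R) by (apply Rdiv_lt_0_compat; auto).
  unfold dirichlet_is_sum, is_series in H.
  destruct (proj1 (filterlim_locally _ _) H (mkposreal _ He)) as [N HN].
  exists N. intros n Hn. specialize (HN n Hn).
  apply C_NormedModule_mixin_compat2 in HN. simpl in HN.
  replace (sqrt 2 * (eps / sqrt 2))%R with eps in HN by (field; lra).
  exact HN.
Qed.

Lemma csum_sum_n_m (u : nat -> C) (n m : nat) : (n < m)%nat ->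
  @sum_n_m C_AbelianMonoid u (S n) m = csum u m - csum u n.
Proof.
  intros H. apply (sum_n_m_sum_n (G := C_AbelianGroup)). lia.
Qed.

Lemma dirichlet_partial_sums_bounded (lam : nat -> R) (a : nat -> C) (s : C) :
  dirichlet_converges lam a s -> exists B, (0 <= B)%R /\ forall n k,
    (Cmod (csum (dirichlet_term lam a s) k - csum (dirichlet_term lam a s) n)%C <= B)%R.
Proof.
  intros [l Hl]. destruct (dirichlet_is_sum_eps _ _ _ _ Hl 1%R) as [N HN]; [lra|].
  destruct (bounded_of_eventually
    (fun n => Cmod (csum (dirichlet_term lam a s) n - l)) 1%R N) as [M HM].
  { intros n Hn. apply Rlt_le; auto. }
  assert (H : forall n k,
    (Cmod (csum (dirichlet_term lam a s) k - csum (dirichlet_term lam a s) n)%C <= M + M)%R).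
  { intros n k. replace (_ - _) with ((csum (dirichlet_term lam a s) k - l)
      - (csum (dirichlet_term lam a s) n - l)) by ring.
    eapply Rle_trans; [apply Cmod_triangle_minus|]. apply Rplus_le_compat; apply HM. }
  exists (M + M)%R. split; auto.
  eapply Rle_trans; [apply Cmod_ge_0|apply (H O O)].
Qed.

Lemma dirichlet_converges_right (lam : nat -> R) (a : nat -> C) (s0 s : C) :
  is_frequency lam -> dirichlet_converges lam a s0 -> (Re s0 < Re s)%R ->
  dirichlet_converges lam a s.
Proof.
  intros Hf H0 Hs. destruct (dirichlet_partial_sums_bounded _ _ _ H0) as [B [HB0 HB]].
  set (w := s - s0).
  assert (Hw : (0 < Re w)%R) by (unfold w, Re, Cminus, Cplus, Copp in *; simpl; lra).
  apply (ex_series_Cauchy (V := C_CompleteNormedModule)). intros eps.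
  assert (HV : (0 <= B * (Cmod w / Re w))%R).
  { apply Rmult_le_pos; auto. apply Rmult_le_pos; [apply Cmod_ge_0|].
    apply Rlt_le, Rinv_0_lt_compat; auto. }
  assert (He : (0 < eps / 2)%R) by (destruct eps; simpl; lra).
  destruct (exp_decay_small _ (Re w) (eps / 2) HV Hw He) as [X0 HX0].
  destruct (frequency_large lam X0 Hf) as [N HN].
  (* The Cauchy block starts at [n] itself, so the Abel estimate is applied from its predecessor. *)
  exists (S N). intros n m Hn Hm.
  destruct (Nat.le_gt_cases n m) as [Hnm|Hnm].
  - destruct n as [|n]; [lia|].
    change (Cmod (@sum_n_m C_AbelianMonoid (dirichlet_term lam a s) (S n) m) < eps)%R.
    rewrite csum_sum_n_m by lia.
    replace s with (s0 + w) by (unfold w; ring).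
    eapply Rle_lt_trans; [apply dirichlet_abel with (B := B); auto|].
    eapply Rle_lt_trans; [apply HX0, Rlt_le, HN; lia|]. destruct eps; simpl in *; lra.
  - rewrite sum_n_m_zero by auto.
    change (Cmod 0 < eps)%R. rewrite Cmod_0. apply cond_pos.
Qed.

(** Gives access to the hypothesis on [f], phrased through the abscissa, at points strictly to the
    right of both [s0] and the imaginary axis. *)
Lemma abscissa_conv_le (lam : nat -> R) (a : nat -> C) (s0 : C) :
  is_frequency lam -> dirichlet_converges lam a s0 ->
  Rbar_le (abscissa_conv lam a) (Re s0).
Proof.
  intros Hf H0. apply Glb_Rbar_correct. intros s Hs.
  eapply dirichlet_converges_right; eauto.
Qed.

Lemma Cmod_dirichlet_term (lam : nat -> R) (a : nat -> C) (s : C) (n : nat) :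
  Cmod (dirichlet_term lam a s n) = (Cmod (a n) * exp (- (lam n * Re s)))%R.
Proof.
  unfold dirichlet_term. rewrite Cmod_mult, Cmod_Cexp. f_equal. f_equal.
  unfold Re, Copp, Cmult, RtoC; simpl; ring.
Qed.

Lemma Cmod_dirichlet_term_le (lam : nat -> R) (a : nat -> C) (s : C) (n : nat) :
  is_frequency lam -> (0 <= Re s)%R -> (Cmod (dirichlet_term lam a s n) <= Cmod (a n))%R.
Proof.
  intros [Hl _] Hs. rewrite Cmod_dirichlet_term.
  rewrite <- (Rmult_1_r (Cmod (a n))) at 2. apply Rmult_le_compat_l; [apply Cmod_ge_0|].
  rewrite <- exp_0. apply exp_le_compat. specialize (Hl n). nra.
Qed.

Lemma dirichlet_tail_le (lam : nat -> R) (a : nat -> C) (s0 w l : C) (B : R) (n : nat) :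
  is_frequency lam -> (0 < Re w)%R -> dirichlet_is_sum lam a (s0 + w) l ->
  (forall k, (n < k)%nat ->
     (Cmod (csum (dirichlet_term lam a s0) k - csum (dirichlet_term lam a s0) n)%C <= B)%R) ->
  (Cmod (l - csum (dirichlet_term lam a (s0 + w)) n)%C
     <= B * (Cmod w / Re w) * exp (- (Re w * lam (S n))))%R.
Proof.
  intros Hf Hw Hl HB. apply le_epsilon. intros eps Heps.
  destruct (dirichlet_is_sum_eps _ _ _ _ Hl eps Heps) as [N HN].
  set (m := (N + S n)%nat). specialize (HN m ltac:(unfold m; lia)).
  pose proof (dirichlet_abel lam a s0 w B n m Hf Hw ltac:(unfold m; lia) HB) as K.
  set (u := csum (dirichlet_term lam a (s0 + w))) in *.
  replace (l - u n) with ((u m - u n) - (u m - l)) by ring.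
  eapply Rle_trans; [apply Cmod_triangle_minus|]. lra.
Qed.

(** The tail is bounded and, far to the right, decays at rate [lam (S n)] with linear growth in
    [Im z]; the geometric mean of the two bounds halves both exponents. *)
Lemma dirichlet_tail_growth (lam : nat -> R) (a : nat -> C) (f : C -> C) (B : R) :
  is_frequency lam -> (exists s0, dirichlet_converges lam a s0) ->
  (forall s, (0 < Re s)%R -> (Cmod (f s) <= B)%R) ->
  (forall s, (0 < Re s)%R -> Rbar_lt (abscissa_conv lam a) (Re s) ->
     dirichlet_is_sum lam a s (f s)) ->
  forall n, exists A, (0 <= A)%R /\ forall x y : R, (0 < x)%R ->
    (Cmod (f (x, y) - csum (dirichlet_term lam a (x, y)) n)%C
      <= A * sqrt (1 + Rabs y) * exp (- (lam (S n) / 2 * x)))%R.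
Proof.
  intros Hf [s0 H0] HB Hsum n.
  destruct (dirichlet_partial_sums_bounded _ _ _ H0) as [B0 [HB00 HB0]].
  set (B1 := (B + sum_f_R0 (fun k => Cmod (a k)) n)%R).
  set (L := lam (S n)). assert (HL : (0 <= L)%R) by (apply Hf).
  assert (Hbd : forall x y : R, (0 < x)%R ->
    (Cmod (f (x, y) - csum (dirichlet_term lam a (x, y)) n)%C <= B1)%R).
  { intros x y Hx. eapply Rle_trans; [apply Cmod_triangle_minus|].
    apply Rplus_le_compat; [apply HB; auto|].
    apply Cmod_csum_le. intros k _. apply Cmod_dirichlet_term_le; auto.
    unfold Re; simpl; lra. }
  assert (HB1 : (0 <= B1)%R).
  { eapply Rle_trans; [apply Cmod_ge_0|apply (Hbd 1%R 0%R); lra]. }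
  (* From [x1] on, [f] is the sum of the series and [Re (z - s0) >= 1], so the Stolz ratio is at
     most [(1 + |Im s0|) (1 + |y|)]. *)
  set (x1 := (Rmax 0 (Re s0) + 1)%R).
  assert (Hx1 : (1 <= x1)%R) by (unfold x1; pose proof (Rmax_l 0 (Re s0)); lra).
  set (A2 := (B0 * (1 + Rabs (Im s0)) * exp (L * Re s0))%R).
  assert (HA2 : (0 <= A2)%R).
  { unfold A2. pose proof (Rabs_pos (Im s0)). apply Rmult_le_pos; [nra|apply Rlt_le, exp_pos]. }
  assert (Htail : forall x y : R, (x1 <= x)%R ->
    (Cmod (f (x, y) - csum (dirichlet_term lam a (x, y)) n)%C
      <= A2 * (1 + Rabs y) * exp (- (L * x)))%R).
  { intros x y Hx.
    assert (Hxs : (1 <= x - Re s0)%R) by (unfold x1 in Hx; pose proof (Rmax_r 0 (Re s0)); lra).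
    set (w := (x, y) - s0).
    assert (Ew : Re w = (x - Re s0)%R) by (unfold w, Re, Cminus, Cplus, Copp; simpl; ring).
    assert (Ez : @eq C (x, y) (s0 + w)) by (unfold w; apply injective_projections; simpl; ring).
    rewrite Ez. eapply Rle_trans; [apply dirichlet_tail_le with (B := B0); auto|].
    - lra.
    - rewrite <- Ez. apply Hsum; [unfold Re; simpl; lra|].
      eapply Rbar_le_lt_trans; [apply abscissa_conv_le; eauto|]. simpl. lra.
    - rewrite Ew. fold L.
      replace (- ((x - Re s0) * L))%R with (L * Re s0 + - (L * x))%R by ring.
      rewrite exp_plus, <- Rmult_assoc. apply Rmult_le_compat_r; [apply Rlt_le, exp_pos|].
      unfold A2.
      replace (B0 * (1 + Rabs (Im s0)) * exp (L * Re s0) * (1 + Rabs y))%R with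
        (B0 * ((1 + Rabs (Im s0)) * (1 + Rabs y)) * exp (L * Re s0))%R by ring.
      apply Rmult_le_compat_r; [apply Rlt_le, exp_pos|].
      apply Rmult_le_compat_l; auto.
      apply Rmult_le_reg_r with (x - Re s0)%R; [lra|].
      unfold Rdiv. rewrite Rmult_assoc, Rinv_l, Rmult_1_r by lra.
      eapply Rle_trans; [apply Cmod_le_Re_Im|]. rewrite Ew, Rabs_pos_eq by lra.
      assert (Hi : (Rabs (Im w) <= Rabs y + Rabs (Im s0))%R).
      { replace (Im w) with (y - Im s0)%R by (unfold w, Im, Cminus, Cplus, Copp; simpl; ring).
        unfold Rminus. rewrite <- (Rabs_Ropp (Im s0)). apply Rabs_triang. }
      pose proof (Rabs_pos y); pose proof (Rabs_pos (Im s0)).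
      assert (0 <= Rabs y * Rabs (Im s0))%R by (apply Rmult_le_pos; auto). nra. }
  (* The first summand is the geometric mean used for [x >= x1]; the second pays for the missing
     exponential on the bounded range [x < x1]. *)
  exists (sqrt (B1 * A2) + B1 * exp (L / 2 * x1))%R. split.
  { apply Rplus_le_le_0_compat; [apply sqrt_pos|].
    apply Rmult_le_pos; auto. apply Rlt_le, exp_pos. }
  intros x y Hx.
  assert (Hs1 : (1 <= sqrt (1 + Rabs y))%R).
  { rewrite <- sqrt_1 at 1. apply sqrt_le_1_alt. pose proof (Rabs_pos y); lra. }
  set (g := Cmod (f (x, y) - csum (dirichlet_term lam a (x, y)) n)).
  assert (Hg : (0 <= g)%R) by apply Cmod_ge_0.
  assert (He := exp_pos (- (L / 2 * x))).
  assert (Hsq := sqrt_pos (B1 * A2)).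
  assert (Hp : (0 <= B1 * exp (L / 2 * x1))%R)
    by (apply Rmult_le_pos; auto; apply Rlt_le, exp_pos).
  destruct (Rle_dec x1 x) as [H1|H1].
  - apply Rle_trans with (sqrt (B1 * A2) * sqrt (1 + Rabs y) * exp (- (L / 2 * x)))%R.
    + rewrite <- sqrt_mult by (try apply Rmult_le_pos; auto; pose proof (Rabs_pos y); lra).
      rewrite <- (sqrt_pow2 (exp (- (L / 2 * x)))) by lra.
      rewrite <- sqrt_mult; [|apply Rmult_le_pos; [apply Rmult_le_pos; auto|pose proof (Rabs_pos y); lra]
        |apply pow_le; lra].
      rewrite <- (sqrt_pow2 g) by auto. apply sqrt_le_1_alt.
      replace (exp (- (L / 2 * x)) ^ 2)%R with (exp (- (L * x))).
      * replace (B1 * A2 * (1 + Rabs y) * exp (- (L * x)))%R with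
          (B1 * (A2 * (1 + Rabs y) * exp (- (L * x))))%R by ring.
        replace (g ^ 2)%R with (g * g)%R by ring.
        apply Rmult_le_compat; auto; [apply Hbd; auto|apply Htail; auto].
      * simpl. rewrite Rmult_1_r, <- exp_plus. f_equal. field.
    + apply Rmult_le_compat_r; [lra|]. apply Rmult_le_compat_r; lra.
  - apply Rle_trans with (B1 * exp (L / 2 * x1) * exp (- (L / 2 * x)))%R.
    + rewrite Rmult_assoc, <- exp_plus.
      apply Rle_trans with (B1 * 1)%R; [rewrite Rmult_1_r; apply Hbd; auto|].
      apply Rmult_le_compat_l; auto. rewrite <- exp_0 at 1. apply exp_le_compat. nra.
    + apply Rmult_le_compat_r; [lra|].
      apply Rle_trans with ((B1 * exp (L / 2 * x1)) * sqrt (1 + Rabs y))%R; [nra|].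
      apply Rmult_le_compat_r; lra.
Qed.

(** * Bounds for coefficients and partial sums *)

Lemma ccont_on_csum (u : nat -> R -> C) (n : nat) (p q : R) :
  (forall j, ccont_on (u j) p q) -> ccont_on (fun y => csum (fun j => u j y) n) p q.
Proof.
  intros H. induction n as [|n IH].
  - intros t Ht. destruct (H O t Ht) as [H1 H2].
    split; [refine (continuous_ext _ _ _ _ H1)|refine (continuous_ext _ _ _ _ H2)];
    intros y; rewrite csum_O; auto.
  - intros t Ht. destruct (ccont_on_plus _ _ _ _ IH (H (S n)) t Ht) as [H1 H2].
    split; [refine (continuous_ext _ _ _ _ H1)|refine (continuous_ext _ _ _ _ H2)];
    intros y; rewrite csum_S; auto.
Qed.

Lemma CInt_csum (d : nat -> C) (u : nat -> R -> C) (n : nat) (p q : R) : (p <= q)%R ->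
  (forall j, ccont_on (u j) p q) ->
  CInt (fun y => csum (fun j => d j * u j y) n) p q = csum (fun j => d j * CInt (u j) p q) n.
Proof.
  intros Hpq H. induction n as [|n IH].
  - rewrite csum_O, <- CInt_scal by auto. apply CInt_ext; auto. intros; rewrite csum_O; auto.
  - rewrite csum_S, <- IH, <- CInt_scal, <- CInt_plus; auto.
    + apply CInt_ext; auto. intros; rewrite csum_S; auto.
    + apply (ccont_on_csum (fun j y => d j * u j y)). intros; apply ccont_on_scal; auto.
    + apply ccont_on_scal; auto.
Qed.

Lemma csum_scal_r (u : nat -> C) (c : C) (n : nat) : csum (fun j => u j * c) n = csum u n * c.
Proof.
  induction n as [|n IH]; [rewrite !csum_O; auto|]. rewrite !csum_S, IH. ring.
Qed.

Lemma csum_error (d : nat -> C) (v : nat -> C) (u : R -> nat -> C) (n : nat) :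
  (forall j, exists A, (0 <= A)%R /\ forall T, (1 <= T)%R -> (Cmod (u T j - v j)%C <= A / T)%R) ->
  exists A, (0 <= A)%R /\ forall T, (1 <= T)%R ->
    (Cmod (csum (fun j => d j * u T j) n - csum (fun j => d j * v j) n)%C <= A / T)%R.
Proof.
  intros H. induction n as [|n [A [HA IH]]].
  - destruct (H O) as [A [HA H0]]. exists (Cmod (d O) * A)%R.
    split; [apply Rmult_le_pos; auto using Cmod_ge_0|]. intros T HT. rewrite !csum_O.
    replace (d O * u T O - d O * v O) with (d O * (u T O - v O)) by ring.
    rewrite Cmod_mult. unfold Rdiv. rewrite Rmult_assoc.
    apply Rmult_le_compat_l; auto using Cmod_ge_0.
  - destruct (H (S n)) as [A' [HA' H0]]. exists (A + Cmod (d (S n)) * A')%R.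
    split; [apply Rplus_le_le_0_compat; auto; apply Rmult_le_pos; auto using Cmod_ge_0|].
    intros T HT. rewrite !csum_S.
    replace (_ - _) with ((csum (fun j => d j * u T j) n - csum (fun j => d j * v j) n)
      + d (S n) * (u T (S n) - v (S n))) by ring.
    eapply Rle_trans; [apply Cmod_triangle|]. rewrite (Cmod_mult (d (S n))).
    unfold Rdiv. rewrite Rmult_plus_distr_r, Rmult_assoc.
    apply Rplus_le_compat; [apply IH; auto|].
    apply Rmult_le_compat_l; auto using Cmod_ge_0.
Qed.

Lemma cdiff_csum (u : nat -> C -> C) (n : nat) (z : C) :
  (forall j, cdiff (u j) z) -> cdiff (fun w => csum (fun j => u j w) n) z.
Proof.
  intros H. induction n as [|n IH].
  - apply cdiff_ext with (u O); auto. intros; rewrite csum_O; auto.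
  - apply cdiff_ext with (fun w => csum (fun j => u j w) n + u (S n) w).
    + intros; rewrite csum_S; auto.
    + apply cdiff_plus; auto.
Qed.

Lemma cdiff_Cexp_opp (l : R) (z : C) : cdiff (fun w => Cexp (- (l * w))) z.
Proof.
  apply cdiff_ext with (fun w => Cexp (- l * w)); [intros; f_equal; ring|].
  apply cdiff_Cexp_scal.
Qed.

Lemma cdiff_dirichlet_term (lam : nat -> R) (a : nat -> C) (j : nat) (z : C) :
  cdiff (fun w => dirichlet_term lam a w j) z.
Proof.
  unfold dirichlet_term. apply cdiff_mult; [apply cdiff_const|apply cdiff_Cexp_opp].
Qed.

(** In [f (s + z)] the partial sum contributes the weights [v], and the tail is negligible
    because it can be integrated far to the right. *)
Lemma kernel_extraction (lam : nat -> R) (a : nat -> C) (f : C -> C) (B : R)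
    (s : C) (c nu kap Y : R) (K : R -> C -> C) (v : nat -> C) (n : nat) :
  is_frequency lam -> (exists s0, dirichlet_converges lam a s0) ->
  (forall z, (0 < Re z)%R -> cdiff f z) ->
  (forall z, (0 < Re z)%R -> (Cmod (f z) <= B)%R) ->
  (forall z, (0 < Re z)%R -> Rbar_lt (abscissa_conv lam a) (Re z) ->
     dirichlet_is_sum lam a z (f z)) ->
  (0 < Re s)%R -> (0 < c)%R -> (2 * nu < lam (S n))%R -> (0 <= kap)%R ->
  (forall T z, (1 <= T)%R -> (0 < Re z)%R -> cdiff (K T) z) ->
  (forall T x y, (1 <= T)%R -> (c <= x)%R -> Rabs y = T ->
     (Cmod (K T (x, y)) <= kap / T * exp (nu * x))%R) ->
  (forall T, (1 <= T)%R -> exists k', (0 <= k')%R /\ forall x y, (c <= x)%R -> (Rabs y <= T)%R ->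
     (Cmod (K T (x, y)) <= k' * exp (nu * x))%R) ->
  (forall j, exists A, (0 <= A)%R /\ forall T, (1 <= T)%R ->
     (Cmod (CInt (fun y => Cexp (- (lam j * (c, y)%R)) * K T (c, y))%C (- T) T - v j)%C <= A / T)%R) ->
  (forall T, (1 <= T)%R -> (Cmod (CInt (fun y => f (s + (c, y)%R) * K T (c, y))%C (- T) T) <= Y)%R) ->
  (Cmod (csum (fun j => dirichlet_term lam a s j * v j)%C n) <= Y)%R.
Proof.
  intros Hf Hconv Hhol HB Hsum Hs Hc Hnu Hkap HK BK BK' HI HY.
  destruct (dirichlet_tail_growth lam a f B Hf Hconv HB Hsum n) as [A [HA Hgrow]].
  set (mu := (lam (S n) / 2)%R) in *.
  set (d := dirichlet_term lam a s) in *.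
  set (u := fun T j => CInt (fun y => Cexp (- (lam j * (c, y)%R)) * K T (c, y)) (- T) T).
  destruct (csum_error d v u n HI) as [A1 [HA1 Herr]].
  set (G := fun z => f (s + z) - csum (dirichlet_term lam a (s + z)) n).
  assert (HG : forall z, (0 < Re z)%R -> cdiff G z).
  { intros z Hz. apply cdiff_minus.
    - apply cdiff_shift, Hhol. unfold Re, Cplus in *; simpl; lra.
    - apply (cdiff_shift (fun z => csum (dirichlet_term lam a z) n)).
      apply (cdiff_csum (fun j z => dirichlet_term lam a z j)).
      intros; apply cdiff_dirichlet_term. }
  set (A2 := (A * sqrt (1 + Rabs (Im s)))%R).
  assert (HA2 : (0 <= A2)%R) by (apply Rmult_le_pos; auto using sqrt_pos).
  assert (BG : forall x y : R, (0 < x)%R ->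
    (Cmod (G (x, y)) <= A2 * sqrt (1 + Rabs y) * exp (- (mu * x)))%R).
  { intros x y Hx. unfold G.
    assert (E : @eq C (s + (x, y)%R) (Re s + x, Im s + y)%R)
      by (unfold Re, Im, Cplus; simpl; auto).
    rewrite E. eapply Rle_trans; [apply Hgrow; lra|].
    unfold A2. pose proof (Rabs_pos (Im s)); pose proof (Rabs_pos y).
    apply Rmult_le_compat; try (apply Rlt_le, exp_pos).
    - apply Rmult_le_pos; auto using sqrt_pos.
    - rewrite Rmult_assoc. apply Rmult_le_compat_l; auto.
      rewrite <- sqrt_mult by lra. apply sqrt_le_1_alt.
      pose proof (Rabs_triang (Im s) y). nra.
    - apply exp_le_compat.
      assert (0 <= mu)%R by (unfold mu; pose proof (proj1 Hf (S n)); lra). nra. }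
  assert (Hmu : (0 < mu - nu)%R) by (unfold mu; lra).
  apply le_epsilon. intros eps Heps.
  set (A3 := (A1 + 4 * (A2 * kap / (mu - nu)))%R).
  assert (Hfr : (0 <= A2 * kap / (mu - nu))%R).
  { apply Rmult_le_pos; [apply Rmult_le_pos; auto|apply Rlt_le, Rinv_0_lt_compat; auto]. }
  assert (HA3 : (0 <= A3)%R) by (unfold A3; lra).
  (* [T = r ^ 2] makes the tail error [O(sqrt (1 + T) / T)] an [O(1 / r)]. *)
  set (r := Rmax 1 (A3 / eps)). assert (Hr : (1 <= r)%R) by apply Rmax_l.
  assert (Hr2 : (A3 / r <= eps)%R).
  { assert (H : (A3 / eps <= r)%R) by apply Rmax_r.
    apply Rmult_le_reg_r with r; [lra|]. unfold Rdiv at 1. rewrite Rmult_assoc, Rinv_l by lra.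
    apply Rmult_le_compat_r with (r := eps) in H; [|lra].
    replace (A3 / eps * eps)%R with A3 in H by (field; lra). lra. }
  set (T := (r * r)%R). assert (HT : (1 <= T)%R) by (unfold T; nra).
  specialize (Herr T HT). specialize (HY T HT).
  destruct (BK' T HT) as [k' [Hk' BK'']].
  assert (HkT : (0 <= kap / T)%R)
    by (apply Rmult_le_pos; auto; apply Rlt_le, Rinv_0_lt_compat; lra).
  assert (Htail := tail_integral G (K T) c nu mu A2 (kap / T) k' T Hc ltac:(lra) ltac:(lra)
    HA2 HkT Hk' HG (fun z Hz => HK T z HT Hz) BG (fun x y Hx Hy => BK T x y HT Hx Hy) BK'').
  assert (HcontK : forall (F : C -> C), (forall z, (0 < Re z)%R -> cdiff F z) ->
    ccont_on (fun y => F (c, y) * K T (c, y)) (- T) T).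
  { intros F HF y _. apply (ccont_V (fun z => F z * K T z)).
    apply cdiff_mult; [apply HF|apply HK]; auto; unfold Re; simpl; lra. }
  (* Term by term integration is applied to a finite sum only; all convergence issues are confined
     to [G]. *)
  assert (E : CInt (fun y => f (s + (c, y)%R) * K T (c, y)) (- T) T =
     csum (fun j => d j * u T j) n + CInt (fun y => G (c, y) * K T (c, y)) (- T) T).
  { unfold u. rewrite <- (CInt_csum d (fun j y => Cexp (- (lam j * (c, y)%R)) * K T (c, y)));
      [|lra|].
    - rewrite <- CInt_plus; [|lra| |].
      + apply CInt_ext; [lra|]. intros y _. unfold G.
        rewrite (csum_ext (fun j => d j * _) (fun j => (d j * Cexp (- (lam j * (c, y)%R))) * K T (c, y)))
          by (intros; ring).
        rewrite csum_scal_r.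
        rewrite (csum_ext (dirichlet_term lam a (s + (c, y)%R))
          (fun j => d j * Cexp (- (lam j * (c, y)%R)))) by (intros; apply dirichlet_term_shift).
        ring.
      + apply (ccont_on_csum (fun j y => d j * (Cexp (- (lam j * (c, y)%R)) * K T (c, y)))).
        intros j. apply ccont_on_scal. apply (HcontK (fun z => Cexp (- (lam j * z)))).
        intros; apply cdiff_Cexp_opp.
      + apply HcontK; auto.
    - intros j. apply (HcontK (fun z => Cexp (- (lam j * z)))). intros; apply cdiff_Cexp_opp. }
  set (Q := CInt (fun y => f (s + (c, y)%R) * K T (c, y)) (- T) T) in *.
  set (P := CInt (fun y => G (c, y) * K T (c, y)) (- T) T) in *.
  set (U := csum (fun j => d j * u T j) n) in *.
  set (V := csum (fun j => d j * v j) n) in *.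
  replace V with ((Q - P) - (U - V)) by (rewrite E; ring).
  eapply Rle_trans; [apply Cmod_triangle_minus|].
  assert (Cmod (Q - P) <= Cmod Q + Cmod P)%R by apply Cmod_triangle_minus.
  assert (Hsq : (sqrt (1 + T) <= 2 * r)%R).
  { rewrite <- (sqrt_pow2 (2 * r)) by lra. apply sqrt_le_1_alt. unfold T. nra. }
  assert (F1 : (A1 / T <= A1 / r)%R).
  { apply Rmult_le_compat_l; auto. apply Rinv_le_contravar; [lra|unfold T; nra]. }
  assert (F2 : (2 * (A2 * (kap / T) * sqrt (1 + T) / (mu - nu)) <= 4 * (A2 * kap / (mu - nu)) / r)%R).
  { replace (2 * (A2 * (kap / T) * sqrt (1 + T) / (mu - nu)))%R with
      (2 * (A2 * kap / (mu - nu)) * (sqrt (1 + T) / T))%R by (field; lra).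
    replace (4 * (A2 * kap / (mu - nu)) / r)%R with
      (2 * (A2 * kap / (mu - nu)) * (2 * r / T))%R by (unfold T; field; lra).
    apply Rmult_le_compat_l; [lra|]. apply Rmult_le_compat_r; auto.
    apply Rlt_le, Rinv_0_lt_compat; lra. }
  assert (F3 : (A3 / r = A1 / r + 4 * (A2 * kap / (mu - nu)) / r)%R) by (unfold A3; field; lra).
  lra.
Qed.

Lemma csum_pick (d : nat -> C) (k n : nat) : (k <= n)%nat ->
  csum (fun j => d j * (if Nat.eq_dec j k then 1 else 0)) n = d k.
Proof.
  assert (Z : forall m, (m < k)%nat -> csum (fun j => d j * (if Nat.eq_dec j k then 1 else 0)) m = 0).
  { induction m as [|m IH]; intros Hm.
    - rewrite csum_O. destruct (Nat.eq_dec 0 k); [lia|]. ring.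
    - rewrite csum_S, IH by lia. destruct (Nat.eq_dec (S m) k); [lia|]. ring. }
  induction n as [|n IH]; intros Hk.
  - rewrite csum_O. destruct (Nat.eq_dec 0 k); [subst; ring|lia].
  - rewrite csum_S. destruct (Nat.eq_dec (S n) k) as [<-|Hne].
    + rewrite Z by lia. ring.
    + rewrite IH by lia. ring.
Qed.

(** A bound independent of [T]: after division by [2 T] every frequency other than the selected one
    averages out. *)
Lemma CInt_Cexp_V (nu c T : R) : nu <> 0%R -> (0 <= T)%R ->
  (Cmod (CInt (fun y => Cexp (nu * (c, y)%R))%C (- T) T) <= 2 * exp (nu * c) / Rabs nu)%R.
Proof.
  intros Hnu HT.
  assert (Hnu' : RtoC nu <> 0%R) by (intros E; apply Hnu; injection E; auto).
  assert (Hd : forall z, is_cderiv (fun z => / nu * Cexp (nu * z)) z (Cexp (nu * z))).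
  { intros z. replace (Cexp (nu * z)) with (0 * Cexp (nu * z) + / nu * (nu * Cexp (nu * z)))
      by (field; auto).
    apply (is_cderiv_mult (fun _ => / nu) (fun z => Cexp (nu * z)));
      [apply is_cderiv_const|apply is_cderiv_Cexp_scal]. }
  pose proof (CInt_primitive_V (fun z => / nu * Cexp (nu * z)) (fun z => Cexp (nu * z)) c (- T) T
    ltac:(lra) (fun y _ => Hd _)
    ltac:(intros y _; apply (ccont_V (fun z => Cexp (nu * z))), cdiff_Cexp_scal)) as E.
  cbv beta in E.
  set (I := CInt (fun y => Cexp (nu * (c, y)%R)) (- T) T) in *.
  assert (K : Cmod (Ci * I) = Cmod I) by (rewrite Cmod_mult, Cmod_Ci; ring).
  rewrite <- K. setoid_rewrite E. eapply Rle_trans; [apply Cmod_triangle_minus|].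
  rewrite !Cmod_mult, !Cmod_Cexp, !Re_real_mult, Cmod_inv, Cmod_R by auto.
  unfold Re; simpl fst. right. field. apply Rabs_no_R0; auto.
Qed.

Lemma dirichlet_coeff_bound (lam : nat -> R) (a : nat -> C) (f : C -> C) (B : R) (k : nat) :
  is_frequency lam -> (exists s0, dirichlet_converges lam a s0) ->
  (forall z, (0 < Re z)%R -> cdiff f z) ->
  (forall z, (0 < Re z)%R -> (Cmod (f z) <= B)%R) ->
  (forall z, (0 < Re z)%R -> Rbar_lt (abscissa_conv lam a) (Re z) ->
     dirichlet_is_sum lam a z (f z)) ->
  (Cmod (a k) <= 9 * B)%R.
Proof.
  intros Hf Hconv Hhol HB Hsum.
  assert (HL := proj1 Hf k). set (L := lam k) in *.
  assert (HB0 : (0 <= B)%R).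
  { eapply Rle_trans; [apply Cmod_ge_0|apply (HB 1)]. unfold Re; simpl; lra. }
  (* Keeps [exp (L * c)] below [3] uniformly in [L]; the [1 +] allows a zero first frequency. *)
  set (c := (/ (1 + L))%R). assert (Hc : (0 < c)%R) by (apply Rinv_0_lt_compat; lra).
  assert (HcL : (L * c <= 1)%R).
  { unfold c. apply Rmult_le_reg_r with (1 + L)%R; [lra|].
    rewrite Rmult_assoc, Rinv_l by lra. lra. }
  destruct (frequency_large lam (2 * L) Hf) as [N HN].
  set (n := (N + k)%nat).
  (* The base point and the line are both at real part [c]. The kernel depends on [T] through the
     normalisation [1 / (2 T)] of the mean value, and [/ 2] is exactly its constant on the
     horizontal sides. *)
  assert (H := kernel_extraction lam a f B (RtoC c) c L (/ 2) (B * exp (L * c))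
    (fun T z => Cexp (L * z) * / (2 * T)%R)
    (fun j => if Nat.eq_dec j k then 1 else 0) n Hf Hconv Hhol HB Hsum).
  cbv beta in H. rewrite csum_pick in H by (unfold n; lia).
  assert (K : (Cmod (a k) * exp (- (L * c)) <= B * exp (L * c))%R).
  { replace (Cmod (a k) * exp (- (L * c)))%R with (Cmod (dirichlet_term lam a c k)).
    2:{ rewrite Cmod_dirichlet_term. unfold Re, RtoC; simpl. auto. }
    apply H; clear H; auto; try lra.
    - apply HN; unfold n; lia.
    - intros T z _ _. apply cdiff_mult; [apply cdiff_Cexp_scal|apply cdiff_const].
    - intros T x y HT _ _. rewrite Cmod_mult, Cmod_Cexp, Re_real_mult, Cmod_inv, Cmod_R.
      + rewrite Rabs_pos_eq by lra. unfold Re; simpl fst. right. field. lra.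
      + intros E. injection E; lra.
    - intros T HT. exists (/ (2 * T))%R. split; [apply Rlt_le, Rinv_0_lt_compat; lra|].
      intros x y _ _. rewrite Cmod_mult, Cmod_Cexp, Re_real_mult, Cmod_inv, Cmod_R.
      + rewrite Rabs_pos_eq by lra. unfold Re; simpl fst. right. ring.
      + intros E. injection E; lra.
    - intros j.
      assert (EI : forall T, (1 <= T)%R ->
        CInt (fun y => Cexp (- (lam j * (c, y)%R)) * (Cexp (L * (c, y)%R) * / (2 * T)%R)) (- T) T
        = / (2 * T)%R * CInt (fun y => Cexp ((L - lam j)%R * (c, y)%R)) (- T) T).
      { intros T HT. rewrite <- CInt_scal; [|lra|].
        - apply CInt_ext; [lra|]. intros y _.
          replace ((L - lam j)%R * (c, y)%R) with (- (lam j * (c, y)%R) + L * (c, y)%R)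
            by (rewrite RtoC_minus; ring).
          rewrite Cexp_plus. ring.
        - intros y _. apply (ccont_V (fun z => Cexp ((L - lam j)%R * z))), cdiff_Cexp_scal. }
      destruct (Nat.eq_dec j k) as [->|Hne].
      + exists 0%R. split; [lra|]. intros T HT. rewrite EI by auto. fold L.
        rewrite (CInt_ext _ (fun _ => RtoC 1)); [|lra|].
        2:{ intros y _. rewrite <- Cexp_0. f_equal. rewrite Rminus_diag. ring. }
        replace (CInt (fun _ : R => RtoC 1) (- T) T) with (RtoC (2 * T)).
        * replace (/ (2 * T)%R * (2 * T)%R - 1) with (RtoC 0).
          -- rewrite Cmod_0. lra.
          -- field. intros E. injection E; lra.
        * unfold CInt, RtoC, Re, Im; simpl. rewrite !RInt_const.
          unfold scal; simpl; unfold mult; simpl. f_equal; ring.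
      + assert (Hnu : (L - lam j)%R <> 0%R).
        { intros E. destruct (Nat.lt_total j k) as [Hlt|[Heq|Hlt]]; [|auto|];
          apply (frequency_lt lam Hf) in Hlt; unfold L in E; lra. }
        assert (Hab := Rabs_pos_lt _ Hnu).
        exists (exp ((L - lam j) * c) / Rabs (L - lam j))%R. split.
        { apply Rmult_le_pos; [apply Rlt_le, exp_pos|apply Rlt_le, Rinv_0_lt_compat; auto]. }
        intros T HT. rewrite EI by auto.
        replace (/ (2 * T)%R * _ - 0) with
          (/ (2 * T)%R * CInt (fun y => Cexp ((L - lam j)%R * (c, y)%R)) (- T) T) by ring.
        rewrite Cmod_mult, Cmod_inv, Cmod_R, Rabs_pos_eq by (lra || (intros E; injection E; lra)).
        apply Rle_trans with (/ (2 * T) * (2 * exp ((L - lam j) * c) / Rabs (L - lam j)))%R.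
        * apply Rmult_le_compat_l; [apply Rlt_le, Rinv_0_lt_compat; lra|].
          apply CInt_Cexp_V; auto; lra.
        * right. field. lra.
    - intros T HT.
      replace (B * exp (L * c))%R with ((T - - T) * (B * (exp (L * c) * / (2 * T))))%R
        by (field; lra).
      apply CInt_le_const; [lra| |].
      + intros y _. apply (ccont_V (fun z => f (RtoC c + z) * (Cexp (L * z) * / (2 * T)%R))).
        apply cdiff_mult.
        * apply cdiff_shift, Hhol. unfold Re, Cplus, RtoC; simpl; lra.
        * apply cdiff_mult; [apply cdiff_Cexp_scal|apply cdiff_const].
      + intros y _. rewrite !Cmod_mult, Cmod_Cexp, Re_real_mult, Cmod_inv, Cmod_R
          by (intros E; injection E; lra).
        rewrite (Rabs_pos_eq (2 * T)) by lra. unfold Re; simpl fst.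
        apply Rmult_le_compat_r.
        * apply Rmult_le_pos; [apply Rlt_le, exp_pos|apply Rlt_le, Rinv_0_lt_compat; lra].
        * apply HB. unfold Re, Cplus, RtoC; simpl; lra. }
  (* Undoing the weight of the [k]-th term at the point [c] gives a second factor [exp (L * c)],
     whence [9 = 3 * 3]. *)
  apply Rmult_le_compat_r with (r := exp (L * c)) in K; [|apply Rlt_le, exp_pos].
  rewrite Rmult_assoc, <- exp_plus in K.
  replace (- (L * c) + L * c)%R with 0%R in K by ring. rewrite exp_0, Rmult_1_r in K.
  eapply Rle_trans; [apply K|]. rewrite Rmult_assoc, Rmult_comm.
  apply Rmult_le_compat_r; auto.
  assert (exp (L * c) <= 3)%R.
  { eapply Rle_trans; [apply exp_le_compat, HcL|apply exp_le_3]. }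
  pose proof (exp_pos (L * c)). nra.
Qed.

(** * The trapezoid kernel: size, L^1-norm and transform *)

Lemma Cexp_difference_le (p q : R) (z : C) : (p <= q)%R -> (0 <= Re z)%R ->
  (Cmod (Cexp (q * z) - Cexp (p * z))%C <= (q - p) * (Cmod z * exp (q * Re z)))%R.
Proof.
  intros Hpq Hz.
  assert (Hc : ccont_on (fun t : R => z * Cexp (t * z)) p q).
  { apply ccont_on_scal. intros t _. destruct z as [u v].
    split; unfold Cexp, Re, Im; simpl;
    apply (ex_derive_continuous (V := R_NormedModule)); auto_derive; auto. }
  rewrite <- (path_integral (fun t : R => Cexp (t * z)) (fun t : R => z * Cexp (t * z))); auto.
  - apply CInt_le_const; auto. intros t Ht.
    rewrite Cmod_mult, Cmod_Cexp, Re_real_mult.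
    apply Rmult_le_compat_l; [apply Cmod_ge_0|]. apply exp_le_compat. nra.
  - intros t _. destruct z as [u v]. split; unfold Cexp, Re, Im; simpl;
      auto_derive; auto; unfold Rminus; ring.
Qed.

(** The transform of this kernel is the trapezoid equal to [1] on [[0, p]] and to [0] on
    [[q, +oo)]. *)
Definition trapezoid_kernel (p q : R) (z : C) : C :=
  (perron_kernel q z - perron_kernel p z) * / (2 * PI * (q - p))%R.

Lemma cdiff_trapezoid_kernel (p q : R) (z : C) : z <> 0%R -> cdiff (trapezoid_kernel p q) z.
Proof.
  intros Hz. apply cdiff_mult; [|apply cdiff_const].
  apply cdiff_minus; apply cdiff_perron_kernel; auto.
Qed.

Lemma Cmod_trapezoid_kernel (p q : R) (z : C) : (p < q)%R ->
  Cmod (trapezoid_kernel p q z) =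
  (Cmod (perron_kernel q z - perron_kernel p z)%C / (2 * PI * (q - p)))%R.
Proof.
  intros Hpq. pose proof PI_RGT_0.
  assert (0 < 2 * PI * (q - p))%R by (apply Rmult_lt_0_compat; lra).
  unfold trapezoid_kernel. rewrite Cmod_mult, Cmod_inv, Cmod_R, Rabs_pos_eq; auto; try lra.
  intros E; injection E; lra.
Qed.

Lemma trapezoid_kernel_le (p q x y r : R) : (0 <= p < q)%R -> (0 < r)%R -> (0 <= x)%R ->
  (r <= Rabs x \/ r <= Rabs y)%R ->
  (Cmod (trapezoid_kernel p q (x, y)) <= / (PI * (q - p)) / r ^ 2 * exp (q * x))%R.
Proof.
  intros Hpq Hr Hx H. pose proof PI_RGT_0.
  assert (0 < PI * (q - p))%R by (apply Rmult_lt_0_compat; lra).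
  rewrite Cmod_trapezoid_kernel by lra.
  assert (Hr2 : (0 < r ^ 2)%R) by (apply pow_lt; auto).
  assert (HK1 := perron_kernel_le q x y r Hr H).
  assert (HK2 := perron_kernel_le p x y r Hr H).
  assert (HK3 : (exp (p * x) <= exp (q * x))%R) by (apply exp_le_compat; nra).
  assert (HK4 : (exp (p * x) / r ^ 2 <= exp (q * x) / r ^ 2)%R).
  { apply Rmult_le_compat_r; auto. apply Rlt_le, Rinv_0_lt_compat; auto. }
  replace (/ (PI * (q - p)) / r ^ 2 * exp (q * x))%R with
    (2 * (exp (q * x) / r ^ 2) / (2 * PI * (q - p)))%R by (field; lra).
  apply Rmult_le_compat_r; [apply Rlt_le, Rinv_0_lt_compat; lra|].
  eapply Rle_trans; [apply Cmod_triangle_minus|]. lra.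
Qed.

(** The majorant is rational in [|y|], so its integral is elementary: [v] is a lower bound for [|z|]
    free of square roots, and [12 x / (2 + x)] replaces the minimum of [3 x] and [6]. *)
Lemma trapezoid_kernel_line_le (p q c y : R) : (0 <= p < q)%R -> (0 < c)%R -> (q * c = 1)%R ->
  let v := ((c + Rabs y) / 2)%R in
  (Cmod (trapezoid_kernel p q (c, y))
     <= / (2 * PI * (q - p)) * (3 * (4 * (q - p) / (v * (2 + (q - p) * v)))))%R.
Proof.
  intros Hpq Hc Hqc v. pose proof PI_RGT_0.
  set (D := (q - p)%R) in *. assert (HD : (0 < D)%R) by (unfold D; lra).
  assert (0 < 2 * PI * D)%R by (apply Rmult_lt_0_compat; lra).
  rewrite Cmod_trapezoid_kernel by lra. fold D. unfold Rdiv at 1. rewrite Rmult_comm.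
  apply Rmult_le_compat_l; [apply Rlt_le, Rinv_0_lt_compat; lra|].
  set (z := ((c, y) : C)). set (r := Cmod z).
  assert (Hv : (0 < v)%R) by (unfold v; pose proof (Rabs_pos y); lra).
  assert (Hvr : (v <= r)%R).
  { assert (c <= r)%R by (unfold r; eapply Rle_trans; [apply Rle_abs|apply (Re_le_Cmod z)]).
    assert (Rabs y <= r)%R by apply (Im_le_Cmod z). unfold v; lra. }
  assert (Hz : z <> 0%R) by (apply Cmod_gt_0; fold r; lra).
  assert (He1 : (exp (q * c) <= 3)%R) by (rewrite Hqc; apply exp_le_3).
  set (N := Cmod (Cexp (q * z) - Cexp (p * z))).
  assert (HN1 : (N <= 3 * (D * r))%R).
  { eapply Rle_trans; [apply Cexp_difference_le; [lra|unfold Re; simpl; lra]|].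
    fold r D. change (Re z) with c.
    replace (3 * (D * r))%R with (D * (r * 3))%R by ring.
    repeat apply Rmult_le_compat_l; lra. }
  assert (HN2 : (N <= 6)%R).
  { eapply Rle_trans; [apply Cmod_triangle_minus|].
    rewrite !Cmod_Cexp, !Re_real_mult. change (Re z) with c.
    assert (exp (p * c) <= exp (q * c))%R by (apply exp_le_compat; nra). lra. }
  assert (HDr : (0 < D * r)%R) by (apply Rmult_lt_0_compat; lra).
  (* Merges the mean value bound [HN1], good for [D * r <= 2], with the trivial bound [HN2]. *)
  assert (HN : (N <= 3 * (4 * (D * r) / (2 + D * r)))%R).
  { apply Rmult_le_reg_r with (2 + D * r)%R; [lra|].
    replace (3 * (4 * (D * r) / (2 + D * r)) * (2 + D * r))%R with (12 * (D * r))%R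
      by (field; lra).
    destruct (Rle_dec (D * r) 2); nra. }
  replace (perron_kernel q z - perron_kernel p z) with
    ((Cexp (q * z) - Cexp (p * z)) * / (z * z)) by (unfold perron_kernel; ring).
  rewrite Cmod_mult, Cmod_inv, Cmod_mult by (apply Cmult_neq_0; auto). fold N r.
  apply Rle_trans with (3 * (4 * (D * r) / (2 + D * r)) * / (r * r))%R.
  - apply Rmult_le_compat_r; auto. apply Rlt_le, Rinv_0_lt_compat; nra.
  - replace (3 * (4 * (D * r) / (2 + D * r)) * / (r * r))%R with
      (3 * (4 * D * / (r * (2 + D * r))))%R by (field; lra).
    apply Rmult_le_compat_l; [lra|]. apply Rmult_le_compat_l; [lra|].
    assert (D * v <= D * r)%R by (apply Rmult_le_compat_l; lra).
    assert (0 < D * v)%R by (apply Rmult_lt_0_compat; lra).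
    apply Rinv_le_contravar; [apply Rmult_lt_0_compat; lra|].
    apply Rmult_le_compat; lra.
Qed.

(** By partial fractions [F] is a primitive of twice the majorant in [v]. Since [D * v < 2 + D * v],
    it stays below [- 4 D ln D], which makes the bound uniform in [T]. *)
Lemma trapezoid_integral_value (D c T : R) : (0 < D)%R -> (0 < c)%R -> (0 <= T)%R ->
  let F := fun v : R => (4 * D * (ln v - ln (2 + D * v)))%R in
  (F ((c + T) / 2) - F (c / 2) <= 4 * D * ln (1 + 4 / (D * c)))%R.
Proof.
  intros HD Hc HT F. unfold F.
  set (v := ((c + T) / 2)%R). set (v0 := (c / 2)%R).
  assert (Hv : (0 < v)%R) by (unfold v; lra). assert (Hv0 : (0 < v0)%R) by (unfold v0; lra).
  assert (0 < D * v)%R by (apply Rmult_lt_0_compat; lra).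
  assert (0 < D * v0)%R by (apply Rmult_lt_0_compat; lra).
  assert (H1 : (ln D + ln v <= ln (2 + D * v))%R).
  { rewrite <- ln_mult by auto. apply Rlt_le, ln_increasing; lra. }
  assert (H2 : (ln (1 + 4 / (D * c)) = ln (2 + D * v0) - (ln D + ln v0))%R).
  { rewrite <- ln_mult, <- ln_div by (auto; lra). f_equal. unfold v0. field. lra. }
  rewrite H2. rewrite <- Rmult_minus_distr_l. apply Rmult_le_compat_l; lra.
Qed.

Lemma trapezoid_integral_le (G : C -> C) (p q c T B : R) :
  (0 <= p < q)%R -> (0 < c)%R -> (q * c = 1)%R -> (0 <= T)%R -> (0 <= B)%R ->
  (forall z, (0 < Re z)%R -> cdiff G z) ->
  (forall z, (0 < Re z)%R -> (Cmod (G z) <= B)%R) ->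
  (Cmod (CInt (fun y => G (c, y) * trapezoid_kernel p q (c, y))%C (- T) T)
    <= 4 * B * (4 + ln ((q + p) / (q - p))))%R.
Proof.
  intros Hpq Hc Hqc HT HB HG BG. pose proof PI_RGT_0 as Hpi.
  pose proof PI2_3_2 as Hpi3.
  set (D := (q - p)%R). assert (HD : (0 < D)%R) by (unfold D; lra).
  assert (HpD : (0 < 2 * PI * D)%R) by (apply Rmult_lt_0_compat; lra).
  set (F := fun v : R => (4 * D * (ln v - ln (2 + D * v)))%R).
  set (h := fun v : R => (4 * D / (v * (2 + D * v)))%R).
  set (k := (B * (/ (2 * PI * D) * 3))%R).
  assert (Hk : (0 <= k)%R).
  { unfold k. apply Rmult_le_pos; auto. apply Rmult_le_pos; [|lra].
    apply Rlt_le, Rinv_0_lt_compat; auto. }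
  assert (HF : forall v, (0 < v)%R -> is_derive F v (2 * h v)%R).
  { intros v Hv. assert (0 < D * v)%R by (apply Rmult_lt_0_compat; lra).
    unfold F, h. auto_derive; [repeat split; lra|]. field. lra. }
  assert (Hh : forall v, (0 < v)%R -> continuous h v).
  { intros v Hv. assert (0 < D * v)%R by (apply Rmult_lt_0_compat; lra).
    unfold h. apply (ex_derive_continuous (V := R_NormedModule)). auto_derive.
    apply Rmult_integral_contrapositive; lra. }
  (* The majorant depends on [|y|], hence one primitive for each half of the segment. The [2] in
     [HF] cancels the inner derivative [1 / 2]. *)
  assert (I1 : is_RInt (fun y => h ((c + y) / 2)%R) 0 T (F ((c + T) / 2) - F ((c + 0) / 2))%R).
  { apply (is_RInt_derive (V := R_CompleteNormedModule) (fun y => F ((c + y) / 2)%R));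
      intros y; rewrite Rmin_left, Rmax_right by auto; intros Hy.
    - replace (h ((c + y) / 2))%R with (/ 2 * (2 * h ((c + y) / 2)))%R by field.
      apply (is_derive_comp F (fun y => (c + y) / 2)%R); [apply HF; lra|].
      auto_derive; auto; field.
    - apply (continuous_comp (fun y => (c + y) / 2)%R h).
      + apply (ex_derive_continuous (V := R_NormedModule)). auto_derive; auto.
      + apply Hh; lra. }
  assert (I2 : is_RInt (fun y => h ((c - y) / 2)%R) (- T) 0
     (- F ((c - 0) / 2) - - F ((c - - T) / 2))%R).
  { apply (is_RInt_derive (V := R_CompleteNormedModule) (fun y => - F ((c - y) / 2))%R);
      intros y; rewrite Rmin_left, Rmax_right by lra; intros Hy.
    - replace (h ((c - y) / 2))%R with (- (- / 2 * (2 * h ((c - y) / 2))))%R by field.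
      apply (is_derive_opp (V := R_NormedModule) (fun y => F ((c - y) / 2))%R).
      apply (is_derive_comp F (fun y => (c - y) / 2)%R); [apply HF; lra|].
      auto_derive; auto; field.
    - apply (continuous_comp (fun y => (c - y) / 2)%R h).
      + apply (ex_derive_continuous (V := R_NormedModule)). auto_derive; auto.
      + apply Hh; lra. }
  replace ((c + 0) / 2)%R with (c / 2)%R in I1 by field.
  replace ((c - 0) / 2)%R with (c / 2)%R in I2 by field.
  replace ((c - - T) / 2)%R with ((c + T) / 2)%R in I2 by field.
  assert (V := trapezoid_integral_value D c T HD Hc HT). cbv zeta in V. fold F in V.
  cbv beta in V. change (4 * D * (ln ((c + T) / 2) - ln (2 + D * ((c + T) / 2))))%R
    with (F ((c + T) / 2)%R) in V.
  change (4 * D * (ln (c / 2) - ln (2 + D * (c / 2))))%R with (F (c / 2)%R) in V.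
  set (J := (F ((c + T) / 2) - F (c / 2))%R) in *.
  set (u := fun y : R => G (c, y) * trapezoid_kernel p q (c, y)).
  assert (Hcont : ccont_on u (- T) T).
  { intros y _. apply (ccont_V (fun z => G z * trapezoid_kernel p q z)).
    apply cdiff_mult; [apply HG; unfold Re; simpl; lra|].
    apply cdiff_trapezoid_kernel, pair_neq_0; left; lra. }
  assert (Hu : forall y, (Cmod (u y) <= k * h ((c + Rabs y) / 2))%R).
  { intros y. unfold u. rewrite Cmod_mult. unfold k. rewrite Rmult_assoc.
    apply Rmult_le_compat; [apply Cmod_ge_0|apply Cmod_ge_0|apply BG; auto|].
    rewrite Rmult_assoc. apply trapezoid_kernel_line_le; auto. }
  rewrite (CInt_chasles u (- T) 0 T); [|lra|auto].
  assert (K2 : (Cmod (CInt u (- T) 0) <= k * J)%R).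
  { apply CInt_le with (g := fun y => (k * h ((c - y) / 2))%R); [lra| | |].
    - intros y Hy; apply Hcont; lra.
    - intros y Hy. eapply Rle_trans; [apply Hu|]. rewrite Rabs_left1 by lra.
      right. f_equal.
    - replace (k * J)%R with (k * (- F (c / 2) - - F ((c + T) / 2)))%R by (unfold J; ring).
      apply (is_RInt_scal (V := R_NormedModule)); auto. }
  assert (K1 : (Cmod (CInt u 0 T) <= k * J)%R).
  { apply CInt_le with (g := fun y => (k * h ((c + y) / 2))%R); [lra| | |].
    - intros y Hy; apply Hcont; lra.
    - intros y Hy. eapply Rle_trans; [apply Hu|]. rewrite Rabs_pos_eq by lra. lra.
    - apply (is_RInt_scal (V := R_NormedModule)); auto. }
  set (W := (4 + ln ((q + p) / D))%R).
  assert (Hln : (ln (1 + 4 / (D * c)) <= W)%R).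
  { assert (Hqq : (q + p = D + 2 * p)%R) by (unfold D; ring).
    assert (Hr : (0 < (q + p) / D)%R) by (apply Rdiv_lt_0_compat; lra).
    assert (H0 : (0 < 4 / (D * c))%R)
      by (apply Rdiv_lt_0_compat; [lra|apply Rmult_lt_0_compat; lra]).
    assert (H5 : (ln 5 <= 4)%R).
    { rewrite <- (ln_exp 4). apply ln_le; [lra|]. pose proof (exp_ineq1_le 4); lra. }
    (* With [c = 1 / q] the argument is [(D + 4 q) / D], at most [5 (q + p) / D]; [ln 5] is then
       absorbed in the additive [4]. *)
    apply Rle_trans with (ln (5 * ((q + p) / D))).
    - assert (Hle : (1 + 4 / (D * c) <= 5 * ((q + p) / D))%R).
      { replace (4 / (D * c))%R with (4 * q / D)%R.
        - apply Rmult_le_reg_r with D; auto.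
          replace ((1 + 4 * q / D) * D)%R with (D + 4 * q)%R by (field; lra).
          replace (5 * ((q + p) / D) * D)%R with (5 * (q + p))%R by (field; lra).
          unfold D; lra.
        - replace (4 * q / D)%R with (4 * (q * c) / (D * c))%R by (field; lra).
          rewrite Hqc. f_equal; ring. }
      apply ln_le; lra.
    - rewrite ln_mult by lra. unfold W. lra. }
  eapply Rle_trans; [apply Cmod_triangle|].
  apply Rle_trans with (2 * (k * (4 * D * W)))%R.
  - assert (J <= 4 * D * W)%R.
    { eapply Rle_trans; [apply V|]. apply Rmult_le_compat_l; lra. }
    assert (k * J <= k * (4 * D * W))%R by (apply Rmult_le_compat_l; auto). lra.
  - assert (HW : (0 <= W)%R).
    { eapply Rle_trans; [|apply Hln].
      rewrite <- ln_1. apply Rlt_le, ln_increasing; [lra|].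
      assert (0 < 4 / (D * c))%R; [|lra].
      apply Rdiv_lt_0_compat; [lra|apply Rmult_lt_0_compat; lra]. }
    (* The [D] from the primitive cancels the normalisation of the kernel, and [3 < PI] removes the
       last factor. *)
    replace (2 * (k * (4 * D * W)))%R with (4 * B * W * (3 / PI))%R
      by (unfold k; field; lra).
    rewrite <- (Rmult_1_r (4 * B * W)) at 2.
    apply Rmult_le_compat_l; [apply Rmult_le_pos; lra|].
    apply Rmult_le_reg_r with PI; auto. unfold Rdiv. rewrite Rmult_assoc, Rinv_l; lra.
Qed.

(** The factor [exp (- l z)] shifts the parameter of each Perron kernel by [l]; the difference of
    the two resulting ramps, divided by [q - p], is the trapezoid. *)
Lemma trapezoid_transform (p q c l : R) : (0 <= p < q)%R -> (0 < c)%R ->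
  exists A, (0 <= A)%R /\ forall T, (1 <= T)%R ->
    (Cmod (CInt (fun y => Cexp (- (l * (c, y)%R)) * trapezoid_kernel p q (c, y))%C (- T) T
       - RtoC ((Rmax 0 (q - l) - Rmax 0 (p - l)) / (q - p)))%C <= A / T)%R.
Proof.
  intros Hpq Hc. pose proof PI_RGT_0 as Hpi.
  assert (HD : (0 < 2 * PI * (q - p))%R) by (apply Rmult_lt_0_compat; lra).
  set (k := (/ (2 * PI * (q - p)))%R). assert (Hk : (0 < k)%R) by (apply Rinv_0_lt_compat; auto).
  destruct (perron_formula (q - l) c Hc) as [A1 [HA1 H1]].
  destruct (perron_formula (p - l) c Hc) as [A2 [HA2 H2]].
  exists (k * (A1 + A2))%R. split; [apply Rmult_le_pos; lra|].
  intros T HT. specialize (H1 T HT). specialize (H2 T HT).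
  assert (Hcont : forall nu, ccont_on (fun y => perron_kernel nu (c, y)) (- T) T).
  { intros nu y _. apply ccont_V, cdiff_perron_kernel, pair_neq_0. left; lra. }
  assert (Hmul : forall nu z, Cexp (- (l * z)) * perron_kernel nu z = perron_kernel (nu - l)%R z).
  { intros nu z. unfold perron_kernel. rewrite Cmult_assoc, <- Cexp_plus. f_equal. f_equal.
    rewrite RtoC_minus. ring. }
  assert (E : CInt (fun y => Cexp (- (l * (c, y)%R)) * trapezoid_kernel p q (c, y)) (- T) T =
    RtoC k * (CInt (fun y => perron_kernel (q - l) (c, y)) (- T) T
      + (- (1)) * CInt (fun y => perron_kernel (p - l) (c, y)) (- T) T)).
  { rewrite <- CInt_scal, <- CInt_plus, <- CInt_scal;
      auto using ccont_on_plus, ccont_on_scal; try lra.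
    apply CInt_ext; [lra|]. intros y _. rewrite <- !Hmul. unfold trapezoid_kernel, k.
    rewrite RtoC_inv by lra. ring. }
  rewrite E.
  set (I1 := CInt (fun y => perron_kernel (q - l) (c, y)) (- T) T) in *.
  set (I2 := CInt (fun y => perron_kernel (p - l) (c, y)) (- T) T) in *.
  assert (Ev : RtoC ((Rmax 0 (q - l) - Rmax 0 (p - l)) / (q - p)) =
    RtoC k * (RtoC (2 * PI * Rmax 0 (q - l)) - RtoC (2 * PI * Rmax 0 (p - l)))).
  { rewrite <- RtoC_minus, <- RtoC_mult. f_equal. unfold k. field. lra. }
  rewrite Ev.
  replace (_ - _) with (RtoC k * ((I1 - RtoC (2 * PI * Rmax 0 (q - l)))
    - (I2 - RtoC (2 * PI * Rmax 0 (p - l))))) by ring.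
  rewrite Cmod_mult, Cmod_R, Rabs_pos_eq by lra.
  replace (k * (A1 + A2) / T)%R with (k * (A1 / T + A2 / T))%R by (field; lra).
  apply Rmult_le_compat_l; [lra|].
  eapply Rle_trans; [apply Cmod_triangle_minus|]. lra.
Qed.

(** Only the indices strictly between [N] and [m] contribute to the difference, each at most [M]. *)
Lemma csum_truncation_le (d : nat -> C) (v : nat -> R) (M : R) (N m n : nat) :
  (N < m <= n)%nat -> (forall j, (Cmod (d j) <= M)%R) ->
  (forall j, (j <= N)%nat -> v j = 1%R) -> (forall j, (Rabs (v j) <= 1)%R) ->
  (forall j, (m <= j)%nat -> v j = 0%R) ->
  (Cmod (csum (fun j => d j * v j)%C n - csum d N)%C <= M * (INR m - INR N))%R.
Proof.
  intros HNm Hd H1 Hv H0.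
  assert (HM : (0 <= M)%R) by (eapply Rle_trans; [apply Cmod_ge_0|apply (Hd O)]).
  (* The minimum freezes the bound once the upper index has passed [m], so one induction treats both
     ranges. *)
  assert (K : forall i, (Cmod (csum (fun j => d j * v j)%C (N + i) - csum d N)%C
    <= M * (INR (Nat.min (N + i) m) - INR N))%R).
  { induction i as [|i IH].
    - rewrite Nat.add_0_r, Nat.min_l by lia.
      rewrite (csum_ext (fun j => d j * v j) d).
      + replace (csum d N - csum d N) with (RtoC 0) by ring. rewrite Cmod_0; lra.
      + intros j Hj. rewrite H1 by auto. ring.
    - rewrite Nat.add_succ_r, csum_S.
      replace (_ - _) with ((csum (fun j => d j * v j) (N + i) - csum d N)
        + d (S (N + i)) * v (S (N + i))) by ring.
      eapply Rle_trans; [apply Cmod_triangle|]. rewrite (Cmod_mult (d _)), Cmod_R.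
      destruct (Nat.le_gt_cases m (S (N + i))) as [Hm|Hm].
      + rewrite (H0 _ Hm), Rabs_R0, Rmult_0_r, Rplus_0_r.
        eapply Rle_trans; [apply IH|]. apply Rmult_le_compat_l; auto.
        apply Rplus_le_compat_r. apply le_INR. lia.
      + rewrite Nat.min_l in IH |- * by lia. rewrite S_INR.
        specialize (Hd (S (N + i))). specialize (Hv (S (N + i))).
        assert (Cmod (d (S (N + i))) * Rabs (v (S (N + i))) <= M * 1)%R.
        { apply Rmult_le_compat; auto using Cmod_ge_0, Rabs_pos. }
        lra. }
  specialize (K (n - N)%nat). replace (N + (n - N))%nat with n in K by lia.
  rewrite Nat.min_r in K by lia. exact K.
Qed.

Lemma dirichlet_partial_sum_bound (lam : nat -> R) (a : nat -> C) (f : C -> C) (B : R)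
    (s : C) (N m : nat) :
  is_frequency lam -> (exists s0, dirichlet_converges lam a s0) ->
  (forall z, (0 < Re z)%R -> cdiff f z) ->
  (forall z, (0 < Re z)%R -> (Cmod (f z) <= B)%R) ->
  (forall z, (0 < Re z)%R -> Rbar_lt (abscissa_conv lam a) (Re z) ->
     dirichlet_is_sum lam a z (f z)) ->
  (0 < Re s)%R -> (N < m)%nat ->
  (Cmod (csum (dirichlet_term lam a s) N)
     <= 25 * B * (ln ((lam m + lam N) / (lam m - lam N)) + (INR m - INR N)))%R.
Proof.
  intros Hf Hconv Hhol HB Hsum Hs HNm.
  assert (Hp := proj1 Hf N). assert (Hpq := frequency_lt lam Hf N m HNm).
  assert (Hmon := frequency_le lam Hf).
  set (p := lam N) in *. set (q := lam m) in *.
  assert (Hpq' : (0 <= p < q)%R) by lra.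
  assert (HB0 : (0 <= B)%R) by (eapply Rle_trans; [apply Cmod_ge_0|apply (HB s Hs)]).
  set (c := (/ q)%R). assert (Hc : (0 < c)%R) by (apply Rinv_0_lt_compat; lra).
  assert (Hqc : (q * c = 1)%R) by (unfold c; field; lra).
  pose proof PI_RGT_0 as Hpi.
  set (kap := (/ (PI * (q - p)))%R).
  assert (Hkap : (0 < kap)%R).
  { apply Rinv_0_lt_compat, Rmult_lt_0_compat; lra. }
  set (L := ln ((q + p) / (q - p))).
  destruct (frequency_large lam (2 * q) Hf) as [N' HN'].
  (* Far enough for [lam (S n) > 2 * q], because the tail decays at half rate only, and at least
     [m], so that the whole trapezoid is seen. *)
  set (n := (N' + m)%nat).
  set (v := fun j => ((Rmax 0 (q - lam j) - Rmax 0 (p - lam j)) / (q - p))%R).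
  assert (Hv : forall j, (0 <= v j <= 1)%R).
  { intros j. unfold v. split.
    - apply Rmult_le_pos; [|apply Rlt_le, Rinv_0_lt_compat; lra].
      unfold Rmax. destruct (Rle_dec _ _), (Rle_dec _ _); lra.
    - apply Rmult_le_reg_r with (q - p)%R; [lra|].
      unfold Rdiv. rewrite Rmult_assoc, Rinv_l by lra.
      unfold Rmax. destruct (Rle_dec _ _), (Rle_dec _ _); lra. }
  assert (H : (Cmod (csum (fun j => dirichlet_term lam a s j * v j)%C n) <= 4 * B * (4 + L))%R).
  { apply (kernel_extraction lam a f B s c q kap (4 * B * (4 + L))
      (fun _ => trapezoid_kernel p q) (fun j => RtoC (v j)) n); auto; try lra.
    - apply HN'; unfold n; lia.
    - intros T z _ Hz. apply cdiff_trapezoid_kernel. intros E; subst z.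
      unfold Re in Hz; simpl in Hz; lra.
    - intros T x y HT Hx Hy.
      eapply Rle_trans; [apply trapezoid_kernel_le with (r := T); auto; lra|]. fold kap.
      apply Rmult_le_compat_r; [apply Rlt_le, exp_pos|].
      apply Rmult_le_compat_l; [lra|]. apply Rinv_le_contravar; nra.
    (* Here [y] may vanish, so the distance from the pole is taken from [Re z >= c]. *)
    - intros T HT. exists (kap / c ^ 2)%R. split.
      { apply Rmult_le_pos; [lra|apply Rlt_le, Rinv_0_lt_compat, pow_lt; auto]. }
      intros x y Hx _. apply trapezoid_kernel_le; auto; try lra.
      left. rewrite Rabs_pos_eq; lra.
    - intros j. apply trapezoid_transform; auto.
    - intros T HT. apply (trapezoid_integral_le (fun z => f (s + z))); auto; try lra.
      + intros z Hz. apply cdiff_shift, Hhol. unfold Re, Cplus in *; simpl; lra.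
      + intros z Hz. apply HB. unfold Re, Cplus in *; simpl; lra. }
  assert (HT : (Cmod (csum (fun j => dirichlet_term lam a s j * v j)%C n
     - csum (dirichlet_term lam a s) N)%C <= 9 * B * (INR m - INR N))%R).
  { apply csum_truncation_le.
    - unfold n; lia.
    - intros j. eapply Rle_trans; [apply Cmod_dirichlet_term_le; auto; lra|].
      apply dirichlet_coeff_bound with lam f; auto.
    - intros j Hj. specialize (Hmon j N Hj). fold p in Hmon. unfold v.
      rewrite !Rmax_right by lra. field. lra.
    - intros j. destruct (Hv j). rewrite Rabs_pos_eq; auto.
    - intros j Hj. specialize (Hmon m j Hj). fold q in Hmon. unfold v.
      rewrite !Rmax_left by lra. unfold Rdiv; ring. }
  assert (HL : (0 <= L)%R).
  { unfold L. rewrite <- ln_1. apply ln_le; [lra|].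
    apply Rmult_le_reg_r with (q - p)%R; [lra|].
    unfold Rdiv. rewrite Rmult_assoc, Rinv_l; lra. }
  assert (HI : (1 <= INR m - INR N)%R).
  { apply le_INR in HNm. rewrite S_INR in HNm. lra. }
  set (U := csum (fun j => dirichlet_term lam a s j * v j) n) in *.
  set (S := csum (dirichlet_term lam a s) N) in *.
  replace S with (U - (U - S)) by ring.
  eapply Rle_trans; [apply Cmod_triangle_minus|].
  (* Since [m - N >= 1], the constant [16 B] is absorbed in the gap, and [25 = 16 + 9]. *)
  assert (4 * B * (4 + L) + 9 * B * (INR m - INR N) <= 25 * B * (L + (INR m - INR N)))%R; [|lra].
  assert (0 <= B * L)%R by (apply Rmult_le_pos; auto).
  assert (B * 1 <= B * (INR m - INR N))%R by (apply Rmult_le_compat_l; auto).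
  lra.
Qed.

(** * Uniform convergence *)

(** The error depends on the smaller index alone, so it survives letting the larger one tend to
    infinity. The real and imaginary parts are handled at once through an abstract projection
    [pr]. *)
Lemma uniform_limit_of_cauchy (F : nat -> C -> C) (U : C -> Prop) (e : nat -> R) :
  (forall n m s, U s -> (n < m)%nat -> (Cmod (F m s - F n s)%C <= e n)%R) ->
  (forall eta, (0 < eta)%R -> exists N, forall n, (N <= n)%nat -> (e n < eta)%R) ->
  exists g : C -> C, forall eta, (0 < eta)%R -> exists N0, forall N, (N0 <= N)%nat ->
    forall s, U s -> (Cmod (F N s - g s)%C < eta)%R.
Proof.
  intros HF He.
  assert (Hlim : forall (pr : C -> R), (forall z w, pr z - pr w = pr (z - w)%C)%R ->
    (forall z, Rabs (pr z) <= Cmod z)%R ->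
    forall s, U s -> forall n, (Rabs (pr (F n s) - real (Lim_seq (fun k => pr (F k s)))) <= e n)%R).
  { intros pr Hpr1 Hpr2 s Hs n.
    assert (Hc : forall i j, (i < j)%nat -> (Rabs (pr (F j s) - pr (F i s)) <= e i)%R).
    { intros i j Hij. rewrite Hpr1. eapply Rle_trans; [apply Hpr2|]. auto. }
    assert (Hex : ex_finite_lim_seq (fun k => pr (F k s))).
    { apply ex_lim_seq_cauchy_corr. intros eps.
      destruct (He (eps / 2)%R) as [N HN]; [destruct eps; simpl; lra|].
      exists (S N). intros i j Hi Hj.
      pose proof (Hc N i ltac:(lia)). pose proof (Hc N j ltac:(lia)).
      specialize (HN N (le_n N)).
      replace (pr (F i s) - pr (F j s))%R with
        ((pr (F i s) - pr (F N s)) + - (pr (F j s) - pr (F N s)))%R by ring.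
      eapply Rle_lt_trans; [apply Rabs_triang|]. rewrite Rabs_Ropp. lra. }
    apply Lim_seq_correct' in Hex. apply le_epsilon. intros eps Heps.
    apply is_lim_seq_spec in Hex. destruct (Hex (mkposreal eps Heps)) as [N HN].
    simpl in HN. specialize (HN (N + S n)%nat ltac:(lia)).
    pose proof (Hc n (N + S n)%nat ltac:(lia)) as Hd.
    set (l := real (Lim_seq (fun k => pr (F k s)))) in *.
    replace (pr (F n s) - l)%R with
      ((pr (F (N + S n)%nat s) - l) + - (pr (F (N + S n)%nat s) - pr (F n s)))%R by ring.
    eapply Rle_trans; [apply Rabs_triang|]. rewrite Rabs_Ropp. lra. }
  exists (fun s => (real (Lim_seq (fun k => Re (F k s))), real (Lim_seq (fun k => Im (F k s))))).
  intros eta Heta. destruct (He (eta / 2)%R) as [N0 HN0]; [lra|].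
  exists N0. intros N HN s Hs. specialize (HN0 N HN).
  eapply Rle_lt_trans; [apply Cmod_le_Re_Im|].
  assert (H1 := Hlim Re (fun _ _ => eq_refl) Re_le_Cmod s Hs N).
  assert (H2 := Hlim Im (fun _ _ => eq_refl) Im_le_Cmod s Hs N).
  set (l1 := real (Lim_seq (fun k => Re (F k s)))) in *.
  set (l2 := real (Lim_seq (fun k => Im (F k s)))) in *.
  change (Re (F N s - (l1, l2))) with (Re (F N s) - l1)%R.
  change (Im (F N s - (l1, l2))) with (Im (F N s) - l2)%R. lra.
Qed.

(** A shift by twice the growth rate leaves decay. With [P k = exp (- (delta * lam k))], Abel terms
    are at most [2 K (P k ^ 2 - P (S k) ^ 2) / P k], hence at most [4 K (P k - P (S k))], which
    telescopes. The shift is real, so no Stolz ratio appears and the bound is uniform in [s]. *)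
Lemma dirichlet_uniform_cauchy (lam : nat -> R) (a : nat -> C) (s : C) (K delta : R)
    (n m : nat) :
  is_frequency lam -> (0 < delta)%R -> (0 <= K)%R ->
  (forall k, (Cmod (csum (dirichlet_term lam a s) k) <= K * exp (delta * lam k))%R) ->
  (n < m)%nat ->
  (Cmod (csum (dirichlet_term lam a (s + (2 * delta)%R)) m
     - csum (dirichlet_term lam a (s + (2 * delta)%R)) n)%C <= 4 * K * exp (- (delta * lam n)))%R.
Proof.
  intros Hf Hdelta HK HS Hnm.
  assert (Hmon := frequency_le lam Hf).
  set (b := dirichlet_term lam a s) in *.
  set (c := fun k => Cexp (- (lam k * (2 * delta)%R))).
  assert (E : forall k, csum (dirichlet_term lam a (s + (2 * delta)%R)) k
    = csum (fun k => b k * c k) k).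
  { intros k. apply csum_ext. intros; apply dirichlet_term_shift. }
  rewrite !E.
  set (P := fun k => exp (- (delta * lam k))).
  assert (HP : forall k, (0 < P k)%R) by (intros; apply exp_pos).
  assert (HPe : forall k, exp (delta * lam k) = (/ P k)%R).
  { intros k. unfold P. rewrite exp_Ropp, Rinv_inv. auto. }
  assert (HP2 : forall k, exp (- (2 * delta * lam k)) = (P k * P k)%R).
  { intros k. unfold P. rewrite <- exp_plus. f_equal. ring. }
  assert (HPm : forall i j, (i <= j)%nat -> (P j <= P i)%R).
  { intros i j Hij. apply exp_le_compat. specialize (Hmon i j Hij). nra. }
  assert (Hc : forall k, Cmod (c k) = (P k * P k)%R).
  { intros k. unfold c. rewrite Cmod_Cexp, <- HP2. f_equal.
    unfold Re, Copp, Cmult, RtoC; simpl; ring. }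
  assert (Hdc : forall k, (Cmod (c (S k) - c k)%C <= P k * P k - P (S k) * P (S k))%R).
  { intros k. eapply Rle_trans; [apply Cexp_increment_le|].
    - unfold Re, RtoC; simpl; lra.
    - apply Hmon; lia.
    - change (Re (RtoC (2 * delta))) with (2 * delta)%R.
      rewrite Cmod_R, Rabs_pos_eq by lra. rewrite !HP2. right. field. lra. }
  assert (HV : forall k, (n < k)%nat -> (Cmod (csum b k - csum b n)%C <= 2 * K / P k)%R).
  { intros k Hk. eapply Rle_trans; [apply Cmod_triangle_minus|].
    pose proof (HS k) as H1. pose proof (HS n) as H2. rewrite HPe in H1, H2.
    assert (/ P n <= / P k)%R by (apply Rinv_le_contravar; auto; apply HPm; lia).
    assert (K * / P n <= K * / P k)%R by (apply Rmult_le_compat_l; auto).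
    unfold Rdiv. lra. }
  assert (Hgam : forall k, (n < k)%nat ->
    (Cmod (csum b k - csum b n)%C * Cmod (c (S k) - c k)%C <= 4 * K * P k - 4 * K * P (S k))%R).
  { intros k Hk.
    apply Rle_trans with (2 * K / P k * (P k * P k - P (S k) * P (S k)))%R.
    - apply Rmult_le_compat; auto using Cmod_ge_0.
    - apply Rmult_le_reg_r with (P k); auto.
      replace (2 * K / P k * (P k * P k - P (S k) * P (S k)) * P k)%R with
        (2 * K * ((P k - P (S k)) * (P k + P (S k))))%R by (field; pose proof (HP k); lra).
      replace ((4 * K * P k - 4 * K * P (S k)) * P k)%R with
        (2 * K * ((P k - P (S k)) * (2 * P k)))%R by ring.
      pose proof (HPm k (S k) ltac:(lia)).
      apply Rmult_le_compat_l; [lra|]. apply Rmult_le_compat_l; lra. }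
  destruct (Nat.le_exists_sub (S n) m) as [j [Hj _]]; [lia|].
  replace m with (n + S j)%nat in * by lia.
  pose proof (abel_bound b c (fun k => 4 * K * P k)%R n Hgam j) as HA. cbv beta in HA.
  set (T := csum (fun k => b k * c k) (n + S j) - csum (fun k => b k * c k) n) in *.
  set (V := csum b (n + S j) - csum b n) in *.
  assert (HVc : (Cmod (V * c (n + S j)%nat)%C <= 2 * K * P (n + S j)%nat)%R).
  { rewrite Cmod_mult, Hc. pose proof (HP (n + S j)%nat).
    replace (2 * K * P (n + S j)%nat)%R with
      (2 * K / P (n + S j)%nat * (P (n + S j)%nat * P (n + S j)%nat))%R by (field; lra).
    apply Rmult_le_compat_r; [apply Rmult_le_pos; lra|]. apply HV; lia. }
  replace T with ((T - V * c (n + S j)%nat) + V * c (n + S j)%nat) by ring.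
  eapply Rle_trans; [apply Cmod_triangle|].
  assert (K * P (S n) <= K * P n)%R by (apply Rmult_le_compat_l; auto).
  assert (0 <= K * P (n + S j)%nat)%R by (apply Rmult_le_pos; auto; apply Rlt_le; auto).
  fold (P n). lra.
Qed.

Theorem corollary3p3 (lam : nat -> R) (hfreq : is_frequency lam)
    (hNC : condition_NC lam) : satisfies_Bohr_theorem lam.
Proof.
  intros a [Hconv [f [Hhol [[B HB] Hsum]]]] eps Heps.
  assert (Hdiff : forall z, (0 < Re z)%R -> cdiff f z).
  { intros z Hz. apply cdiff_of_ex_derive, Hhol, Hz. }
  assert (HB0 : (0 <= B)%R).
  { eapply Rle_trans; [apply Cmod_ge_0|apply (HB 1)]. unfold half_plane, Re; simpl; lra. }
  (* A point of [half_plane eps] can be moved left by [eps] and stay in the right half-plane. The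
     shift has to be twice the growth rate, hence [eps / 2]. *)
  destruct (hNC (eps / 2)%R) as [C0 [HC0 HNC]]; [lra|].
  set (K := (25 * B * C0)%R).
  assert (HK : (0 <= K)%R) by (repeat apply Rmult_le_pos; lra).
  assert (HS : forall s, (0 < Re s)%R -> forall k,
    (Cmod (csum (dirichlet_term lam a s) k) <= K * exp (eps / 2 * lam k))%R).
  (* The index [m] varies with [k], while the constants [C0] and [B], hence [K], depend on neither
     [k] nor [s]. *)
  { intros s Hs k. destruct (HNC k) as [m [Hm Hle]].
    eapply Rle_trans; [apply dirichlet_partial_sum_bound with (f := f) (B := B) (m := m); auto|].
    unfold K. rewrite (Rmult_assoc _ C0). apply Rmult_le_compat_l; lra. }
  apply (uniform_limit_of_cauchy (fun n s => csum (dirichlet_term lam a s) n) (half_plane eps)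
    (fun n => 4 * K * exp (- (eps / 2 * lam n)))%R).
  - intros n m s Hs Hnm. replace s with ((s - eps) + (2 * (eps / 2))%R).
    + apply dirichlet_uniform_cauchy; auto; [lra|]. intros k. apply HS.
      unfold half_plane, Re, Cminus, Cplus, Copp, RtoC in *; simpl; lra.
    + replace (2 * (eps / 2))%R with eps by field. ring.
  - intros eta Heta.
    destruct (exp_decay_small (4 * K) (eps / 2) (eta / 2)) as [X0 HX0]; try lra.
    destruct (frequency_large lam X0 hfreq) as [N HN].
    exists N. intros n Hn. eapply Rle_lt_trans; [apply HX0, Rlt_le, HN; auto|]. lra.
Qed.
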